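(* Let $(\beta_n,h_n)_{n\ge 1}$ be a sequence of pairs of real numbers with $(\beta_n,h_n)\to(\beta,h)$, where $\beta,h\ge 0$ and $(\beta,h)\ne(\beta_0,h_0)$. Assume that the free energy $f_{\beta,h}$ has a unique global minimizer $\boldsymbol{x}=(x_1,x_q,\ldots,x_q)$ in $\Omega$. For every $n$, let $\boldsymbol{d}_n$ be the smallest (in norm) $\boldsymbol{d}\in\mathcal{H}$ such that $\boldsymbol{x}+\boldsymbol{d}\in\Omega$ is a local minimizer of $f_{\beta_n,h_n}$. Let $\boldsymbol{W}$ be the random variable in $\mathcal{H}$ defined by $$\boldsymbol{N}=n\boldsymbol{x}+n\boldsymbol{d}_n+n^{1/2}\boldsymbol{W},$$ where $\boldsymbol{N}$ is distributed according to $\mu_{\beta_n,h_n,n}$. Then, as $n\to\infty$, $\boldsymbol{W}$ converges in law to the centered Gaussian vector with covariance matrix $$\left(\frac{1}{x_1x_q}-q\beta\right)^{-1}\begin{pmatrix} q-1 & -1 & \cdots & -1\\ -1 & 1+(q-2)\rho & & -\rho\\ \vdots & & \ddots & \\ -1 & -\rho & & 1+(q-2)\rho\end{pmatrix},\qquad \rho=\frac{\frac1{x_1}-\beta}{\frac1{x_q}-\beta},$$ (that is, inside the matrix: the $(1,1)$ entry is $q-1$; the $(1,i)$ and $(i,1)$ entries are $-1$ for $i\ge2$; the $(i,i)$ entries are $1+(q-2)\rho$ for $i\ge 2$; the $(i,j)$ entries are $-\rho$ for $i\ne j$, $i,j\ge2$), and this matrix has rank $q-1$.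
   Context: $q\ge 2$ is a fixed integer. The Curie-Weiss Potts model: for $n\ge1$ and real $\beta,h$, $\mu_{\beta,h,n}$ is the probability measure on $\{1,\ldots,q\}^n$ given by $$\mu_{\beta,h,n}(\sigma)=\frac1{Z_{\beta,h,n}}\exp\Big(\frac{\beta}{n}\sum_{1\le i<j\le n}\delta_{\sigma_i,\sigma_j}+h\sum_{i=1}^n\delta_{\sigma_i,1}\Big),$$ with $\delta$ the Kronecker symbol and $Z_{\beta,h,n}$ the normalizing constant. The empirical vector is $\boldsymbol{N}=(N_1,\ldots,N_q)$ with $N_k=\sum_{i=1}^n\delta_{\sigma_i,k}$. $\Omega=\{\boldsymbol{x}\in\mathbb{R}^q: x_1+\cdots+x_q=1,\ x_i\ge0\ \forall i\}$. The free energy is $f_{\beta,h}(\boldsymbol{x})=\sum_{i=1}^q x_i\log x_i-\frac{\beta}{2}\sum_{i=1}^q x_i^2-hx_1$ for $\boldsymbol{x}\in\Omega$, with $0\log0=0$; its (global or local) minimizers are understood in $\Omega$. $\mathcal{H}=\{\boldsymbol{w}\in\mathbb{R}^q:\sum_{i=1}^q w_i=0\}$. Finally $\beta_0=4\frac{q-1}{q}$ and $h_0=\log(q-1)-2\frac{q-2}{q}$. *)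

(* Defs.v *)
From HB Require Import structures.
From mathcomp Require Import all_boot all_order all_algebra.
From mathcomp Require Import all_classical all_reals all_analysis.

Set Implicit Arguments.
Unset Strict Implicit.
Unset Printing Implicit Defensive.

Import Order.TTheory GRing.Theory Num.Theory.
Import numFieldNormedType.Exports.

Local Open Scope classical_set_scope.
Local Open Scope ring_scope.

(* Throughout, q = p.+2 ranges over the integers q >= 2; the spins 1, ..., q
   are the elements of 'I_p.+2, spin 1 being ord0. *)

(* A copy of the type of configurations, carrying the discrete sigma-algebra. *)
Definition config (p n : nat) := {ffun 'I_n -> 'I_p.+2}.

HB.instance Definition _ p n := Finite.on (config p n).
HB.instance Definition _ p n := isPointed.Build (config p n) [ffun=> ord0].
HB.instance Definition _ p n := @isMeasurable.Build default_measure_display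
  (config p n) discrete_measurable discrete_measurable0
  discrete_measurableC discrete_measurableU.

Section curie_weiss_potts.
Context {R : realType}.
Variables (p : nat) (beta h : R) (n : nat).

Definition potts_exponent (s : config p n) : R :=
  beta / n%:R * (\sum_(i < n) \sum_(j < n | (i < j)%N) (s i == s j)%:R)
  + h * \sum_(i < n) (s i == ord0)%:R.

Definition potts_Z : R := \sum_(s : config p n) expR (potts_exponent s).

Definition potts_pmf (s : config p n) : R := expR (potts_exponent s) / potts_Z.

Definition potts : set (config p n) -> \bar R :=
  fun A => (\esum_(s in A) (potts_pmf s)%:E)%E.

Lemma potts_Z_gt0 : 0 < potts_Z.
Proof.
rewrite /potts_Z (bigD1 (point : config p n))//= ltr_pwDl ?expR_gt0//.
by apply: sumr_ge0 => s _; exact: expR_ge0.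
Qed.

Lemma potts_pmf_ge0 s : 0 <= potts_pmf s.
Proof. by rewrite divr_ge0 ?expR_ge0// ltW// potts_Z_gt0. Qed.

Lemma sum_potts_pmf : \sum_(s : config p n) potts_pmf s = 1.
Proof. by rewrite -mulr_suml divff// gt_eqF// potts_Z_gt0. Qed.

Let potts0 : potts set0 = 0%E.
Proof. by rewrite /potts esum_set0. Qed.

Let potts_ge0 A : (0 <= potts A)%E.
Proof. by apply: esum_ge0 => s _; rewrite lee_fin potts_pmf_ge0. Qed.

Let potts_sigma_additive : semi_sigma_additive potts.
Proof.
move=> F mF tF mUF; rewrite /potts; apply: cvg_toP.
  apply: ereal_nondecreasing_is_cvgn => a b ab.
  by apply: lee_sum_nneg_natr => // k _ _; exact: potts_ge0.
by rewrite nneseries_sum_bigcup// => s; rewrite lee_fin potts_pmf_ge0.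
Qed.

HB.instance Definition _ := isMeasure.Build _ _ _ potts
  potts0 potts_ge0 potts_sigma_additive.

Let potts_setT : potts [set: _] = 1%E.
Proof.
rewrite /potts esum_fset; last 2 first.
- exact: finite_finset.
- by move=> s _; rewrite lee_fin potts_pmf_ge0.
have -> : [set: config p n] = [set` index_enum (config p n)].
  by apply/seteqP; split => // s _ /=; rewrite mem_index_enum.
by rewrite -fsbig_seq ?index_enum_uniq// sumEFin sum_potts_pmf.
Qed.

HB.instance Definition _ := @Measure_isProbability.Build _ _ R potts potts_setT.

End curie_weiss_potts.

Arguments potts {R p} beta h n A.

Definition empirical_vector (R : realType) (p n : nat) (s : config p n) :
    'rV[R]_p.+2 :=
  \row_k \sum_(i < n) (s i == k)%:R.

Section free_energy.
Context {R : realType} {p : nat}.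
Implicit Types (beta h : R) (x d w : 'rV[R]_p.+2).

Definition Omega : set 'rV[R]_p.+2 :=
  [set x | \sum_i x 0 i = 1 /\ forall i, 0 <= x 0 i].

(* The convention 0 log 0 = 0 holds since x 0 i = 0 annihilates the product. *)
Definition free_energy beta h x : R :=
  \sum_i x 0 i * ln (x 0 i) - beta / 2 * \sum_i x 0 i ^+ 2 - h * x 0 ord0.

Definition global_minimizer beta h x :=
  Omega x /\ forall y, Omega y -> free_energy beta h x <= free_energy beta h y.

Definition local_minimizer beta h x :=
  Omega x /\
  \forall y \near x, Omega y -> free_energy beta h x <= free_energy beta h y.

Definition sum_zero : set 'rV[R]_p.+2 := [set w | \sum_i w 0 i = 0].

(* The norm of the library on matrices is the sup norm. *)
Definition euclidean_norm w : R := Num.sqrt (\sum_i w 0 i ^+ 2).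

Definition minimizer_shift beta h x d :=
  sum_zero d /\ local_minimizer beta h (x + d).

Definition smallest_minimizer_shift beta h x d :=
  minimizer_shift beta h x d /\
  forall d', minimizer_shift beta h x d' ->
    euclidean_norm d <= euclidean_norm d'.

End free_energy.

Definition beta0 (R : realType) (p : nat) : R :=
  4 * ((p.+2%:R - 1) / p.+2%:R).

Definition h0 (R : realType) (p : nat) : R :=
  ln (p.+2%:R - 1) - 2 * ((p.+2%:R - 2) / p.+2%:R).

(* The vector (x1, xq, ..., xq). *)
Definition two_valued (R : realType) (p : nat) (x1 xq : R) : 'rV[R]_p.+2 :=
  \row_i (if i == ord0 then x1 else xq).

Definition limit_covariance (R : realType) (p : nat) (beta x1 xq : R) :
    'M[R]_p.+2 :=
  let rho := (x1^-1 - beta) / (xq^-1 - beta) in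
  ((x1 * xq)^-1 - p.+2%:R * beta)^-1 *:
  \matrix_(i, j)
    (if (i == ord0) && (j == ord0) then p.+2%:R - 1
     else if (i == ord0) || (j == ord0) then -1
     else if i == j then 1 + (p.+2%:R - 2) * rho
     else - rho).

Section random_vectors.
Context {R : realType} {m : nat}.

Definition random_vector {d} {T : measurableType d} (X : T -> 'rV[R]_m) :=
  forall i, measurable_fun [set: T] (fun t => X t 0 i).

(* The law N(0, v) on the line. The degenerate case is separate because
   normal_prob _ 0 is the uniform law on [0, 1]. *)
Definition centered_normal (v : R) : set R -> \bar R :=
  if v == 0 then dirac (0 : R) else normal_prob 0 (Num.sqrt v).

(* G has law N(0, S): every linear form <u, G> has law N(0, u S u^T). S may be
   singular. *)
Definition centered_gaussian_vector {d} {T : measurableType d}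
    (P : probability T R) (S : 'M[R]_m) (G : T -> 'rV[R]_m) :=
  random_vector G /\
  forall (u : 'rV[R]_m) (A : set R), measurable A ->
    P [set t | A ((G t *m u^T) 0 0)] =
    centered_normal ((u *m S *m u^T) 0 0) A.

Definition converges_in_law {d : nat -> measure_display}
    {T : forall n, measurableType (d n)} (P : forall n, probability (T n) R)
    (X : forall n, T n -> 'rV[R]_m)
    {d'} {T' : measurableType d'} (P' : probability T' R)
    (Y : T' -> 'rV[R]_m) :=
  forall g : 'rV[R]_m -> R, continuous g -> bounded_fun g ->
    ('E_(P n)[g \o X n] @[n --> \oo] --> 'E_P'[g \o Y])%E.

End random_vectors.

(* Main.v *)
Require Import Defs.
From mathcomp Require Import all_boot all_order all_algebra.
From mathcomp Require Import ring lra zify.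
From mathcomp Require Import all_classical all_reals all_analysis.
From mathcomp Require Import measurable_realfun.

Set Implicit Arguments.
Unset Strict Implicit.
Unset Printing Implicit Defensive.

Import Order.TTheory GRing.Theory Num.Theory.
Import numFieldNormedType.Exports.

Local Open Scope classical_set_scope.
Local Open Scope ring_scope.

(** The exponent of the model depends on a configuration only through its
    occupation numbers [K], so the law of [W] is a multinomial coefficient times
    a Boltzmann weight. Writing [k! = F k * (k / e) ^ k] with [F k ~ a * sqrt k],
    this product is exactly
    [F n / \prod_i F (K i) * exp (- n * f (K / n) - beta / 2)], where [f] is the
    free energy ([multinomial_weightE]). Expectations of functions of [W] are
    thus ratios of two lattice sums of Laplace type, of mesh [1 / sqrt n] around
    [y = x + d], in which every constant factor cancels
    ([potts_expectation_ratio]).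

    What makes each sum converge to a Gaussian integral is an exact expansion:
    [y] is an interior local minimizer, so its gradient vanishes on the tangent
    space, and for [z] in the simplex
    [f z - f y = \sum_i y i * psi ((z i - y i) / y i) - beta / 2 * |z - y| ^ 2]
    with [psi u = (1 + u) * ln (1 + u) - u] ([perturbed_energyB]). As
    [psi u ~ u ^ 2 / 2], the weights converge pointwise to the exponential of
    minus half the Hessian of the limiting free energy. They are dominated by a
    Gaussian because [f z - f y >= c * |z - y| ^ 2] on the whole simplex, with
    one [c] for all large [n] ([quadratic_growth]): near [x] the Hessian is
    coercive, and far from [x] uniqueness of the minimizer and compactness leave
    a gap. Dominated convergence, one coordinate at a time, then gives the limit
    as an iterated integral ([lattice_sum_cvg]).

    The Hessian is nonnegative on the tangent space at a minimizer, and wherever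
    it vanishes the third-order term must vanish too. In the direction that
    keeps the form [(x1, xq, ..., xq)] both can vanish only at the critical point
    [(beta0, h0)] ([radial_curvature_gt0]). In the direction exchanging mass
    between two of the last coordinates, vanishing means [beta = 1 / xq]; the
    first-order condition and [h >= 0] then force [x1 = xq], and the first
    direction would degenerate as well ([angular_curvature_gt0]).

    It remains to identify the limit. In the last [p.+1] coordinates the Hessian
    is a positive definite matrix [P]. Completing the square one coordinate at a
    time builds a random vector whose linear forms [bform P b] are centered
    normal of variance [bform P b b], and whose law has density proportional to
    [exp (- bform P w w / 2)] ([exists_gaussian]). Inverting [P], a multiple of
    the identity plus a rank-one matrix, gives the stated covariance on the
    sum-zero hyperplane ([precision_dual]); its kernel is the line of constant
    vectors, hence its rank. *)

(** * Limits of sums, products and row vectors *)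

Section convergence_tools.
Context {R : realType}.

Lemma cvg_sumr (T : Type) (F : set_system T) {FF : Filter F} (I : Type) (r : seq I)
    (f : I -> T -> R) (l : I -> R) :
  (forall i, f i t @[t --> F] --> l i) ->
  \sum_(i <- r) f i t @[t --> F] --> \sum_(i <- r) l i.
Proof.
move=> fl; elim: r => [|i r IH].
  by rewrite big_nil; under eq_fun do rewrite big_nil; exact: cvg_cst.
rewrite big_cons; under eq_fun do rewrite big_cons; exact: cvgD.
Qed.

Lemma cvg_prodr (T : Type) (F : set_system T) {FF : Filter F} (I : Type) (r : seq I)
    (f : I -> T -> R) (l : I -> R) :
  (forall i, f i t @[t --> F] --> l i) ->
  \prod_(i <- r) f i t @[t --> F] --> \prod_(i <- r) l i.
Proof.
move=> fl; elim: r => [|i r IH].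
  by rewrite big_nil; under eq_fun do rewrite big_nil; exact: cvg_cst.
rewrite big_cons; under eq_fun do rewrite big_cons; exact: cvgM.
Qed.

Lemma cvg_sqr (T : Type) (F : set_system T) {FF : Filter F} (f : T -> R) (l : R) :
  f t @[t --> F] --> l -> f t ^+ 2 @[t --> F] --> l ^+ 2.
Proof. by move=> fl; exact: (cvgM fl fl). Qed.

Lemma cvg_rV (T : Type) (F : set_system T) {FF : Filter F} n
    (f : T -> 'rV[R]_n) (l : 'rV[R]_n) :
  (forall i, f t 0 i @[t --> F] --> l 0 i) -> f t @[t --> F] --> l.
Proof.
move=> fl; apply/cvg_ballP => e e0.
have : \forall t \near F, forall i, ball (l 0 i) e (f t 0 i).
  apply: filter_forall => i; by have /cvg_ballP := fl i; apply.
by apply: filterS => t H; split=> // i j; rewrite ord1.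
Qed.

(** At 0, [ln u <= u] at [u = 1 / sqrt w] gives [|w * ln w| <= 2 * sqrt w]. *)
Lemma continuous_xlnx : continuous (fun v : R => v * ln v).
Proof.
move=> v; rewrite /continuous_at; have [v0|v0|->] := ltgtP v 0.
- have -> : v * ln v = 0 by rewrite ln0 ?mulr0// ltW.
  apply: cvg_near_cst; near=> w.
  by rewrite ln0 ?mulr0// ltW//; near: w; exact: lt_nbhsl.
- by apply: cvgM; [exact: cvg_id|exact: continuous_ln].
rewrite mul0r; apply: norm_cvg0.
apply: (@squeeze_cvgr _ _ _ _ (fun=> 0) (fun v : R => 2 * Num.sqrt `|v|)); last 2 first.
- exact: cvg_cst.
- rewrite -[X in _ --> X](_ : 2 * Num.sqrt `|0 : R| = 0); last by rewrite normr0 sqrtr0 mulr0.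
  apply: cvgM; first exact: cvg_cst.
  apply: (@continuous_comp _ _ _ (fun v : R => `|v|) Num.sqrt).
    exact: norm_continuous.
  exact: sqrt_continuous.
near=> w; rewrite normr_ge0/=.
have [w0|w0] := leP w 0; first by rewrite ln0// mulr0 normr0 mulr_ge0// sqrtr_ge0.
have w1 : w < 1 by near: w; exact: lt_nbhsl.
set s := Num.sqrt `|w|; have s0 : 0 < s by rewrite sqrtr_gt0 normr_gt0 gt_eqF.
have wE : w = s ^+ 2 by rewrite sqr_sqrtr// gtr0_norm.
rewrite normrM (ler0_norm (ln_le0 (ltW w1))) gtr0_norm// {1 2}wE lnXn//.
have := ln_sublinear (_ : 0 < s^-1); rewrite invr_gt0 => /(_ s0).
rewrite lnV ?posrE// => h.
have {}h : s * (- ln s) <= 1 by rewrite -(divff (lt0r_neq0 s0)) ler_pM2l// ltW.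
have := ler_wpM2l (ltW s0) h; lra.
Unshelve. all: by end_near. Qed.

Lemma exists_common_lb (I : finType) (f : I -> R) : (forall i, 0 < f i) ->
  exists2 e, 0 < e & forall i, e <= f i.
Proof.
move=> f0; have s0 : 0 <= \sum_i (f i)^-1.
  by apply: sumr_ge0 => i _; rewrite invr_ge0 ltW.
exists (1 + \sum_i (f i)^-1)^-1 => [|i]; first by rewrite invr_gt0 ltr_pwDl.
rewrite -[leRHS]invrK lef_pV2 ?posrE ?invr_gt0 ?ltr_pwDl//.
rewrite (bigD1 i)//= addrCA lerDl addr_ge0// sumr_ge0// => j _.
by rewrite invr_ge0 ltW.
Qed.

Local Notation s n := (Num.sqrt (n%:R : R)).

Lemma sqrtn_gt0 n : (0 < n)%N -> 0 < s n.
Proof. by move=> n0; rewrite sqrtr_gt0 ltr0n. Qed.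

Lemma sqrtn_cvgy : s n @[n --> \oo] --> +oo.
Proof.
apply/cvgryPge => A; near=> n.
have An : A ^+ 2 <= n%:R by near: n; exact: nbhs_infty_ger.
have [A0|A0] := leP A 0; first by rewrite (le_trans A0)// sqrtr_ge0.
by rewrite -(ger0_norm (ltW A0)) -sqrtr_sqr ler_sqrt.
Unshelve. all: by end_near. Qed.

Lemma invsqrtn_cvg0 : (s n)^-1 @[n --> \oo] --> (0 : R).
Proof.
apply/gtr0_cvgV0; last exact: sqrtn_cvgy.
by near=> n; apply: sqrtn_gt0; near: n; exact: nbhs_infty_gt.
Unshelve. all: by end_near. Qed.

End convergence_tools.

(** * Cubic and quartic bounds on the entropy function *)

Section entropy_deviation.
Context {R : realType}.
Implicit Types u t : R.

(** For [a, b > 0], [a * psi ((b - a) / a)] is [b * ln (b / a) - (b - a)], the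
    contribution of one coordinate to a relative entropy. *)
Definition psi u : R := (1 + u) * ln (1 + u) - u.

Lemma le_of_deriv_sign (f f' : R -> R) :
  (forall u, -1 < u -> is_derive u 1 f (f' u)) ->
  (forall u, -1 < u -> 0 <= u * f' u) ->
  forall u, -1 < u -> f 0 <= f u.
Proof.
move=> df sf u u1.
have N10 : -1 < 0 :> R by rewrite ltrN10.
have cf a b : -1 < a -> {within `[a, b], continuous f}.
  move=> a1; apply: derivable_within_continuous => z; rewrite in_itv/= => /andP[az _].
  by apply: ex_derive; apply: df; exact: lt_le_trans az.
have [u_lt0|u_gt0|->//] := ltgtP u 0.
- have [||c] := @MVT R f f' u 0 u_lt0.
  + by move=> z; rewrite in_itv/= => /andP[uz _]; apply: df; exact: lt_trans uz.
  + exact: cf.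
  rewrite in_itv/= => /andP[uc c0] fE; rewrite -subr_le0 fE sub0r mulrN oppr_le0.
  have := sf c (lt_trans u1 uc); rewrite nmulr_rge0// => f'c.
  by rewrite mulr_le0// ltW.
- have [||c] := @MVT R f f' 0 u u_gt0.
  + by move=> z; rewrite in_itv/= => /andP[uz _]; apply: df; exact: lt_trans uz.
  + exact: cf.
  rewrite in_itv/= => /andP[uc c0] fE; rewrite -subr_ge0 fE subr0.
  have := sf c (lt_trans N10 uc); rewrite pmulr_rge0// => f'c.
  by rewrite mulr_ge0// ltW.
Qed.

Lemma is_derive_ln1D u : -1 < u -> is_derive u 1 (fun v : R => ln (1 + v)) (1 + u)^-1.
Proof.
move=> u1; have u0 : 0 < 1 + u by rewrite -ltrBlDl sub0r.
have d1 : is_derive u 1 (fun v : R => 1 + v) 1.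
  have := is_deriveD (is_derive_cst (1 : R) u 1) (is_derive_id u 1).
  by rewrite add0r.
have := @is_derive1_comp R _ _ _ _ _ (is_derive1_ln u0) d1.
by rewrite mulr1.
Qed.

(** The difference of the two sides has derivative [v ^+ 3 / (1 + v)], which has
    the sign of [v]. *)
Lemma ln1D_le u : -1 < u -> ln (1 + u) <= u - u ^+ 2 / 2 + u ^+ 3 / 3.
Proof.
move=> u1; rewrite -subr_ge0.
have -> : 0 = (fun v : R => (v - v ^+ 2 / 2 + v ^+ 3 / 3) - ln (1 + v)) 0 :> R.
  by rewrite /= addr0 ln1 !expr0n/= !mul0r !subr0 addr0.
apply: (@le_of_deriv_sign (fun v : R => (v - v ^+ 2 / 2 + v ^+ 3 / 3) - ln (1 + v))
  (fun v => v ^+ 3 / (1 + v)) _ _ u u1) => v v1.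
  have v0 : 1 + v != 0 by rewrite gt_eqF// -ltrBlDl sub0r.
  have dl := is_derive_ln1D v1.
  apply: is_derive_eq.
  by rewrite /GRing.scale/=; field.
have v0 : 0 < 1 + v by rewrite -ltrBlDl sub0r.
by rewrite mulrA divr_ge0 ?(ltW v0)// -exprS exprn_even_ge0.
Qed.

Lemma psi_le u : -1 < u -> psi u <= u ^+ 2 / 2 - u ^+ 3 / 6 + u ^+ 4 / 3.
Proof.
move=> u1; have u0 : 0 <= 1 + u by rewrite ltW// -ltrBlDl sub0r.
have := ler_wpM2l u0 (ln1D_le u1); rewrite /psi; lra.
Qed.

(** The difference of the two sides has derivative
    [ln (1 + v) - v + v ^+ 2 / 2], which has the sign of [v] because it vanishes
    at 0 and has itself the nonnegative derivative [v ^+ 2 / (1 + v)]. *)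
Lemma psi_ge u : -1 <= u -> u ^+ 2 / 2 - u ^+ 3 / 6 <= psi u.
Proof.
rewrite le_eqVlt => /predU1P[<-|u1].
  by rewrite /psi subrr mul0r; lra.
have sgn_h (v : R) : -1 < v -> 0 <= v * (ln (1 + v) - v + v ^+ 2 / 2).
  move=> v1.
  have dh (w : R) : -1 < w -> is_derive w 1
      (fun v : R => ln (1 + v) - v + v ^+ 2 / 2) (w ^+ 2 / (1 + w)).
    move=> w1.
    have w0 : 1 + w != 0 by rewrite gt_eqF// -ltrBlDl sub0r.
    have dl := is_derive_ln1D w1.
    by apply: is_derive_eq; rewrite /GRing.scale/=; field.
  have h0 : (fun v : R => ln (1 + v) - v + v ^+ 2 / 2) 0 = 0 :> R.
    by rewrite /= addr0 ln1 expr0n/= mul0r subr0 addr0.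
  have ch (a b : R) : -1 < a -> {within `[a, b], continuous (fun v : R => ln (1 + v) - v + v ^+ 2 / 2)}.
    move=> a1; apply: derivable_within_continuous => z.
    rewrite in_itv/= => /andP[az _].
    by have [] := dh z (lt_le_trans a1 az).
  have [v0|v0|->] := ltgtP v 0; last by rewrite mul0r.
  - have [||c] := @MVT R (fun v : R => ln (1 + v) - v + v ^+ 2 / 2) (fun w : R => w ^+ 2 / (1 + w)) v 0 v0.
      by move=> z; rewrite in_itv/= => /andP[vz _]; apply: dh; exact: lt_trans vz.
      exact: ch.
    rewrite h0 !sub0r in_itv/= => /andP[vc c0] hE.
    have c1 : 0 <= 1 + c by rewrite -lerBlDl sub0r ltW// (lt_trans v1).
    rewrite -mulrNN mulr_ge0 ?oppr_ge0 ?(ltW v0)//.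
    by rewrite -oppr_ge0 hE mulr_ge0 ?oppr_ge0 ?(ltW v0)// divr_ge0 ?sqr_ge0.
  - have [||c] := @MVT R (fun v : R => ln (1 + v) - v + v ^+ 2 / 2) (fun w : R => w ^+ 2 / (1 + w)) 0 v v0.
      by move=> z; rewrite in_itv/= => /andP[vz _]; apply: dh; rewrite (lt_trans _ vz)// ltrN10.
      by apply: ch; rewrite ltrN10.
    rewrite h0 !subr0 in_itv/= => /andP[vc c0] hE.
    have c1 : 0 <= 1 + c by rewrite addr_ge0// ltW.
    by rewrite mulr_ge0 ?(ltW v0)// hE mulr_ge0 ?(ltW v0)// divr_ge0 ?sqr_ge0.
rewrite -subr_ge0.
have -> : 0 = (fun v : R => psi v - (v ^+ 2 / 2 - v ^+ 3 / 6)) 0 :> R.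
  by rewrite /psi /= addr0 ln1 !expr0n/= mulr0 !mul0r !subr0.
apply: (@le_of_deriv_sign (fun v : R => psi v - (v ^+ 2 / 2 - v ^+ 3 / 6))
  (fun v : R => ln (1 + v) - v + v ^+ 2 / 2) _ sgn_h u u1) => v v1.
have v0 : 1 + v != 0 by rewrite gt_eqF// -ltrBlDl sub0r.
have dl := is_derive_ln1D v1.
by apply: is_derive_eq; rewrite /GRing.scale/=; field.
Qed.

End entropy_deviation.

(** * Stirling's formula up to its constant *)

Section stirling.
Context {R : realType}.

(** The factor [F k] of [k! = F k * (k / e) ^ k]. *)
Definition stirling_factor (k : nat) : R := k`!%:R * expR k%:R / k%:R ^+ k.

Lemma sqrt_expR_ln (a : R) : 0 < a -> Num.sqrt a = expR (ln a / 2).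
Proof.
by move=> a0; rewrite -powR12_sqrt ?ltW// /powR gt_eqF// mulrC.
Qed.

Lemma expR_natM_ln (a : R) n : 0 < a -> expR (n%:R * ln a) = a ^+ n.
Proof. by move=> a0; rewrite expRM_natl lnK. Qed.

Lemma stirling_factor_gt0 k : 0 < stirling_factor k.
Proof.
rewrite /stirling_factor divr_gt0 ?mulr_gt0 ?expR_gt0 ?ltr0n ?fact_gt0//.
by case: k => [|k]; rewrite ?expr0// exprn_gt0.
Qed.

Let logratio (k : nat) : R :=
  ln k`!%:R + k%:R - (k%:R + 2^-1) * ln k%:R.

Let stirling_factorE k : (0 < k)%N ->
  stirling_factor k / Num.sqrt k%:R = expR (logratio k).
Proof.
move=> k0; have k0R : 0 < k%:R :> R by rewrite ltr0n.
rewrite /logratio mulrDl opprD addrA !expRB expRD lnK ?posrE ?ltr0n ?fact_gt0//.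
by rewrite sqrt_expR_ln// expR_natM_ln// (mulrC (ln _)).
Qed.

(** With [t = 1 / k.+1] the difference is [((1 + t / 2) * ln (1 + t) - t) / t],
    which [psi_ge] and [ln1D_le] place between 0 and [t ^ 2 / 4]. *)
Let logratio_step k :
  0 <= logratio k.+1 - logratio k.+2 <=
  (2 * k.+1%:R)^-1 - (2 * k.+2%:R)^-1.
Proof.
pose t : R := k.+1%:R^-1; have k0 : 0 < k.+1%:R :> R by [].
have t0 : 0 < t by rewrite invr_gt0.
have t1 : t <= 1 by rewrite invf_le1// ler1n.
have tE : k.+1%:R = t^-1 :> R by rewrite /t invrK.
have tE2 : k.+2%:R = t^-1 + 1 :> R by rewrite -tE natr1.
have lnE : ln (k.+2%:R : R) = ln k.+1%:R + ln (1 + t).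
  rewrite -lnM ?posrE ?addr_gt0//; congr ln.
  by rewrite mulrDr mulr1 tE2 tE mulVf ?gt_eqF.
have -> : logratio k.+1 - logratio k.+2 = ((1 + t / 2) * ln (1 + t) - t) / t.
  rewrite /logratio (factS k.+1) natrM lnM ?posrE ?ltr0n ?fact_gt0// lnE tE tE2.
  by field; rewrite gt_eqF.
have tN1 : -1 < t by rewrite (lt_trans _ t0)// ltrN10.
apply/andP; split.
  rewrite divr_ge0 ?(ltW t0)//.
  have := psi_ge (ltW tN1); rewrite /psi => pt.
  have t10 : 0 < 1 + t by rewrite addr_gt0.
  rewrite -(pmulr_rge0 _ t10).
  have t20 : 0 <= 1 + t / 2 by rewrite addr_ge0// divr_ge0// ltW.
  have {t20}pt := ler_wpM2l t20 pt.
  have : 0 <= t ^+ 3 * (1 - t) by rewrite mulr_ge0 ?exprn_ge0 ?subr_ge0// ltW.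
  lra.
rewrite ler_pdivrMr//.
have := ln1D_le tN1 => pt.
have t20 : 0 <= 1 + t / 2 by rewrite addr_ge0// divr_ge0// ltW.
have {t20}pt := ler_wpM2l t20 pt.
have -> : ((2 * k.+1%:R)^-1 - (2 * k.+2%:R)^-1) * t = t ^+ 3 / (2 * (1 + t)) :> R.
  by rewrite tE2 tE; field; rewrite !gt_eqF ?addr_gt0.
have : t ^+ 3 / 4 <= t ^+ 3 / (2 * (1 + t)).
  rewrite ler_wpM2l ?exprn_ge0 ?(ltW t0)// lef_pV2 ?posrE ?mulr_gt0 ?addr_gt0//; lra.
have : t ^+ 4 <= t ^+ 3 by rewrite exprS ler_piMl// exprn_ge0// ltW.
lra.
Qed.

(** The logarithm of the ratio decreases with [k], whereas subtracting
    [1 / (2 * k)] makes it increasing; so it converges, and its limit is a lower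
    bound. The constant [a] cancels in the expectations and stays implicit. *)
Lemma stirling_factor_cvg : exists2 a : R, 0 < a &
  stirling_factor k / Num.sqrt k%:R @[k --> \oo] --> a /\
  forall k, (0 < k)%N -> a * Num.sqrt k%:R <= stirling_factor k.
Proof.
pose u k := logratio k.+1.
have u_dec : nonincreasing_seq u.
  apply/nonincreasing_seqP => k.
  by have /andP[+ _] := logratio_step k; rewrite subr_ge0.
have v_inc : nondecreasing_seq (fun k => u k - (2 * k.+1%:R)^-1).
  apply/nondecreasing_seqP => k; rewrite lerBlDl.
  have /andP[_] := logratio_step k; rewrite /u.
  move: (logratio k.+1) (logratio k.+2) (2 * k.+1%:R)^-1 (2 * k.+2%:R)^-1.
  by move=> a b c d; lra.
have u_lb k : 0 <= u k.
  have u0 : u 0%N = 1 by rewrite /u /logratio factS fact0 muln1 ln1 mulr0 add0r subr0.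
  have := v_inc 0%N k (leq0n k); rewrite /= u0 mulr1 => h.
  have : 0 <= (2 * k.+1%:R)^-1 :> R by rewrite invr_ge0 mulr_ge0.
  by move: (u k) (2 * k.+1%:R)^-1 h => a b; lra.
have u_cvg : cvgn u.
  apply: nonincreasing_is_cvgn => //.
  by exists 0 => _ [k _ <-].
exists (expR (limn u)); first exact: expR_gt0.
split.
  rewrite -cvg_shiftS/=.
  under eq_fun do rewrite stirling_factorE//.
  by apply: continuous_cvg; [exact: continuous_expR|exact: u_cvg].
move=> [//|k] _; rewrite -ler_pdivlMr ?sqrtr_gt0 ?ltr0n// stirling_factorE//.
by rewrite ler_expR; exact: nonincreasing_cvgn_ge.
Qed.

End stirling.

(** * Second-order conditions at a minimizer of the free energy *)

Section polynomial_test.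
Context {R : realType}.
Implicit Types a b d e K t : R.

Lemma ge0_of_small e a K : 0 < e ->
  (forall t, 0 < t < e -> 0 <= a + t * K) -> 0 <= a.
Proof.
move=> e0 H; apply/ler_addgt0Pr => s s0; pose t := Num.min (e / 2) (s / (`|K| + 1)).
have K0 : 0 < `|K| + 1 by rewrite ltr_wpDl.
have t0 : 0 < t by rewrite lt_min !divr_gt0.
have te : t < e by rewrite gt_min ltr_pdivrMr// ltr_pMr// ltr1n.
have ts : t * (`|K| + 1) <= s by rewrite -ler_pdivlMr// ge_min lexx orbT.
have := H t; rewrite t0 te => /(_ isT) /le_trans; apply.
rewrite lerD2l (le_trans _ ts)// ler_wpM2l ?(ltW t0)//.
by rewrite (le_trans (ler_norm K))// lerDl.
Qed.

(** Divide by the lowest power of [t] left and let [t] tend to 0; the odd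
    coefficients vanish because both signs of [t] are allowed. *)
Lemma quartic_ge0_coef e l a b d : 0 < e ->
  (forall t, `|t| < e -> 0 <= t * l + t ^+ 2 * a + t ^+ 3 * b + t ^+ 4 * d) ->
  [/\ l = 0, 0 <= a & a = 0 -> b = 0].
Proof.
move=> e0 H; pose e' := Num.min e 1.
have e'0 : 0 < e' by rewrite lt_min e0 ltr01.
have small t : 0 < t < e' -> [/\ 0 < t, t < 1, `|t| < e & `|-t| < e].
  by move=> /andP[t0]; rewrite lt_min => /andP[te t1]; rewrite normrN gtr0_norm.
have pow t n : 0 < t < e' -> t ^+ n <= 1.
  by move=> /small[t0 t1 _ _]; rewrite exprn_ile1// ltW.
have absM t n c : 0 < t < e' -> t ^+ n * c <= `|c|.
  move=> te; have [t0 _ _ _] := small t te.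
  rewrite (le_trans (ler_norm _))// normrM ler_piMl// ger0_norm ?exprn_ge0 ?(ltW t0)//.
  exact: pow.
have l_ge0 : 0 <= l.
  apply: (@ge0_of_small e' _ (`|a| + `|b| + `|d|) e'0) => t te.
  have [t0 t1 nt _] := small t te.
  rewrite -(pmulr_rge0 _ t0); have := H t nt.
  have := absM t 0%N a te; have := absM t 1%N b te; have := absM t 2%N d te.
  rewrite expr0 mul1r expr1 => h1 h2 h3.
  have := lerD h1 (lerD h2 h3) => h4.
  have := ler_wpM2l (exprn_ge0 2 (ltW t0)) h4; nra.
have l_le0 : 0 <= - l.
  apply: (@ge0_of_small e' _ (`|a| + `|-b| + `|d|) e'0) => t te.
  have [t0 t1 _ nt] := small t te.
  rewrite -(pmulr_rge0 _ t0); have := H (- t) nt.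
  have := absM t 0%N a te; have := absM t 1%N (- b) te; have := absM t 2%N d te.
  rewrite expr0 mul1r expr1 => h1 h2 h3.
  have := lerD h1 (lerD h2 h3) => h4.
  have := ler_wpM2l (exprn_ge0 2 (ltW t0)) h4; nra.
have l0 : l = 0 by lra.
have a0 : 0 <= a.
  apply: (@ge0_of_small e' _ (`|b| + `|d|) e'0) => t te.
  have [t0 t1 nt _] := small t te.
  rewrite -(pmulr_rge0 _ (exprn_gt0 2 t0)); have := H t nt.
  have := absM t 0%N b te; have := absM t 1%N d te.
  rewrite expr0 mul1r expr1 => h1 h2; rewrite l0.
  have := lerD h1 h2 => h4.
  have := ler_wpM2l (exprn_ge0 3 (ltW t0)) h4; nra.
split => // aE.
have b_ge0 : 0 <= b.
  apply: (@ge0_of_small e' _ d e'0) => t te.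
  have [t0 t1 nt _] := small t te.
  by rewrite -(pmulr_rge0 _ (exprn_gt0 3 t0)); have := H t nt; rewrite l0 aE; lra.
have b_le0 : 0 <= - b.
  apply: (@ge0_of_small e' _ d e'0) => t te.
  have [t0 t1 _ nt] := small t te.
  by rewrite -(pmulr_rge0 _ (exprn_gt0 3 t0)); have := H (- t) nt; rewrite l0 aE; lra.
lra.
Qed.

End polynomial_test.

Section free_energy_expansion.
Context {R : realType} {p : nat}.
Implicit Types (beta h : R) (x y z w : 'rV[R]_p.+2).

(** The gradient of the free energy, less the constant 1 coming from the
    derivative of [u * ln u], which tangent vectors do not see. *)
Definition gradient beta h y (i : 'I_p.+2) : R :=
  ln (y 0 i) - beta * y 0 i - h * (i == ord0)%:R.

Lemma free_energyE beta h x : free_energy beta h x =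
  \sum_i (x 0 i * ln (x 0 i) - beta / 2 * x 0 i ^+ 2
          - h * (x 0 i * (i == ord0)%:R)).
Proof.
rewrite /free_energy !big_split/= sumrN -mulr_sumr sumrN -mulr_sumr.
congr (_ - _ - _ * _); rewrite (bigD1 ord0)//= big1 ?addr0 ?mulr1// => i /negbTE->.
by rewrite mulr0.
Qed.

Lemma xlnx_psi (a b : R) : 0 < a -> 0 <= b ->
  b * ln b - a * ln a = (b - a) * ln a + a * psi ((b - a) / a) + (b - a).
Proof.
move=> a0; rewrite le_eqVlt => /predU1P[<-|b0].
  have -> : (0 - a) / a = -1 by field; rewrite gt_eqF.
  by rewrite /psi subrr; ring.
have E : 1 + (b - a) / a = b / a by field; rewrite gt_eqF.
rewrite /psi E ln_div ?posrE//; field; by rewrite gt_eqF.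
Qed.

(** An exact second-order expansion: [psi] collects the entropy beyond its linear
    part, and the terms [z 0 i - y 0 i] left by [xlnx_psi] sum to 0. *)
Lemma free_energyB beta h y z :
  (forall i, 0 < y 0 i) -> (forall i, 0 <= z 0 i) ->
  \sum_i z 0 i = \sum_i y 0 i ->
  free_energy beta h z - free_energy beta h y =
  \sum_i (z 0 i - y 0 i) * gradient beta h y i
  + \sum_i y 0 i * psi ((z 0 i - y 0 i) / y 0 i)
  - beta / 2 * \sum_i (z 0 i - y 0 i) ^+ 2.
Proof.
move=> y0 z0 zy; rewrite !free_energyE -sumrB.
have -> : \sum_i y 0 i * psi ((z 0 i - y 0 i) / y 0 i) =
  \sum_i (y 0 i * psi ((z 0 i - y 0 i) / y 0 i) + (z 0 i - y 0 i)).
  by rewrite big_split/= sumrB zy subrr addr0.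
rewrite mulr_sumr -big_split/= -sumrB; apply: eq_bigr => i _.
have := xlnx_psi (y0 i) (z0 i); rewrite /gradient.
move: (psi _) => P; move: (ln (z 0 i)) (ln (y 0 i)) => lz ly; lra.
Qed.

Lemma ray_in_Omega y w : Omega y -> (forall i, 0 < y 0 i) -> sum_zero w ->
  exists2 e, 0 < e & forall t, `|t| < e ->
    Omega (y + t *: w) /\ forall i, `|t * w 0 i / y 0 i| < 1.
Proof.
move=> [y1 _] y0 w0.
have K0 : 0 <= \sum_i `|w 0 i| / y 0 i.
  by apply: sumr_ge0 => i _; rewrite divr_ge0// ltW.
exists (1 + \sum_i `|w 0 i| / y 0 i)^-1 => [|t te].
  by rewrite invr_gt0 ltr_pwDl.
have small i : `|t * w 0 i / y 0 i| < 1.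
  rewrite !normrM normfV (gtr0_norm (y0 i)) -mulrA.
  have [->|t0] := eqVneq t 0; first by rewrite normr0 mul0r.
  have tgt : 0 < `|t| by rewrite normr_gt0.
  rewrite mulrC -ltr_pdivlMr// mul1r.
  apply: (@le_lt_trans _ _ (\sum_i `|w 0 i| / y 0 i)).
    rewrite (bigD1 i)//= lerDl sumr_ge0// => j _; by rewrite divr_ge0// ltW.
  rewrite (@lt_le_trans _ _ (1 + \sum_i `|w 0 i| / y 0 i))// ?ltrDr//.
  by rewrite -[leLHS]invrK lef_pV2 ?posrE ?invr_gt0 ?ltr_pwDl// ltW.
split => //; split.
  under eq_bigr do rewrite !mxE.
  by rewrite big_split/= -mulr_sumr w0 mulr0 addr0.
move=> i; rewrite !mxE.
have := small i; rewrite ltr_norml => /andP[+ _].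
by rewrite ltr_pdivlMr// mulN1r => /ltW; rewrite -subr_ge0 opprK addrC.
Qed.

(** By [psi_le] the energy along the ray lies below a polynomial of degree 4 with
    the same Taylor expansion to order 3, so this polynomial is nonnegative near
    0. Its order 3 is what rules out a degenerate Hessian later. *)
Lemma minimizer_along_ray beta h y w (e : R) : 0 < e ->
  Omega y -> (forall i, 0 < y 0 i) -> sum_zero w ->
  (forall t, `|t| < e -> Omega (y + t *: w) ->
     free_energy beta h y <= free_energy beta h (y + t *: w)) ->
  [/\ \sum_i w 0 i * gradient beta h y i = 0,
      0 <= \sum_i w 0 i ^+ 2 * ((y 0 i)^-1 - beta) &
      \sum_i w 0 i ^+ 2 * ((y 0 i)^-1 - beta) = 0 ->
      \sum_i w 0 i ^+ 3 / y 0 i ^+ 2 = 0].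
Proof.
move=> e0 Oy y0 w0 ymin; have [e' e'0 He] := ray_in_Omega Oy y0 w0.
have ee0 : 0 < Num.min e e' by rewrite lt_min e0.
set l := \sum_i w 0 i * gradient beta h y i.
set a := \sum_i w 0 i ^+ 2 * ((y 0 i)^-1 - beta).
set b := \sum_i w 0 i ^+ 3 / y 0 i ^+ 2.
pose d := \sum_i w 0 i ^+ 4 / y 0 i ^+ 3 / 3.
have [|l0 a0 ab] := @quartic_ge0_coef R _ l (a / 2) (- b / 6) d ee0.
  move=> t; rewrite lt_min => /andP[/ymin te /He[Ot tw]].
  have {te}:= te Ot; rewrite -subr_ge0 free_energyB//; last 2 first.
  - by case: Ot.
  - by case: Ot => -> _; case: Oy.
  move/le_trans; apply.
  have zE i : (y + t *: w) 0 i - y 0 i = t * w 0 i by rewrite !mxE addrC addKr.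
  have -> : \sum_i ((y + t *: w) 0 i - y 0 i) * gradient beta h y i =
      \sum_i t * w 0 i * gradient beta h y i.
    by apply: eq_bigr => i _; rewrite zE.
  have -> : \sum_i ((y + t *: w) 0 i - y 0 i) ^+ 2 = \sum_i (t * w 0 i) ^+ 2.
    by apply: eq_bigr => i _; rewrite zE.
  have -> : t * l + t ^+ 2 * (a / 2) + t ^+ 3 * (- b / 6) + t ^+ 4 * d =
    \sum_i t * w 0 i * gradient beta h y i +
    \sum_i (y 0 i * ((t * w 0 i / y 0 i) ^+ 2 / 2
             - (t * w 0 i / y 0 i) ^+ 3 / 6 + (t * w 0 i / y 0 i) ^+ 4 / 3))
    - beta / 2 * \sum_i (t * w 0 i) ^+ 2.
    rewrite /l /a /b /d mulr_sumr !mulr_suml !mulr_sumr -sumrN !mulr_suml !mulr_sumr.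
    rewrite -!big_split/= -sumrB; apply: eq_bigr => i _.
    by field; rewrite gt_eqF.
  rewrite lerD2r lerD2l; apply: ler_sum => i _; rewrite zE ler_pM2l//.
  by apply: psi_le; have := tw i; rewrite ltr_norml => /andP[].
split => //; first by rewrite -(pmulr_lge0 _ (_ : 0 < 2^-1))// invr_gt0.
move=> a_eq0; have := ab; rewrite a_eq0 mul0r => /(_ erefl)/eqP.
by rewrite mulf_eq0 oppr_eq0 invr_eq0 pnatr_eq0 orbF => /eqP.
Qed.

End free_energy_expansion.

Section minimizer_interior.
Context {R : realType} {p : nat}.
Implicit Types (beta h : R) (x y z w : 'rV[R]_p.+2).

Lemma sum_delta2 (i j : 'I_p.+2) : i != j ->
  \sum_k (delta_mx 0 i - delta_mx 0 j : 'rV[R]_p.+2) 0 k = 0.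
Proof.
move=> ij; under eq_bigr do rewrite !mxE eqxx/=.
rewrite sumrB (bigD1 i)//= eqxx big1 ?addr0; last by move=> k /negbTE->.
by rewrite (bigD1 j)//= eqxx big1 ?addr0 ?subrr// => k /negbTE->.
Qed.

Lemma sum_shift2 (G : 'I_p.+2 -> R -> R) x (i j : 'I_p.+2) (t : R) : i != j ->
  \sum_k G k ((x + t *: (delta_mx 0 i - delta_mx 0 j)) 0 k) - \sum_k G k (x 0 k)
  = (G i (x 0 i + t) - G i (x 0 i)) + (G j (x 0 j - t) - G j (x 0 j)).
Proof.
move=> ij; rewrite -sumrB (bigD1 i)//= (bigD1 j) 1?eq_sym//= big1 ?addr0.
  by rewrite !mxE !eqxx/= (negbTE ij) eq_sym (negbTE ij)/= subr0 sub0r mulr1 mulrN1.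
move=> k /andP[/negbTE ki /negbTE kj].
by rewrite !mxE eqxx/= ki kj subr0 mulr0 addr0 subrr.
Qed.

(** Moving a mass [e] from a positive coordinate to a vanishing one changes the
    energy by [e * ln e + O(e)], which is negative for small [e]. *)
Lemma global_minimizer_gt0 beta h x :
  global_minimizer beta h x -> forall i, 0 < x 0 i.
Proof.
move=> [[x1 x0] xmin] i; rewrite lt_neqAle x0 andbT eq_sym; apply/negP => /eqP xi0.
have [j xj0] : exists j, 0 < x 0 j.
  apply/existsP; rewrite -[X in is_true X]negbK negb_exists; apply/negP => /forallP H.
  have : \sum_k x 0 k = 0.
    by apply: big1 => k _; apply/eqP; rewrite eq_le x0 andbT leNgt H.
  by rewrite x1 => /eqP; rewrite oner_eq0.
have ij : i != j by apply/eqP => ij; move: xj0; rewrite -ij xi0 ltxx.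
pose G (k : 'I_p.+2) (v : R) :=
  v * ln v - beta / 2 * v ^+ 2 - h * (v * (k == ord0)%:R).
set s := x 0 j in xj0.
(* [K] bounds the terms linear in [e]; then [ln e <= - K - 1] beats them. *)
pose K := - ln s + s^-1 + `|beta| + `|h|.
pose e := Num.min (expR (- K - 1)) (Num.min (s / 2) 1).
have e0 : 0 < e by rewrite !lt_min expR_gt0 divr_gt0//=.
have es : e <= s / 2 by rewrite !ge_min lexx orbT.
have e1 : e <= 1 by rewrite !ge_min lexx !orbT.
have : 0 <= e * ln e + e * K.
  have Oz : Omega (x + e *: (delta_mx 0 i - delta_mx 0 j)).
    split.
      under eq_bigr do rewrite mxE.
      rewrite big_split/= x1.
      under eq_bigr do rewrite mxE.
      by rewrite -mulr_sumr sum_delta2// mulr0 addr0.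
    move=> k; rewrite !mxE eqxx/=.
    have [->|kj] := eqVneq k j.
      by rewrite eq_sym (negbTE ij) sub0r mulrN1 -/s; lra.
    by rewrite subr0 addr_ge0// mulr_ge0// ltW.
  have := xmin _ Oz; rewrite -subr_ge0 !free_energyE.
  rewrite (@sum_shift2 G)// xi0 add0r /G -/s expr0n/= !mul0r !mulr0 !subr0.
  have se0 : 0 <= s - e by lra.
  have := xlnx_psi xj0 se0.
  have -> : s - e - s = - e by ring.
  have es1 : e / s < 1 by rewrite ltr_pdivrMr//; lra.
  have es0 : 0 < e / s by rewrite divr_gt0.
  have : psi (- e / s) <= (e / s) ^+ 2.
    rewrite mulNr; apply: le_trans (psi_le _) _; first lra.
    move: (e / s) es1 es0 => v v1 v0.
    have : v ^+ 3 <= v ^+ 2 by rewrite exprS ler_piMl ?sqr_ge0 ?ltW.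
    have : v ^+ 4 <= v ^+ 3 by rewrite exprS ler_piMl ?exprn_ge0 ?ltW.
    lra.
  rewrite -(ler_pM2l xj0) => hpsi hxlnx.
  have {}hpsi : s * psi (- e / s) <= e * s^-1.
    apply: (le_trans hpsi); rewrite exprMn [e ^+ 2]expr2.
    have -> : s * (e * e * s^-1 ^+ 2) = e * (e * s^-1) by field; rewrite gt_eqF.
    by rewrite ler_pM2l// ler_piMl ?invr_ge0// ltW.
  have s1 : s <= 1.
    by rewrite -x1 (bigD1 j)//= lerDl sumr_ge0.
  have hb : `|beta * (e * (s - e))| <= `|beta| * e.
    rewrite normrM ler_wpM2l// ger0_norm ?mulr_ge0 ?(ltW e0)// ler_piMr ?(ltW e0)//.
    lra.
  have hh : `|h * (e * ((j == ord0)%:R - (i == ord0)%:R))| <= `|h| * e.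
    rewrite normrM ler_wpM2l// normrM (gtr0_norm e0) ler_piMr ?(ltW e0)//.
    by case: (_ == _); case: (_ == _); rewrite ?subrr ?subr0 ?sub0r ?normrN ?normr0 ?normr1.
  move: hb hh; rewrite !ler_norml => /andP[_ hb] /andP[_ hh].
  rewrite /K; move: hxlnx hpsi hb hh.
  move: (psi (- e / s)) => f; move: (ln (s - e)) (ln s) (ln e) => a b c.
  move: s^-1 (i == ord0)%:R (j == ord0)%:R => k g g'.
  move=> hxlnx hpsi hb hh; lra.
rewrite -mulrDr pmulr_rge0//; apply/negP; rewrite -ltNge.
have : ln e <= - K - 1.
  rewrite -[leRHS]expRK ler_ln ?posrE ?expR_gt0//.
  by rewrite /e ge_min lexx.
by rewrite -subr_lt0; lra.
Qed.

End minimizer_interior.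

Section nondegeneracy.
Context {R : realType} {p : nat}.
Variables (beta h x1 xq : R).
Hypothesis xmin : global_minimizer beta h (two_valued p x1 xq).
Let x := two_valued p x1 xq.
Let m : R := p.+1%:R.

Let x0E : x 0 ord0 = x1. Proof. by rewrite mxE. Qed.
Let xSE (i : 'I_p.+1) : x 0 (lift ord0 i) = xq. Proof. by rewrite mxE. Qed.

Lemma two_valued_gt0 : 0 < x1 /\ 0 < xq.
Proof.
split; first by rewrite -x0E; exact: global_minimizer_gt0 xmin _.
by rewrite -(xSE ord0); exact: global_minimizer_gt0 xmin _.
Qed.

Lemma two_valued_sum : x1 + m * xq = 1.
Proof.
have [[<- _] _] := xmin; rewrite big_ord_recl -/x x0E; congr (_ + _).
under eq_bigr do rewrite xSE.
by rewrite sumr_const card_ord mulr_natl.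
Qed.

Let ray w := @minimizer_along_ray R p beta h x w 1 ltr01 xmin.1
  (global_minimizer_gt0 xmin).

Let ray_min w : sum_zero w ->
  [/\ \sum_i w 0 i * gradient beta h x i = 0,
      0 <= \sum_i w 0 i ^+ 2 * ((x 0 i)^-1 - beta) &
      \sum_i w 0 i ^+ 2 * ((x 0 i)^-1 - beta) = 0 ->
      \sum_i w 0 i ^+ 3 / x 0 i ^+ 2 = 0].
Proof. by move=> w0; apply: ray => // t _ Ot; exact: xmin.2. Qed.

(** The tangent direction to the vectors of the form [(x1, xq, ..., xq)]. *)
Let radial : 'rV[R]_p.+2 := two_valued p m (-1).

Let radial0 : sum_zero radial.
Proof.
rewrite /sum_zero/= big_ord_recl mxE eqxx.
under eq_bigr do rewrite mxE/=.
by rewrite sumr_const card_ord mulNrn subrr.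
Qed.

Let m1 : 1 <= m. Proof. by rewrite ler1n. Qed.

Lemma two_valued_critical : ln x1 - beta * x1 - h = ln xq - beta * xq.
Proof.
have [+ _ _] := ray_min radial0; rewrite big_ord_recl mxE eqxx.
rewrite /gradient x0E mulr1.
under eq_bigr do rewrite xSE mxE/= mulr0 subr0 mulN1r.
rewrite sumr_const card_ord mulNrn -mulr_natl -mulrBr => /eqP.
by rewrite mulf_eq0 pnatr_eq0/= subr_eq0 => /eqP.
Qed.

Hypothesis h_ge0 : 0 <= h.
Hypothesis noncritical : (beta, h) <> (beta0 R p, h0 R p).

(** If the curvature vanished, so would the third-order term
    [m ^+ 2 / x1 ^+ 2 - xq ^- 2], that is [x1 = m * xq = 1 / 2]; the vanishing
    curvature and the first-order condition then give exactly [beta0] and [h0]. *)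
Lemma radial_curvature_gt0 : 0 < xq^-1 - beta + m * (x1^-1 - beta).
Proof.
have [x1_gt0 xq_gt0] := two_valued_gt0.
have [_ + +] := ray_min radial0.
have -> : \sum_i radial 0 i ^+ 2 * ((x 0 i)^-1 - beta) =
   m * (xq^-1 - beta + m * (x1^-1 - beta)).
  rewrite big_ord_recl x0E mxE eqxx.
  under eq_bigr do rewrite xSE mxE/= sqrrN expr1n mul1r.
  by rewrite sumr_const card_ord -mulr_natl -/m; ring.
have -> : \sum_i radial 0 i ^+ 3 / x 0 i ^+ 2 = m * (m ^+ 2 / x1 ^+ 2 - xq ^- 2).
  rewrite big_ord_recl x0E mxE eqxx.
  under eq_bigr do rewrite xSE mxE/= exprNn expr1n mulr1 -signr_odd/= mulN1r.
  by rewrite sumr_const card_ord -mulr_natl -/m; ring.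
have m0 : 0 < m by rewrite ltr0n.
rewrite pmulr_rge0// => D0 degenerate; rewrite lt_neqAle D0 andbT eq_sym.
apply/eqP => DE; apply: noncritical.
have := degenerate; rewrite DE mulr0 => /(_ erefl)/eqP.
rewrite mulf_eq0 gt_eqF//= subr_eq0 -!exprVn -exprMn.
rewrite eqrXn2 ?divr_ge0 ?invr_ge0 ?(ltW x1_gt0) ?(ltW xq_gt0) ?(ltW m0)//.
move=> /eqP mE; have x1E : x1 = m * xq.
  by rewrite -[m](divfK (lt0r_neq0 x1_gt0)) mE mulrAC mulVf ?gt_eqF// mul1r.
have xqE : xq = (2 * m)^-1.
  apply: (mulfI (_ : 2 * m != 0)); first by rewrite mulf_neq0 ?gt_eqF.
  rewrite divff ?mulf_neq0 ?gt_eqF//.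
  by have := two_valued_sum; rewrite x1E; lra.
have {}x1E : x1 = 2^-1 by rewrite x1E xqE; field; rewrite gt_eqF.
have nE : p.+2%:R = m + 1 :> R by rewrite natr1.
have bE : beta = 4 * (m / (m + 1)).
  have : beta * (m + 1) = 4 * m.
    by move: DE; rewrite xqE x1E !invrK; lra.
  by move=> bmE; rewrite mulrA -bmE mulfK// gt_eqF// addr_gt0.
congr pair.
  by rewrite /beta0 nE bE addrK.
have := two_valued_critical; rewrite /h0 nE.
have -> : m + 1 - 1 = m by ring.
rewrite xqE x1E !lnV ?posrE ?mulr_gt0// lnM ?posrE// bE.
have -> : m + 1 - 2 = m - 1 by ring.
move=> /eqP; rewrite -subr_eq0 => /eqP E.
have -> : h = h + 0 by rewrite addr0.
rewrite -E; field; by rewrite !gt_eqF// addr_gt0.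
Qed.

(** If [beta = xq^-1], the first-order condition reads [ln r = r - 1 + h] for
    [r = x1 / xq]. Since [ln r < r - 1] unless [r = 1], and [h >= 0], this forces
    [x1 = xq], where the radial curvature would vanish too. *)
Lemma angular_curvature_gt0 : (0 < p)%N -> 0 < xq^-1 - beta.
Proof.
move=> p0; have [x1_gt0 xq_gt0] := two_valued_gt0.
pose i : 'I_p.+2 := lift ord0 ord0; pose j : 'I_p.+2 := ord_max.
have ij : i != j by rewrite -val_eqE/= /bump/= eq_sym eqSS -lt0n.
have w0 : sum_zero (delta_mx 0 i - delta_mx 0 j : 'rV[R]_p.+2) by exact: sum_delta2.
have xi : x 0 i = xq by rewrite xSE.
have xj : x 0 j = xq by rewrite mxE.
have [_ + _] := ray_min w0.
rewrite (bigD1 i)//= (bigD1 j) 1?eq_sym//= big1 ?addr0; last first.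
  move=> k /andP[/negbTE ki /negbTE kj].
  by rewrite !mxE eqxx/= ki kj subrr expr0n/= mul0r.
rewrite xi xj !mxE !eqxx/= (negbTE ij) eq_sym (negbTE ij) subr0 sub0r.
rewrite sqrrN expr1n !mul1r -mulr2n pmulrn_lge0// => A0.
rewrite lt_neqAle A0 andbT eq_sym; apply/eqP => /eqP.
rewrite subr_eq0 => /eqP bE.
have hr : ln (x1 / xq) = x1 / xq - 1 + h.
  rewrite ln_div ?posrE//; have := two_valued_critical; rewrite -bE.
  by rewrite mulVf ?gt_eqF// [xq^-1 * _]mulrC; lra.
have r0 : 0 < x1 / xq by rewrite divr_gt0.
have : ln (x1 / xq) = 0.
  apply/eqP; apply/negP => /negP lr0.
  by have := expR_gt1Dx lr0; rewrite lnK ?posrE// hr addrA addrCA subrr addr0 -ltrBrDl subrr ltNge h_ge0.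
move=> /eqP; rewrite ln_eq0// => /eqP r1.
have E : x1 = xq by rewrite -[x1](divfK (lt0r_neq0 xq_gt0)) r1 mul1r.
by have := radial_curvature_gt0; rewrite E -bE subrr mulr0 addr0 ltxx.
Qed.

Lemma sum_sqr_le n (w : 'I_n -> R) :
  (\sum_i w i) ^+ 2 <= n%:R * \sum_i w i ^+ 2.
Proof.
case: n w => [|n] w; first by rewrite !big_ord0 expr0n/= mulr0.
have n0 : 0 < n.+1%:R :> R by [].
pose s := (\sum_i w i) / n.+1%:R.
have : 0 <= n.+1%:R * \sum_i (w i - s) ^+ 2.
  by rewrite mulr_ge0// sumr_ge0// => i _; exact: sqr_ge0.
have -> : n.+1%:R * \sum_i (w i - s) ^+ 2 =
    n.+1%:R * \sum_i w i ^+ 2 - (\sum_i w i) ^+ 2.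
  under eq_bigr do rewrite sqrrB.
  rewrite !big_split/= sumrN sumrMnl -mulr_suml sumr_const card_ord -mulr_natl.
  have -> : \sum_i w i = n.+1%:R * s by rewrite /s mulrC divfK// gt_eqF.
  ring.
by rewrite subr_ge0.
Qed.

(** If [p > 0], only [x1^-1 - beta] can be negative, and it multiplies
    [(\sum_(i > 0) w i) ^ 2], which Cauchy-Schwarz bounds by [m] times the other
    squares; the extremal case is the radial direction. *)
Lemma hessian_coercive : exists2 c, 0 < c & forall w : 'rV[R]_p.+2, sum_zero w ->
  c * \sum_i w 0 i ^+ 2 <= \sum_i w 0 i ^+ 2 * ((x 0 i)^-1 - beta).
Proof.
set A := xq^-1 - beta; set B := x1^-1 - beta; pose D := A + m * B.
have D0 : 0 < D := radial_curvature_gt0.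
have hE (w : 'rV[R]_p.+2) : \sum_i w 0 i ^+ 2 * ((x 0 i)^-1 - beta) =
    w 0 ord0 ^+ 2 * B + (\sum_i w 0 (lift ord0 i) ^+ 2) * A.
  rewrite big_ord_recl x0E; congr (_ + _); rewrite mulr_suml.
  by apply: eq_bigr => i _; rewrite xSE.
have m0 : 0 < m by rewrite ltr0n.
have w0E (w : 'rV[R]_p.+2) : sum_zero w ->
    w 0 ord0 ^+ 2 = (\sum_i w 0 (lift ord0 i)) ^+ 2.
  rewrite /sum_zero/= big_ord_recl => /eqP; rewrite addr_eq0 => /eqP->.
  by rewrite sqrrN.
have [p0|p0] := posnP p.
  exists (D / 2); first by rewrite divr_gt0.
  move=> w ws; rewrite hE big_ord_recl (w0E _ ws).
  have m1E : m = 1 by rewrite /m p0.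
  have one (u : 'I_p.+1 -> R) : \sum_i u i ^+ 2 = (\sum_i u i) ^+ 2.
    by move: u; rewrite p0 => u; rewrite !big_ord1.
  rewrite one.
  by rewrite /D m1E; move: (_ ^+ 2) => S; rewrite le_eqVlt; apply/orP; left; apply/eqP; field.
have A0 := angular_curvature_gt0 p0; rewrite -/A in A0.
pose c := Num.min A D; have c0 : 0 < c by rewrite lt_min A0.
exists (c / (m + 1)); first by rewrite divr_gt0// addr_gt0.
move=> w ws; rewrite hE big_ord_recl.
have := sum_sqr_le (fun i => w 0 (lift ord0 i)); rewrite -(w0E _ ws) -/m.
have : 0 <= \sum_i w 0 (lift ord0 i) ^+ 2 by apply: sumr_ge0 => i _; exact: sqr_ge0.
have := sqr_ge0 (w 0 ord0).
move: (_ ^+ 2) (\sum_i _) => v S v0 S0 vS.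
rewrite mulrAC ler_pdivrMr ?addr_gt0//.
have cA : c <= A by rewrite ge_min lexx.
have cD : c <= D by rewrite ge_min lexx orbT.
apply: (@le_trans _ _ (c * S * (m + 1))).
  by rewrite -mulrA ler_wpM2l ?(ltW c0)// mulrDr mulr1 lerD2r mulrC.
rewrite ler_wpM2r ?addr_ge0 ?(ltW m0)//.
have [B0|B0] := leP 0 B.
  rewrite (@le_trans _ _ (A * S)) ?ler_wpM2r//.
  by rewrite [S * A]mulrC lerDr mulr_ge0.
rewrite (@le_trans _ _ (D * S)) ?ler_wpM2r//.
rewrite /D mulrDl [S * A]mulrC addrC lerD2r mulrAC ler_wnM2r// ltW//.
Qed.

End nondegeneracy.

(** * Minimizers of the perturbed free energies *)

Section compactness.
Context {R : realType} {p : nat}.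
Implicit Types (beta h : R) (x y z w : 'rV[R]_p.+2).

Definition sqdist z x : R := \sum_i (z 0 i - x 0 i) ^+ 2.

Lemma sqdist_ge0 z x : 0 <= sqdist z x.
Proof. by apply: sumr_ge0 => i _; exact: sqr_ge0. Qed.

Lemma sqdist_coord z x i : (z 0 i - x 0 i) ^+ 2 <= sqdist z x.
Proof.
by rewrite /sqdist (bigD1 i)//= lerDl sumr_ge0// => j _; exact: sqr_ge0.
Qed.

Lemma coord_cvg x (i : 'I_p.+2) : (fun y : 'rV[R]_p.+2 => y 0 i) @ x --> x 0 i.
Proof. exact: coord_continuous. Qed.

Lemma cvg_free_energy (T : Type) (F : set_system T) {FF : Filter F}
    (z : T -> 'rV[R]_p.+2) beta h x :
  (forall i, z t 0 i @[t --> F] --> x 0 i) ->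
  free_energy beta h (z t) @[t --> F] --> free_energy beta h x.
Proof.
move=> zx; apply: cvgB; [apply: cvgB|].
- apply: cvg_sumr => i.
  apply: (@cvg_comp _ _ _ (fun t => z t 0 i) (fun v => v * ln v) F (nbhs (x 0 i))).
    exact: zx.
  exact: continuous_xlnx.
- apply: cvgM; first exact: cvg_cst.
  by apply: cvg_sumr => i; apply: cvg_sqr.
- by apply: cvgM => //; exact: cvg_cst.
Qed.

Lemma cvg_sqdist (T : Type) (F : set_system T) {FF : Filter F}
    (z : T -> 'rV[R]_p.+2) x y :
  (forall i, z t 0 i @[t --> F] --> x 0 i) ->
  sqdist (z t) y @[t --> F] --> sqdist x y.
Proof.
move=> zx; apply: cvg_sumr => i; apply: cvg_sqr; apply: cvgB => //; exact: cvg_cst.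
Qed.

Lemma continuous_free_energy beta h : continuous (@free_energy R p beta h).
Proof.
by move=> x; apply: (@cvg_free_energy _ (nbhs x) (nbhs_filter x) id) => i; exact: coord_cvg.
Qed.

Lemma continuous_sqdist x : continuous (fun z => sqdist z x).
Proof.
by move=> z; apply: (@cvg_sqdist _ (nbhs z) (nbhs_filter z) id) => i; exact: coord_cvg.
Qed.

Lemma Omega_coord_le1 z i : Omega z -> 0 <= z 0 i <= 1.
Proof.
move=> [z1 z0]; rewrite z0/= -z1 (bigD1 i)//= lerDl.
by apply: sumr_ge0 => j _.
Qed.

Lemma compact_Omega : compact (@Omega R p).
Proof.
have cube : compact [set v : 'rV[R]_p.+2 | forall i, v ord0 i \in `[0, 1]%R].
  by apply: (@rV_compact _ _ (fun=> `[(0 : R), 1]%classic)) => _; exact: segment_compact.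
apply: (subclosed_compact _ cube); last first.
  by move=> z Oz i; rewrite in_itv/=; exact: Omega_coord_le1.
have -> : @Omega R p =
    (fun z : 'rV[R]_p.+2 => \sum_i z 0 i) @^-1` [set v | v = 1] `&`
    \bigcap_(i in [set: 'I_p.+2]) [set z | 0 <= z 0 i].
  apply/seteqP; split => z [z1 z0]; split => // i; last exact: z0.
  by move=> _; exact: z0.
apply: closedI.
  apply: closed_comp; last exact: closed_eq.
  move=> z _; apply: (@cvg_sumr _ _ (nbhs z) _ _ _
    (fun i (y : 'rV[R]_p.+2) => y 0 i) (fun i => z 0 i)) => i.
  exact: coord_cvg.
apply: closed_bigI => i _.
apply: (@closed_comp _ _ (fun z : 'rV[R]_p.+2 => z 0 i) [set v | 0 <= v]); last exact: closed_ge.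
by move=> z _; exact: coord_cvg.
Qed.

Lemma exists_global_minimizer beta h : exists x : 'rV[R]_p.+2, global_minimizer beta h x.
Proof.
have O0 : @Omega R p !=set0.
  exists (delta_mx 0 ord0); split.
    rewrite (bigD1 ord0)//= !mxE eqxx/= big1 ?addr0// => i /negbTE i0.
    by rewrite mxE i0.
  by move=> i; rewrite mxE ler0n.
have [|x] := compact_EVT_min (f := @free_energy R p beta h) O0 compact_Omega.
  by apply: continuous_subspaceT; exact: continuous_free_energy.
rewrite inE => Ox xmin; exists x; split => // y Oy; apply: xmin; exact: mem_set.
Qed.

(** The part of the simplex away from [x] is compact, and the minimum of the
    energy there cannot be the global one. *)
Lemma global_minimizer_gap beta h x d :
  global_minimizer beta h x ->
  (forall y, global_minimizer beta h y -> y = x) -> 0 < d ->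
  exists2 e, 0 < e & forall z, Omega z -> d <= sqdist z x ->
    free_energy beta h x + e <= free_energy beta h z.
Proof.
move=> [Ox xmin] xuniq d0.
pose K := @Omega R p `&` [set z | d <= sqdist z x].
have [K0|/nonemptyPn K0] := pselect (K !=set0); last first.
  exists 1; rewrite ?ltr01// => z Oz dz; exfalso.
  by have : K z by []; rewrite K0.
have cK : compact K.
  apply: (subclosed_compact _ compact_Omega) => [|z []//].
  apply: closedI; first exact: compact_closed (@norm_hausdorff _ _) compact_Omega.
  apply: (@closed_comp _ _ (fun z => sqdist z x) [set v | d <= v]); last exact: closed_ge.
  by move=> z _; exact: continuous_sqdist.
have [|c] := compact_EVT_min (f := @free_energy R p beta h) K0 cK.
  by apply: continuous_subspaceT; exact: continuous_free_energy.
rewrite inE => -[Oc dc] cmin.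
exists (free_energy beta h c - free_energy beta h x); last first.
  by move=> z Oz dz; rewrite addrC subrK; apply: cmin; rewrite inE.
rewrite subr_gt0 lt_neqAle xmin// andbT; apply/eqP => E.
have cx : c = x by apply: xuniq; split => // y Oy; rewrite -E; exact: xmin.
move: dc; rewrite /= cx /sqdist big1 ?leNgt ?d0// => i _.
by rewrite subrr expr0n.
Qed.

Lemma free_energy_param_lip beta h beta' h' z : Omega z ->
  `|free_energy beta' h' z - free_energy beta h z| <= `|beta' - beta| + `|h' - h|.
Proof.
move=> Oz; have sq1 : 0 <= \sum_i z 0 i ^+ 2 <= 1.
  apply/andP; split; first by apply: sumr_ge0 => i _; exact: sqr_ge0.
  have [<- _] := Oz; apply: ler_sum => i _.
  by have /andP[z0 z1] := Omega_coord_le1 i Oz; rewrite expr2 ler_piMl.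
have /andP[z0 z1] := Omega_coord_le1 ord0 Oz.
have -> : free_energy beta' h' z - free_energy beta h z =
  - ((beta' - beta) * ((\sum_i z 0 i ^+ 2) / 2)) - (h' - h) * z 0 ord0.
  by rewrite /free_energy; ring.
rewrite (le_trans (ler_normB _ _))// normrN [X in X + _]normrM [X in _ + X]normrM lerD//.
  have /andP[s0 s1] := sq1.
  rewrite ler_piMr// ger0_norm ?divr_ge0//.
  by rewrite ler_pdivrMr// mul1r (le_trans s1)// ler1n.
by rewrite ler_piMr// ger0_norm.
Qed.

End compactness.

(** What the local limit needs of a minimizer: the exact expansion yields the
    pointwise limits of the weights, the quadratic lower bound dominates them. *)
Definition quadratic_well (R : realType) (p : nat) (c beta h : R)
    (y : 'rV[R]_p.+2) : Prop :=
  [/\ \sum_i y 0 i = 1, (forall i, 0 < y 0 i) &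
   forall z, Omega z ->
     free_energy beta h z - free_energy beta h y =
       \sum_i y 0 i * psi ((z 0 i - y 0 i) / y 0 i) - beta / 2 * sqdist z y /\
     c * sqdist z y <= free_energy beta h z - free_energy beta h y].

Section perturbed_minimizers.
Context {R : realType} {p : nat}.
Variables (betan hn : nat -> R) (beta h : R).
Hypothesis betan_cvg : betan n @[n --> \oo] --> beta.
Hypothesis hn_cvg : hn n @[n --> \oo] --> h.
Variable x : 'rV[R]_p.+2.
Hypothesis x_min : global_minimizer beta h x.
Hypothesis x_unique : forall y, global_minimizer beta h y -> y = x.
Variable dn : nat -> 'rV[R]_p.+2.
Hypothesis dnP : forall n, (0 < n)%N ->
  smallest_minimizer_shift (betan n) (hn n) x (dn n).

Let yn n := x + dn n.
Let en n := `|betan n - beta| + `|hn n - h|.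

Let en_cvg0 : en n @[n --> \oo] --> (0 : R).
Proof.
rewrite -[X in _ --> X](_ : `|beta - beta| + `|h - h| = 0); last first.
  by rewrite !subrr normr0 addr0.
by apply: cvgD; apply: cvg_norm; apply: cvgB => //; exact: cvg_cst.
Qed.

Let en_lt e : 0 < e -> \forall n \near \oo, en n < e.
Proof. by move=> e0; exact: (cvgr_lt _ en_cvg0). Qed.

(** A global minimizer of the perturbed energy competes with [x + dn n] in the
    choice of the smallest shift, and it lies near [x] as soon as the gap exceeds
    twice the effect of the perturbation. *)
Lemma minimizer_shift_sqdist d : 0 < d -> \forall n \near \oo, sqdist (yn n) x < d.
Proof.
move=> d0; have [e e0 gap] := global_minimizer_gap x_min x_unique d0.
have e20 : 0 < e / 2 by rewrite divr_gt0.
near=> n.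
have n0 : (0 < n)%N by near: n; exact: nbhs_infty_gt.
have ene : en n < e / 2 by near: n; exact: en_lt.
have [g gmin] := exists_global_minimizer (p := p) (betan n) (hn n).
have gshift : minimizer_shift (betan n) (hn n) x (g - x).
  split.
    rewrite /sum_zero/=; under eq_bigr do rewrite !mxE.
    by rewrite sumrB; have [[-> _] _] := gmin; have [[-> _] _] := x_min; rewrite subrr.
  rewrite addrC subrK; split; first by case: gmin.
  by apply: (@nearW _ (nbhs g) _ (nbhs_filter g)) => y Oy; apply: gmin.2.
have [_ /(_ _ gshift)] := dnP n0.
rewrite /euclidean_norm ler_sqrt ?sumr_ge0// => [|i _]; last exact: sqr_ge0.
have E1 : \sum_i (dn n) 0 i ^+ 2 = sqdist (yn n) x.
  by apply: eq_bigr => i _; rewrite /yn !mxE [x 0 i + _]addrC addrK.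
have E2 : \sum_i (g - x) 0 i ^+ 2 = sqdist g x.
  by apply: eq_bigr => i _; rewrite !mxE.
rewrite E1 E2 => /le_lt_trans; apply.
rewrite ltNge; apply/negP => dg; have [Og gle] := gmin.
have := gap g Og dg; have := gle x x_min.1.
have := free_energy_param_lip beta h (betan n) (hn n) Og.
have := free_energy_param_lip beta h (betan n) (hn n) x_min.1.
rewrite -/(en n) !ler_norml => /andP[_ h1] /andP[h2 _] h3 h4.
by move: ene; lra.
Unshelve. all: by end_near. Qed.

Lemma perturbed_minimizer_cvg i : yn n 0 i @[n --> \oo] --> x 0 i.
Proof.
apply/cvgrPdist_lt => e e0.
have := minimizer_shift_sqdist (exprn_gt0 2 e0); apply: filterS => n nd.
rewrite distrC -(@ltr_pXn2r _ 2)// ?nnegrE ?normr_ge0 ?(ltW e0)//.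
by rewrite real_normK ?num_real//; apply: le_lt_trans (sqdist_coord _ _ _) nd.
Qed.

Let x_gt0 := global_minimizer_gt0 x_min.

Lemma perturbed_minimizer_gt0 : \forall n \near \oo, forall i, 0 < yn n 0 i.
Proof.
apply: filter_forall => i.
exact: (cvgr_gt _ (@perturbed_minimizer_cvg i)).
Qed.

Lemma local_minimizer_ray (b k : R) (y w : 'rV[R]_p.+2) : local_minimizer b k y ->
  exists2 e, 0 < e & forall t, `|t| < e -> Omega (y + t *: w) ->
    free_energy b k y <= free_energy b k (y + t *: w).
Proof.
move=> [Oy ymin].
have yw : y + t *: w @[t --> (0 : R)] --> y.
  apply: cvg_rV => i.
  have H : y 0 i + t * w 0 i @[t --> (0 : R)] --> y 0 i + 0 * w 0 i.
    by apply: cvgD; [exact: cvg_cst|apply: cvgM; [exact: cvg_id|exact: cvg_cst]].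
  rewrite mul0r addr0 in H; apply: cvg_trans H.
  by apply: near_eq_cvg; apply: nearW => t; rewrite !mxE.
have /nbhs_ballP[e e0 He] := yw _ ymin.
exists e => // t te; apply: He; rewrite -ball_normE/= sub0r normrN//.
Qed.

(** The linear term of [free_energyB] is the derivative at an interior local
    minimizer along the tangent vector [z - yn n]. *)
Lemma perturbed_energyB n : (0 < n)%N -> (forall i, 0 < yn n 0 i) ->
  forall z, Omega z ->
  free_energy (betan n) (hn n) z - free_energy (betan n) (hn n) (yn n) =
  \sum_i yn n 0 i * psi ((z 0 i - yn n 0 i) / yn n 0 i)
  - betan n / 2 * sqdist z (yn n).
Proof.
move=> n0 y0 z [z1 z0]; have [[dn0 yloc] _] := dnP n0.
have Oy : Omega (yn n) by case: yloc.
rewrite free_energyB//; last by rewrite z1; case: Oy => ->.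
suff -> : \sum_i (z 0 i - yn n 0 i) * gradient (betan n) (hn n) (yn n) i = 0.
  by rewrite add0r.
have [e e0 He] := @local_minimizer_ray _ _ _ (z - yn n) yloc.
have w0 : sum_zero (z - yn n).
  rewrite /sum_zero/= (eq_bigr (fun i => z 0 i - yn n 0 i)).
    by rewrite sumrB z1 Oy.1 subrr.
  by move=> i _; rewrite !mxE.
have [+ _ _] := minimizer_along_ray e0 Oy y0 w0 He.
by move=> E; rewrite -[RHS]E; apply: eq_bigr => i _; rewrite !mxE.
Qed.

Variable c0 : R.
Hypothesis c0_gt0 : 0 < c0.
Hypothesis coercive : forall w : 'rV[R]_p.+2, sum_zero w ->
  c0 * \sum_i w 0 i ^+ 2 <= \sum_i w 0 i ^+ 2 * ((x 0 i)^-1 - beta).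

(** Near [yn n], the cubic term of [psi_ge] costs a factor [1 - d / 3] on the
    entropy part of the Hessian, which coercivity absorbs for small [d]. Farther
    away, the gap does, since [sqdist] is bounded on the simplex. *)
Lemma quadratic_growth : exists2 c, 0 < c & \forall n \near \oo,
  forall z, Omega z ->
  c * sqdist z (yn n) <=
    free_energy (betan n) (hn n) z - free_energy (betan n) (hn n) (yn n).
Proof.
have [mu mu0 mule] := exists_common_lb x_gt0.
(* This [d] makes the loss [d / (3 * x 0 i)] at most [c0 / 4]. *)
pose d := Num.min 1 (3 * c0 * mu / 4).
have d0 : 0 < d by rewrite lt_min ltr01/= divr_gt0// !mulr_gt0.
have d1 : d <= 1 by rewrite ge_min lexx.
have dc : d <= 3 * c0 * mu / 4 by rewrite ge_min lexx orbT.
(* A relative deviation larger than [d] moves a coordinate by [d * mu / 2] away from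
   [yn n], hence by [d * mu / 4] away from [x]. *)
pose d' := (d * mu / 4) ^+ 2.
have d'0 : 0 < d' by rewrite exprn_gt0// divr_gt0// mulr_gt0.
have [e e0 gap] := global_minimizer_gap x_min x_unique d'0.
pose c := Num.min (c0 / 4) (e / 2 / p.+2%:R).
have c_gt0 : 0 < c by rewrite lt_min !divr_gt0.
exists c => //.
have near_curv : \forall n \near \oo, forall i,
    (x 0 i)^-1 - beta - c0 / 2 < (1 - d / 3) / yn n 0 i - betan n.
  apply: filter_forall => i.
  have lim : (1 - d / 3) / yn n 0 i - betan n @[n --> \oo] -->
      (1 - d / 3) / x 0 i - beta.
    apply: cvgB => //; apply: cvgM; first exact: cvg_cst.
    by apply: cvgV; [rewrite gt_eqF|exact: perturbed_minimizer_cvg].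
  apply: (cvgr_gt _ lim).
  have : d / (3 * x 0 i) <= c0 / 4.
    rewrite ler_pdivrMr ?mulr_gt0//; apply: (le_trans dc).
    have := ler_wpM2l (ltW c0_gt0) (mule i); lra.
  have -> : (1 - d / 3) / x 0 i = (x 0 i)^-1 - d / (3 * x 0 i).
    by field; rewrite gt_eqF.
  move: c0_gt0; lra.
have near_y : \forall n \near \oo, forall i, `|x 0 i - yn n 0 i| < d * mu / 4.
  apply: filter_forall => i.
  have /cvgrPdist_lt := @perturbed_minimizer_cvg i; apply.
  by rewrite divr_gt0// mulr_gt0.
have near_f : \forall n \near \oo,
    free_energy beta h (yn n) < free_energy beta h x + e / 4.
  have fc : free_energy beta h (yn n) @[n --> \oo] --> free_energy beta h x.
    by apply: cvg_free_energy => i; exact: perturbed_minimizer_cvg.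
  by apply: (cvgr_lt _ fc); rewrite ltrDl divr_gt0.
near=> n.
have n0 : (0 < n)%N by near: n; exact: nbhs_infty_gt.
have y0 : forall i, 0 < yn n 0 i by near: n; exact: perturbed_minimizer_gt0.
have ene : en n < e / 8 by near: n; apply: en_lt; rewrite divr_gt0.
have curv : forall i, (x 0 i)^-1 - beta - c0 / 2 < (1 - d / 3) / yn n 0 i - betan n.
  by near: n.
have ylose : forall i, `|x 0 i - yn n 0 i| < d * mu / 4 by near: n.
have fy : free_energy beta h (yn n) < free_energy beta h x + e / 4 by near: n.
move=> z Oz.
have Oy : Omega (yn n) by have [[_ []]] := dnP n0.
have [close|/existsNP[i far]] :=
  pselect (forall i, `|(z 0 i - yn n 0 i) / yn n 0 i| <= d).
  rewrite perturbed_energyB//.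
  have w0 : sum_zero (z - yn n).
    rewrite /sum_zero/= (eq_bigr (fun i => z 0 i - yn n 0 i)).
      by rewrite sumrB Oz.1 Oy.1 subrr.
    by move=> i _; rewrite !mxE.
  have := coercive w0.
  have -> : \sum_i (z - yn n) 0 i ^+ 2 = sqdist z (yn n).
    by apply: eq_bigr => i _; rewrite !mxE.
  move=> co.
  have low : \sum_i (z - yn n) 0 i ^+ 2 * ((x 0 i)^-1 - beta - c0 / 2) <=
      2 * (\sum_i yn n 0 i * psi ((z 0 i - yn n 0 i) / yn n 0 i)
      - betan n / 2 * sqdist z (yn n)).
    rewrite /sqdist mulrBr !mulr_sumr -sumrB; apply: ler_sum => i _.
    have -> : (z - yn n) 0 i = z 0 i - yn n 0 i by rewrite !mxE.
    set v := z 0 i - yn n 0 i; have yi0 := y0 i.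
    have := close i; rewrite -/v => /ler_normlP[vl vu].
    have u1 : -1 <= v / yn n 0 i by move: d1; lra.
    have := psi_ge u1 => pg.
    have : yn n 0 i * ((v / yn n 0 i) ^+ 2 * (1 - d / 3)) <=
        2 * (yn n 0 i * psi (v / yn n 0 i)).
      rewrite [leRHS]mulrCA ler_pM2l//.
      have := sqr_ge0 (v / yn n 0 i) => s0.
      have := ler_wpM2l s0 vu.
      move: pg; rewrite exprSr; lra.
    have -> : yn n 0 i * ((v / yn n 0 i) ^+ 2 * (1 - d / 3)) =
      v ^+ 2 * ((1 - d / 3) / yn n 0 i) by field; rewrite gt_eqF.
    have := ler_wpM2l (sqr_ge0 v) (ltW (curv i)); lra.
  have cc : c <= c0 / 4 by rewrite ge_min lexx.
  have := ler_wpM2r (sqdist_ge0 z (yn n)) cc.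
  have : \sum_i (z - yn n) 0 i ^+ 2 * ((x 0 i)^-1 - beta - c0 / 2) =
     \sum_i (z - yn n) 0 i ^+ 2 * ((x 0 i)^-1 - beta) - c0 / 2 * sqdist z (yn n).
    rewrite /sqdist mulr_sumr -sumrB; apply: eq_bigr => i _.
    by rewrite !mxE; ring.
  move: low co; lra.
have dz : d' <= sqdist z x.
  apply: le_trans (sqdist_coord z x i).
  rewrite -[leRHS]real_normK ?num_real// /d'.
  rewrite ler_pXn2r// ?nnegrE ?normr_ge0 ?divr_ge0 ?mulr_ge0 ?(ltW d0) ?(ltW mu0)//.
  move: far => /negP; rewrite -ltNge normrM normfV (gtr0_norm (y0 i)).
  rewrite ltr_pdivlMr// => far.
  have yl := ylose i.
  have ymu : mu / 2 <= yn n 0 i.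
    have := mule i; move: yl; rewrite ltr_norml => /andP[_ +].
    have : d * mu <= mu by rewrite ler_piMl// ltW.
    lra.
  have := ler_wpM2l (ltW d0) ymu.
  have := ler_normB (z 0 i - x 0 i) (yn n 0 i - x 0 i).
  rewrite opprB addrA subrK => t1; rewrite distrC in yl.
  move: far yl t1; lra.
have := gap z Oz dz.
have := free_energy_param_lip beta h (betan n) (hn n) Oz.
have := free_energy_param_lip beta h (betan n) (hn n) Oy.
rewrite -/(en n) !ler_norml => /andP[_ h1] /andP[h2 _] h3.
have sq : sqdist z (yn n) <= p.+2%:R.
  rewrite -[p.+2%:R](_ : \sum_(i < p.+2) 1 = _); last first.
    by rewrite sumr_const card_ord.
  apply: ler_sum => j _; have /andP[z0 z1] := Omega_coord_le1 j Oz.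
  have /andP[y0' y1] := Omega_coord_le1 j Oy.
  by rewrite -real_normK ?num_real// exprn_ile1// ler_norml; lra.
have cc : c <= e / 2 / p.+2%:R by rewrite ge_min lexx orbT.
have : c * sqdist z (yn n) <= e / 2.
  rewrite -[leRHS](divfK (_ : p.+2%:R != 0 :> R)) ?pnatr_eq0//.
  by apply: ler_pM => //; [exact: ltW|exact: sqdist_ge0].
move: ene fy; lra.
Unshelve. all: by end_near. Qed.

Lemma perturbed_minimizer_well : exists2 c, 0 < c &
  \forall n \near \oo, quadratic_well c (betan n) (hn n) (yn n).
Proof.
have [c c_gt0 growth] := quadratic_growth; exists c => //.
near=> n; have n0 : (0 < n)%N by near: n; exact: nbhs_infty_gt.
have y0 : forall i, 0 < yn n 0 i by near: n; exact: perturbed_minimizer_gt0.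
split=> // [|z Oz]; first by have [[_ [[]]]] := dnP n0.
split; first exact: (perturbed_energyB n0 y0 Oz).
by move: z Oz; near: n.
Unshelve. all: by end_near. Qed.

End perturbed_minimizers.

(** * Lattice sums and iterated integrals *)

Section gaussian_majorant.
Context {R : realType}.
Local Notation mu := (@lebesgue_measure R).

Lemma integrable_gaussian (e : R) : 0 < e ->
  mu.-integrable setT (fun w => (expR (- (e * w ^+ 2)))%:E).
Proof.
move=> e0; pose s := Num.sqrt (e *+ 2)^-1.
have s2 : s ^+ 2 = (e *+ 2)^-1 by rewrite sqr_sqrtr// invr_ge0 mulrn_wge0// ltW.
have s0 : s != 0 by rewrite gt_eqF// sqrtr_gt0 invr_gt0 pmulrn_lgt0.
have := integrableZl measurableT (normal_peak s)^-1 (integrable_normal_pdf 0 s).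
apply: eq_integrable => // w _; rewrite normal_pdfE// -EFinM mulKf; last first.
  by rewrite gt_eqF// normal_peak_gt0.
congr (expR _)%:E; rewrite subr0 s2.
by field; rewrite gt_eqF.
Qed.

End gaussian_majorant.

Section riemann_sum.
Context {R : realType}.
Local Notation mu := (@lebesgue_measure R).

Variables (c : nat -> R) (a : nat -> nat -> R) (F : R -> R) (C e : R).
Local Notation s n := (Num.sqrt (n%:R : R)).
Hypothesis e_gt0 : 0 < e.
Hypothesis a_le : forall n k,
  `|a n k| <= C * expR (- (e * ((k%:R - c n) / s n) ^+ 2)).
Hypothesis c_lo : c n / s n @[n --> \oo] --> +oo.
Hypothesis c_hi : (n%:R - c n) / s n @[n --> \oo] --> +oo.
Hypothesis a_cvg : forall (k : nat -> nat) (w : R),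
  ((k n)%:R - c n) / s n @[n --> \oo] --> w -> a n (k n) @[n --> \oo] --> F w.

Let cell n k : set R := `[(k%:R - c n) / s n, (k.+1%:R - c n) / s n[%classic.
Let step n (w : R) : R := \sum_(k < n.+1) a n k * \1_(cell n k) w.

Let C_ge0 : 0 <= C.
Proof.
by have := le_trans (normr_ge0 _) (a_le 0 0); rewrite pmulr_lge0// expR_gt0.
Qed.

Let cellP n k w : (0 < n)%N -> cell n k w <-> k%:R <= c n + w * s n < k.+1%:R.
Proof.
move=> n0; rewrite /cell/= in_itv/= ler_pdivrMr ?sqrtn_gt0// ltr_pdivlMr ?sqrtn_gt0//.
by rewrite lerBlDl ltrBrDl.
Qed.

Let cell0 k : cell 0 k = set0.
Proof.
by rewrite /cell sqrtr0 invr0 !mulr0 set_itvco0.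
Qed.

Let integral_step n : (\int[mu]_w (step n w)%:E = ((s n)^-1 * \sum_(k < n.+1) a n k)%:E)%E.
Proof.
under eq_integral do rewrite /step -sumEFin.
rewrite integral_sum//; last first.
  move=> k; under eq_fun do rewrite EFinM; apply: integrableZl => //.
  apply: integrable_indic_itv.
rewrite mulr_sumr -sumEFin; apply: eq_bigr => k _.
under eq_integral do rewrite EFinM.
rewrite integralZl//; last exact: integrable_indic_itv.
have mc : measurable (cell n k) by exact: measurable_itv.
rewrite integral_indic//= setIT /cell lebesgue_measure_itv/= lte_fin.
have [n0|n0] := posnP n.
  have -> : s n = 0 by rewrite n0 sqrtr0.
  by rewrite invr0 !mulr0 ltxx mule0 mul0r.
rewrite ltr_pM2r ?invr_gt0 ?sqrtn_gt0// ltrD2r ltr_nat ltnSn -EFinD -EFinM.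
by congr EFin; rewrite -mulrBl -natr1; ring.
Qed.

(** As [u ^ 2 >= w ^ 2 / 2 - (w - u) ^ 2], a shift by at most 1 costs a factor
    [exp e] and half of the exponent. *)
Let majorant (w : R) := C * expR e * expR (- (e / 2 * w ^+ 2)).

Let majorant_ge0 w : 0 <= majorant w.
Proof. by rewrite !mulr_ge0 ?expR_ge0. Qed.

Let step0 n w : (forall k, (k < n.+1)%N -> ~ cell n k w) -> step n w = 0.
Proof.
move=> H; apply: big1 => k _; rewrite indicE memNset ?mulr0//.
exact: H.
Qed.

Let step_eq n (w : R) : (0 < n)%N -> 0 <= c n + w * s n < n.+1%:R ->
  cell n (Num.truncn (c n + w * s n)) w /\
  step n w = a n (Num.truncn (c n + w * s n)).
Proof.
move=> n0 /andP[x0 xn]; set x := c n + w * s n in x0 xn *.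
have xk := truncn_itv x0; set k := Num.truncn x in xk *.
have kn : (k < n.+1)%N.
  by rewrite -(ltr_nat R); apply: le_lt_trans xn; case/andP: xk.
have cellk : cell n k w by apply/cellP.
split=> //; rewrite /step (bigD1 (Ordinal kn))//= indicE mem_set// mulr1.
rewrite big1 ?addr0// => j /eqP jk; rewrite indicE memNset ?mulr0//.
move=> /(cellP _ _ n0)/truncn_def xj; apply: jk.
by apply: val_inj => /=; rewrite -xj.
Qed.

Let step_le n w : `|step n w| <= majorant w.
Proof.
have [n0|n0] := posnP n.
  rewrite step0 ?normr0 ?majorant_ge0// => k _.
  by rewrite n0 cell0.
have [xn|xn] := boolP (0 <= c n + w * s n < n.+1%:R); last first.
  rewrite step0 ?normr0 ?majorant_ge0// => k kn /(cellP _ _ n0)/andP[h1 h2].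
  move/negP: xn; apply; rewrite (le_trans _ h1)//=.
  by rewrite (lt_le_trans h2)// ler_nat.
have [/= + ->] := step_eq n0 xn; set k := Num.truncn _.
rewrite /cell/= in_itv/= => /andP[uw wu].
apply: (le_trans (a_le n k)).
rewrite /majorant -mulrA ler_wpM2l// -expRD ler_expR.
move: uw wu; set u := (k%:R - c n) / s n => uw.
have -> : (k.+1%:R - c n) / s n = u + (s n)^-1 by rewrite /u -natr1; ring.
have s1 : (s n)^-1 <= 1.
  by rewrite invf_le1 ?sqrtn_gt0// -[leLHS]sqrtr1 ler_sqrt ?ler0n// ler1n.
move=> wu; have d0 : 0 <= w - u by rewrite subr_ge0.
have d1 : w - u <= 1 by move: wu s1; lra.
have : (w - u) ^+ 2 <= 1 by rewrite exprn_ile1.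
have := sqr_ge0 (w - 2 * u) => h1 h2.
have := ler_wpM2l (ltW e_gt0) h2.
have := ler_wpM2l (ltW e_gt0) h1.
rewrite !mulr0 mulr1; lra.
Qed.

Let step_cvg w : step n w @[n --> \oo] --> F w.
Proof.
(* The cells of [step n] cover [w] for large [n], as the box grows on both sides. *)
have near_in : \forall n \near \oo, (0 < n)%N /\ 0 <= c n + w * s n < n.+1%:R.
  near=> n.
  have n0 : (0 < n)%N by near: n; exact: nbhs_infty_gt.
  split => //; apply/andP; split.
    have : - w <= c n / s n by near: n; move/cvgryPge: c_lo; apply.
    by rewrite ler_pdivlMr ?sqrtn_gt0// mulNr lerNl -subr_ge0 opprK addrC; lra.
  have : w <= (n%:R - c n) / s n by near: n; move/cvgryPge: c_hi; apply.
  by rewrite ler_pdivlMr ?sqrtn_gt0// -natr1; lra.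
have near_eq : \forall n \near \oo,
    a n (Num.truncn (c n + w * s n)) = step n w.
  by move: near_in; apply: filterS => n [n0 xn]; have [_ ->] := step_eq n0 xn.
apply: cvg_trans (near_eq_cvg near_eq) _.
apply: a_cvg; apply/cvgrPdist_lt => d d0.
have : \forall n \near \oo, (s n)^-1 < d by exact: (cvgr_lt _ (@invsqrtn_cvg0 R)).
move: near_in; apply: filterS2 => n [n0 xn] sd.
have [+ _] := step_eq n0 xn; set k := Num.truncn _.
rewrite /cell/= in_itv/= => /andP[uw wu].
rewrite ger0_norm ?subr_ge0//; apply: lt_trans sd.
move: wu; rewrite -natr1 addrAC mulrDl mul1r; lra.
Unshelve. all: by end_near. Qed.

(** The sum is the integral of the step function equal to [a n k] on the [k]-th
    cell, of length [1 / sqrt n]. Steps converge pointwise, and a point is within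
    distance 1 of the left end of its cell, whence a Gaussian majorant. *)
Lemma riemann_sum_cvg :
  (s n)^-1 * \sum_(k < n.+1) a n k @[n --> \oo] --> \int[mu]_w F w.
Proof.
have e2 : 0 < e / 2 by rewrite divr_gt0.
have ig : mu.-integrable setT (EFin \o majorant).
  have := integrableZl measurableT (C * expR e) (integrable_gaussian e2).
  by apply: eq_integrable.
have mstep n : measurable_fun [set: measurableTypeR R] (fun w => (step n w)%:E).
  apply/measurable_EFinP; apply: measurable_sum => k.
  by apply: measurable_funM => //; apply: measurable_indic; exact: measurable_itv.
have stepF w : (step n w)%:E @[n --> \oo] --> (F w)%:E.
  by apply: cvg_EFin; [exact: nearW|exact: step_cvg].
have dom n w : (`|(step n w)%:E| <= (majorant w)%:E)%E.
  by rewrite lee_fin step_le.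
have lebF := @dominated_cvg _ _ R mu setT measurableT (fun n w => (step n w)%:E)
  (fun w => (F w)%:E) (fun w => (majorant w)%:E) mstep (fun w _ => stepF w)
  (fun w _ => isT) ig (fun n w _ => dom n w).
have intF := @lebesgue_integral_dominated_convergence.dominated_integrable _ _ R mu setT measurableT (fun n w => (step n w)%:E)
  (fun w => (F w)%:E) (fun w => (majorant w)%:E) mstep (fun w _ => stepF w)
  ig (fun n w _ => dom n w).
have intF_fin := integrable_fin_num measurableT intF.
have H : ((s n)^-1 * \sum_(k < n.+1) a n k)%:E @[n --> \oo] --> (\int[mu]_w F w)%:E.
  by rewrite /Rintegral fineK//; move: lebF; under eq_fun do rewrite integral_step.
exact: fine_cvg H.
Qed.

End riemann_sum.

Section iterated.
Context {R : realType}.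
Local Notation mu := (@lebesgue_measure R).

Definition rV_cons (T : Type) m (t : T) (v : 'rV[T]_m) : 'rV[T]_m.+1 :=
  \row_i oapp (v 0) t (unlift ord0 i).

Lemma rV_cons0 (T : Type) m (t : T) (v : 'rV[T]_m) : rV_cons t v 0 ord0 = t.
Proof. by rewrite mxE unlift_none. Qed.

Lemma rV_consS (T : Type) m (t : T) (v : 'rV[T]_m) i :
  rV_cons t v 0 (lift ord0 i) = v 0 i.
Proof. by rewrite mxE liftK. Qed.

Lemma rV_consP (T : Type) m (v : 'rV[T]_m.+1) :
  v = rV_cons (v 0 ord0) (\row_i v 0 (lift ord0 i)).
Proof.
apply/rowP => i; case: (unliftP ord0 i) => [j ->|->].
  by rewrite rV_consS mxE.
by rewrite rV_cons0.
Qed.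

(** Integrating one coordinate at a time matches the recursions of [boxsum] and of
    the Gaussian vectors below, which peel off coordinate 0. *)
Fixpoint iterint m : ('rV[R]_m -> R) -> R :=
  match m with
  | 0 => fun F => F 0
  | m'.+1 => fun F =>
      iterint (fun v : 'rV[R]_m' => \int[mu]_t F (rV_cons t v))
  end.

Fixpoint boxsum N m : ('rV[nat]_m -> R) -> R :=
  match m with
  | 0 => fun a => a 0
  | m'.+1 => fun a =>
      boxsum N (fun v : 'rV[nat]_m' => \sum_(k < N.+1) a (rV_cons (k : nat) v))
  end.

Lemma eq_boxsum N m (a b : 'rV[nat]_m -> R) : a =1 b -> boxsum N a = boxsum N b.
Proof. by move=> /funext ->. Qed.

Lemma boxsumZ N m (a : 'rV[nat]_m -> R) r :
  boxsum N (fun k => r * a k) = r * boxsum N a.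
Proof.
elim: m a => [//|m IH] a /=; rewrite -IH; apply: eq_boxsum => v.
by rewrite mulr_sumr.
Qed.

Local Notation s n := (Num.sqrt (n%:R : R)).

(** By induction on the dimension: summed over coordinate 0, the family still
    satisfies the hypotheses. Its limits are one-dimensional integrals, and its
    majorant only loses the supremum [K] of the one-dimensional Gaussian sums. *)
Lemma lattice_sum_cvg m (c : nat -> 'I_m -> R) (a : nat -> 'rV[nat]_m -> R)
    (F : 'rV[R]_m -> R) (C e : R) :
  0 < e ->
  (forall n k, `|a n k| <=
     C * expR (- (e * \sum_i (((k 0 i)%:R - c n i) / s n) ^+ 2))) ->
  (forall i, c n i / s n @[n --> \oo] --> +oo) ->
  (forall i, (n%:R - c n i) / s n @[n --> \oo] --> +oo) ->
  (forall (k : nat -> 'rV[nat]_m) (w : 'rV[R]_m),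
     (forall i, ((k n 0 i)%:R - c n i) / s n @[n --> \oo] --> w 0 i) ->
     a n (k n) @[n --> \oo] --> F w) ->
  (s n)^-1 ^+ m * boxsum n (a n) @[n --> \oo] --> iterint F.
Proof.
move=> e0; elim: m c a F C => [|m IH] c a F C a_le c_lo c_hi a_cvg /=.
  under eq_fun do rewrite expr0 mul1r.
  by apply: (a_cvg (fun=> 0)) => -[].
have C0 : 0 <= C.
  by have := le_trans (normr_ge0 _) (a_le 0 0); rewrite pmulr_lge0// expR_gt0.
pose c0 n := c n ord0; pose c' n i := c n (lift ord0 i).
have gauss_sum : exists2 K : R, 0 <= K & forall n,
    (s n)^-1 * \sum_(k < n.+1) expR (- (e * ((k%:R - c0 n) / s n) ^+ 2)) <= K.
  pose g n (k : nat) := expR (- (e * ((k%:R - c0 n) / s n) ^+ 2)).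
  have lim : (s n)^-1 * \sum_(k < n.+1) g n k @[n --> \oo] -->
      \int[mu]_w expR (- (e * w ^+ 2)).
    apply: (@riemann_sum_cvg R c0 g (fun w => expR (- (e * w ^+ 2))) 1 e e0).
    - by move=> n k; rewrite mul1r ger0_norm ?expR_ge0.
    - exact: c_lo.
    - exact: c_hi.
    - move=> k w kw.
      apply: (@cvg_comp _ _ _ (fun n => - (e * (((k n)%:R - c0 n) / s n) ^+ 2)) expR
        _ (nbhs (- (e * w ^+ 2)))).
        by apply: cvgN; apply: cvgM; [exact: cvg_cst|exact: cvg_sqr].
      exact: continuous_expR.
  have [M [_ HM]] := cvg_seq_bounded (cvgP _ lim).
  exists (`|M| + 1) => [|n]; first by rewrite addr_ge0.
  apply: le_trans (ler_norm _) _; apply: HM => //.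
  by rewrite (le_lt_trans (ler_norm M))// ltrDl.
have [K K0 Kle] := gauss_sum.
pose a' n v := (s n)^-1 * \sum_(k < n.+1) a n (rV_cons (k : nat) v).
have E n : (s n)^-1 ^+ m.+1 * boxsum n (fun v => \sum_(k < n.+1) a n (rV_cons (k : nat) v))
   = (s n)^-1 ^+ m * boxsum n (a' n).
  by rewrite exprSr -mulrA -boxsumZ.
under eq_fun do rewrite E.
apply: (IH c' a' _ (C * K)) => //.
- move=> n v; rewrite /a' normrM ger0_norm ?invr_ge0 ?sqrtr_ge0//.
  apply: (@le_trans _ _ ((s n)^-1 * \sum_(k < n.+1)
     (C * expR (- (e * \sum_i (((v 0 i)%:R - c' n i) / s n) ^+ 2)) *
      expR (- (e * ((k%:R - c0 n) / s n) ^+ 2))))).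
    rewrite ler_wpM2l ?invr_ge0 ?sqrtr_ge0//.
    apply: le_trans (ler_norm_sum _ _ _) _; apply: ler_sum => k _.
    apply: (le_trans (a_le _ _)); rewrite -mulrA ler_wpM2l// -expRD ler_expR.
    rewrite big_ord_recl rV_cons0 -/(c0 n).
    under eq_bigr do rewrite rV_consS.
    by rewrite mulrDr opprD addrC.
  rewrite -mulr_sumr mulrCA -[leLHS]mulrA -[leRHS]mulrA ler_wpM2l//.
  by rewrite [leRHS]mulrC ler_wpM2l ?expR_ge0.
- by move=> i; exact: c_lo.
- by move=> i; exact: c_hi.
- move=> v w vw; rewrite /a'.
  apply: (@riemann_sum_cvg R c0 (fun n k => a n (rV_cons k (v n)))
    (fun t => F (rV_cons t w)) C e e0).
  + move=> n k; apply: (le_trans (a_le _ _)); rewrite ler_wpM2l// ler_expR lerN2.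
    rewrite ler_pM2l// big_ord_recl rV_cons0 lerDl sumr_ge0// => i _.
    exact: sqr_ge0.
  + exact: c_lo.
  + exact: c_hi.
  + move=> k t kt; apply: a_cvg => i.
    case: (unliftP ord0 i) => [j ->|->].
      by rewrite rV_consS; under eq_fun do rewrite rV_consS; exact: vw.
    by rewrite rV_cons0; under eq_fun do rewrite rV_cons0; exact: kt.
Qed.

End iterated.

(** * Affine images and convolutions of normal laws *)

Section affine_change.
Context {R : realType}.
Local Notation mu := (@lebesgue_measure R).
Variables (m s : R).
Hypothesis s0 : s != 0.

Let phi (z : R) : R := m + s * z.

Let mphi : measurable_fun [set: R] phi.
Proof. by apply: measurable_funD => //; exact: measurable_funM. Qed.

Let mphi' : @measurable_fun _ _ (measurableTypeR R) (measurableTypeR R) setT phi := mphi.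

Let push : {measure set measurableTypeR R -> \bar R} :=
  measure_function_pushforward__canonical__measure_function_Measure mu mphi'.

Lemma lebesgue_measure_affine (A : set R) : measurable A ->
  mu A = (`|s|%:E * mu (phi @^-1` A))%E.
Proof.
have sn0 : 0 <= `|s| by [].
pose nu := mscale (NngNum sn0) push.
move=> mA; rewrite -[RHS]/(nu A).
apply: lebesgue_measure_unique => // _ [[x y] _ <-]/=.
rewrite /nu /mscale/= -[pushforward _ _ _]/(mu (phi @^-1` `]x, y]%classic)).
have [xy|yx] := leP y x.
  have E : `]x, y]%classic = set0 :> set R by apply: set_itv_ge; rewrite bnd_simp -leNgt.
  by rewrite E preimage_set0 !measure0 mule0.
rewrite lebesgue_measure_itv/= lte_fin yx.
have [s_lt0|s_gt0] : s < 0 \/ 0 < s by move: s0; rewrite neq_lt => /orP.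
  have -> : phi @^-1` `]x, y]%classic = `[(y - m) / s, (x - m) / s[%classic.
    apply/seteqP; split => z /=; rewrite !in_itv/= /phi ler_ndivrMr// ltr_ndivlMr//;
      rewrite (mulrC z); move=> /andP[h1 h2]; apply/andP; split; lra.
  rewrite lebesgue_measure_itv/= lte_fin ltr_nM2r ?invr_lt0// ltrD2r yx.
  by rewrite ltr0_norm// -!EFinD -EFinM; congr EFin; field.
have -> : phi @^-1` `]x, y]%classic = `](x - m) / s, (y - m) / s]%classic.
  apply/seteqP; split => z /=; rewrite !in_itv/= /phi ler_pdivlMr// ltr_pdivrMr//;
    rewrite (mulrC z); move=> /andP[h1 h2]; apply/andP; split; lra.
rewrite lebesgue_measure_itv/= lte_fin ltr_pM2r ?invr_gt0// ltrD2r yx.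
by rewrite gtr0_norm// -!EFinD -EFinM; congr EFin; field.
Qed.

Lemma integral_affine (f : R -> \bar R) : measurable_fun [set: R] f ->
  (forall z, 0 <= f z)%E ->
  (\int[mu]_t f t = `|s|%:E * \int[mu]_z f (m + s * z)%R)%E.
Proof.
move=> mf f0; have sn0 : 0 <= `|s| by [].
pose nu := mscale (NngNum sn0) push.
transitivity (\int[nu]_t f t)%E.
  apply: eq_measure_integral => A mA _; exact: lebesgue_measure_affine.
rewrite ge0_integral_mscale//; congr (_ * _)%E.
by rewrite /push ge0_integral_pushforward.
Qed.

Lemma measurable_normal_pdf_patch (a b : R) (A : set R) : measurable A ->
  measurable_fun [set: R] ((fun x => (normal_pdf a b x)%:E) \_ A).
Proof.
move=> mA; apply/(measurable_restrictT _ _).1 => //; apply: measurable_funTS.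
by apply/measurable_EFinP; exact: measurable_normal_pdf.
Qed.

Lemma normal_pdf_patch_ge0 (a b : R) (A : set R) x :
  (0 <= ((fun x => (normal_pdf a b x)%:E) \_ A) x)%E.
Proof. by rewrite /patch; case: ifP => // _; rewrite lee_fin normal_pdf_ge0. Qed.

Lemma normal_pdf_affine z : `|s| * normal_pdf m s (m + s * z) = normal_pdf 0 1 z.
Proof.
rewrite !normal_pdfE//= ?oner_neq0// mulrA; congr (_ * _).
  rewrite /normal_peak.
  have -> : s ^+ 2 * pi *+ 2 = s ^+ 2 * (1 ^+ 2 * pi *+ 2) :> R.
    by rewrite expr1n mul1r mulrnAr.
  by rewrite sqrtrM ?sqr_ge0// sqrtr_sqr invfM mulVKf ?normr_eq0.
rewrite /normal_fun; congr expR; rewrite expr1n subr0 [m + _]addrC addrK; field.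
by [].
Qed.

Lemma normal_prob_affine (A : set R) : measurable A ->
  normal_prob m s A = normal_prob 0 1 [set z | A (m + s * z)].
Proof.
move=> mA; have mB : measurable [set z | A (m + s * z)].
  by rewrite -[X in measurable X]setTI; exact: mphi.
rewrite /normal_prob [in LHS]integral_mkcond integral_affine; last 2 first.
- exact: measurable_normal_pdf_patch.
- by move=> z; exact: normal_pdf_patch_ge0.
rewrite [in RHS]integral_mkcond -ge0_integralZl//; last 2 first.
- have := measurable_normal_pdf_patch m s mA => h.
  exact: (measurableT_comp h mphi).
- by move=> z _; exact: normal_pdf_patch_ge0.
apply: eq_integral => z _; rewrite /patch/=.
have -> : (z \in [set z0 | A (m + s * z0)]) = (m + s * z \in A).
  by apply/idP/idP; rewrite !inE.
by case: ifP => _; rewrite ?mule0// -EFinM normal_pdf_affine.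
Qed.

End affine_change.

Section normal_density_integral.
Context {R : realType}.
Local Notation mu := (@lebesgue_measure R).

(** The density is almost everywhere the Radon-Nikodym derivative, for which
    change of variables holds. *)
Lemma integral_normal_prob (m s : R) (f : R -> \bar R) :
  (normal_prob m s).-integrable setT f ->
  (\int[normal_prob m s]_x f x = \int[mu]_x (f x * (normal_pdf m s x)%:E))%E.
Proof.
move=> intf; have dom := normal_prob_dominates m s.
rewrite -(Radon_Nikodym_change_of_variables dom)//=.
have mf := measurable_int _ intf.
have mpdf : measurable_fun [set: R] (fun x => (normal_pdf m s x)%:E).
  by apply/measurable_EFinP; exact: measurable_normal_pdf.
have intRN : mu.-integrable setT
    (Radon_Nikodym (charge_of_finite_measure (normal_prob m s)) mu).
  by apply: Radon_Nikodym_integrable; exact: dom.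
apply: ae_eq_integral => //.
- by apply: emeasurable_funM => //; exact: measurable_int intRN.
- exact: emeasurable_funM.
apply: ae_eqe_mul2l; apply: integral_ae_eq => //= E _ mE.
by rewrite -Radon_Nikodym_integral.
Qed.

End normal_density_integral.

Section normal_convolution.
Context {R : realType}.
Local Notation mu := (@lebesgue_measure R).

Lemma normal_pdf_norm (m s : R) : normal_pdf m `|s| = normal_pdf m s.
Proof.
apply/funext => x; rewrite /normal_pdf normr_eq0 /normal_peak /normal_fun.
by rewrite -normrX ger0_norm ?sqr_ge0.
Qed.

(** Completing the square in [z]: the joint density of [z] and [x = k * z + s * y],
    with [z] and [y] standard, disintegrated over [x] instead of over [z]. *)
Lemma normal_pdf_mulE (k s x z : R) : s != 0 ->
  normal_pdf (k * z) s x * normal_pdf 0 1 z =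
  normal_pdf 0 (Num.sqrt (k ^+ 2 + s ^+ 2)) x *
  normal_pdf (k * x / (k ^+ 2 + s ^+ 2)) (s / Num.sqrt (k ^+ 2 + s ^+ 2)) z.
Proof.
move=> s0; set v := k ^+ 2 + s ^+ 2.
have v0 : 0 < v by rewrite ltr_wpDl ?sqr_ge0// exprn_even_gt0.
have sv0 : Num.sqrt v != 0 by rewrite gt_eqF// sqrtr_gt0.
have ssv0 : s / Num.sqrt v != 0 by rewrite mulf_neq0// invr_neq0.
have v2 : Num.sqrt v ^+ 2 = v by rewrite sqr_sqrtr// ltW.
rewrite !normal_pdfE ?oner_neq0//= mulrACA [RHS]mulrACA; congr (_ * _).
  rewrite /normal_peak -!invfM -!sqrtrM; first last.
  - by rewrite mulrn_wge0// mulr_ge0 ?sqr_ge0 ?pi_ge0.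
  - by rewrite mulrn_wge0// mulr_ge0 ?sqr_ge0 ?pi_ge0.
  congr (Num.sqrt _)^-1; rewrite v2 expr_div_n v2 expr1n; field.
  by rewrite gt_eqF.
rewrite /normal_fun -!expRD; congr expR.
rewrite v2 expr_div_n v2 expr1n subr0 /v; field.
by rewrite -/v (gt_eqF v0) s0.
Qed.

(** By Tonelli, [z] can be integrated first, and [normal_pdf_mulE] shows what it
    leaves. *)
Lemma normal_prob_convolution (k s : R) (A : set R) : s != 0 -> measurable A ->
  (\int[normal_prob 0 1]_z normal_prob (k * z)%R s A =
   normal_prob 0 (Num.sqrt (k ^+ 2 + s ^+ 2)) A)%E.
Proof.
move=> s0 mA; set v := k ^+ 2 + s ^+ 2.
pose h (u : R * R) := \1_A u.2 * normal_pdf (k * u.1) s u.2.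
have mh : measurable_fun [set: R * R] h.
  apply: measurable_funM.
    have m1 : measurable_fun [set: R] (\1_A : R -> R) by exact: measurable_indic.
    exact: (measurableT_comp m1 measurable_snd).
  rewrite /h; under eq_fun do rewrite normal_pdfE//.
  apply: measurable_funM => //; apply: measurableT_comp => //.
  apply: measurable_funM => //; apply: measurableT_comp => //.
  apply: measurable_funX; apply: measurable_funB; first exact: measurable_snd.
  by apply: measurable_funM => //; exact: measurable_fst.
have h0 u : 0 <= h u by rewrite mulr_ge0// normal_pdf_ge0.
have E1 z : (normal_prob (k * z)%R s A = \int[mu]_x (h (z, x))%:E)%E.
  rewrite /normal_prob integral_mkcond; apply: eq_integral => x _.
  rewrite /patch /h /= indicE.
  by case: (x \in A); rewrite ?mul1r ?mul0r.
have mN : measurable_fun [set: R] (fun z => normal_prob (k * z)%R s A).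
  rewrite (_ : (fun z => _) = (fun z => \int[mu]_x (h (z, x))%:E)%E).
    apply: (@measurable_fun_fubini_tonelli_F _ _ _ _ R mu (fun u => (h u)%:E)) => //.
    exact/measurable_EFinP.
  by apply: funext => z; exact: E1.
rewrite integral_normal_prob; last first.
  apply: (@le_integrable _ _ _ _ _ _ _ (cst 1%E)) => //.
    by move=> z _; rewrite gee0_abs ?measure_ge0// gee0_abs// probability_le1.
  exact: finite_measure_integrable_cst.
have mN01 : measurable_fun [set: R * R] (fun u : R * R => normal_pdf 0 1 u.1).
  exact: (measurableT_comp (measurable_normal_pdf 0 1) measurable_fst).
under eq_integral do rewrite E1.
transitivity (\int[mu]_z \int[mu]_x (h (z, x) * normal_pdf 0 1 z)%:E)%E.
  apply: eq_integral => z _; rewrite -ge0_integralZr//.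
  - by apply/measurable_EFinP; exact: (measurableT_comp mh (pair1_measurable z)).
  - by move=> x _; rewrite lee_fin.
  - by rewrite lee_fin normal_pdf_ge0.
rewrite (@fubini_tonelli _ _ _ _ R mu mu (fun u => (h u * normal_pdf 0 1 u.1)%:E)); last 2 first.
- by apply/measurable_EFinP; exact: measurable_funM.
- by move=> u; rewrite lee_fin mulr_ge0// normal_pdf_ge0.
rewrite /normal_prob [RHS]integral_mkcond; apply: eq_integral => x _.
rewrite /patch /h /=; under eq_integral do rewrite -mulrA normal_pdf_mulE// mulrA EFinM.
rewrite ge0_integralZl//; last 3 first.
- by apply/measurable_EFinP; exact: measurable_normal_pdf.
- by move=> z _; rewrite lee_fin normal_pdf_ge0.
- by rewrite lee_fin mulr_ge0// normal_pdf_ge0.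
rewrite integral_normal_pdf mule1 indicE.
by case: (x \in A); rewrite ?mul1r ?mul0r.
Qed.

End normal_convolution.

(** * Gaussian vectors with a given precision matrix *)

Section gaussian_vectors.
Context {R : realType}.
Local Notation mu := (@lebesgue_measure R).
Local Notation N01 := (normal_prob (0 : R) 1).

(** A standard normal variable scaled by [k] plus an independent centered normal
    one. For [v > 0] this is a convolution of densities; for [v = 0] the second
    term is almost surely 0 and the sum is an affine image, or 0 when [k = 0]. *)
Lemma centered_normal_add d (T : measurableType d) (P : probability T R)
    (Y : T -> R) (v k : R) (A : set R) :
  measurable_fun [set: T] Y -> 0 <= v ->
  (forall B, measurable B -> P (Y @^-1` B) = centered_normal v B) ->
  measurable A ->
  (N01 \x P)%E [set u | A (k * u.1 + Y u.2)] = centered_normal (k ^+ 2 + v) A.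
Proof.
move=> mY v0 lawY mA; rewrite /product_measure1.
transitivity (\int[N01]_z centered_normal v [set y | A (k * z + y)%R])%E.
  apply: eq_integral => z _ /=; rewrite -lawY.
    by congr (P _); apply/seteqP; split => t; rewrite /xsection/= inE.
  rewrite -[X in measurable X]setTI.
  have : measurable_fun [set: R] (fun y => k * z + y) by exact: measurable_funD.
  exact.
rewrite /centered_normal paddr_eq0 ?sqr_ge0// sqrf_eq0.
have [->|v_neq0] := eqVneq v 0; last first.
  have s0 : Num.sqrt v != 0 by rewrite gt_eqF// sqrtr_gt0 lt_neqAle eq_sym v_neq0.
  have -> : k ^+ 2 + v = k ^+ 2 + Num.sqrt v ^+ 2 by rewrite sqr_sqrtr.
  rewrite andbF -(normal_prob_convolution k s0 mA).
  apply: eq_integral => z _.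
  have mB : measurable [set y | A (k * z + y)].
    rewrite -[X in measurable X]setTI.
    have : measurable_fun [set: R] (fun y => k * z + y) by exact: measurable_funD.
    exact.
  rewrite (normal_prob_affine 0 s0 mB) (normal_prob_affine (k * z) s0 mA).
  by congr (normal_prob _ _ _); apply/seteqP; split => y /=; rewrite add0r.
rewrite andbT addr0; have [->|k0] := eqVneq k 0.
  under eq_integral do rewrite mul0r.
  rewrite integral_cst// [X in (_ * X)%E](@probability_setT _ _ _ N01) mule1.
  rewrite diracE indicE.
  suff -> : (0 \in [set y | A (0 + y)]) = (0 \in A) by [].
  by apply/idP/idP; rewrite !inE/= add0r.
have -> : normal_prob 0 (Num.sqrt (k ^+ 2)) A = normal_prob 0 k A.
  by rewrite sqrtr_sqr /normal_prob normal_pdf_norm.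
have mB : measurable [set z | A (k * z)].
  rewrite -[X in measurable X]setTI.
  have : measurable_fun [set: R] (fun y => k * y) by exact: measurable_funM.
  exact.
rewrite (normal_prob_affine 0 k0 mA).
transitivity (\int[N01]_z (\1_[set z | A (k * z)] z)%:E)%E.
  apply: eq_integral => z _; rewrite diracE indicE.
  suff -> : (0 \in [set y | A (k * z + y)]) = (z \in [set z | A (k * z)]) by [].
  by apply/idP/idP; rewrite !inE/= addr0.
rewrite integral_indic// setIT; congr (N01 _).
by apply/seteqP; split => y /=; rewrite add0r.
Qed.

(** Only measurability along random vectors matters, and it needs no sigma-algebra
    on the row vectors. *)
Definition Borel_measurable m (F : 'rV[R]_m -> R) : Prop :=
  forall d (T : measurableType d) (X : T -> 'rV[R]_m),
    random_vector X -> measurable_fun [set: T] (F \o X).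

(** An open set is the union of countably many boxes with rational centers and
    radii, and the preimage of a box is measurable coordinatewise. *)
Lemma continuous_Borel_measurable m (F : 'rV[R]_m -> R) :
  continuous F -> Borel_measurable F.
Proof.
move=> cF d T X mX.
have openV V : open V -> measurable (X @^-1` V).
  move=> oV; pose box (u : 'rV[rat]_m * rat) : set 'rV[R]_m :=
    [set w | forall i, `|ratr (u.1 0 i) - w 0 i| < ratr u.2].
  pose D : set ('rV[rat]_m * rat) := [set u | box u `<=` V].
  have -> : V = \bigcup_u (if u \in D then box u else set0).
    apply/seteqP; split => [w Vw|w [u _]]; last first.
      by case: ifPn => // uD; move: uD; rewrite inE; exact.
    have /nbhs_ballP[e e0 He] : nbhs w V by exact: open_nbhs_nbhs.
    have [r] := rat_in_itvoo (divr_gt0 e0 (ltr0n R 2) : 0 < e / 2).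
    rewrite in_itv/= => /andP[r0 re].
    have pick i : {q : rat | `|ratr q - w 0 i| < ratr r}.
      apply: cid; have [|q] := @rat_in_itvoo R (w 0 i - ratr r) (w 0 i + ratr r).
        by rewrite ltrBlDr -addrA ltrDl addr_gt0.
      rewrite in_itv/= => /andP[q1 q2]; exists q.
      by rewrite ltr_norml; apply/andP; split; lra.
    pose u : 'rV[rat]_m * rat := (\row_i sval (pick i), r).
    have uw : box u w by move=> i; rewrite /= mxE; exact: svalP (pick i).
    exists u => //; rewrite ifT// inE => z uz; apply: He; split=> // i j.
    rewrite ord1 -ball_normE/=; have := uz j; have := uw j.
    rewrite -[w 0 j - z 0 j](subrKA (ratr (u.1 0 j))) => h1 h2.
    apply: le_lt_trans (ler_normD _ _) _; rewrite distrC.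
    by move: re h1 h2 => /=; lra.
  rewrite preimage_bigcup; apply: countable_bigcupT_measurable => [|u].
    exact: countableP.
  case: ifP => _; last by rewrite preimage_set0.
  have -> : X @^-1` box u =
      \bigcap_(i in [set: 'I_m]) [set t | `|ratr (u.1 0 i) - X t 0 i| < ratr u.2].
    by apply/seteqP; split => t /= H i; [move=> _|]; apply: H.
  apply: fin_bigcap_measurable => // i _.
  rewrite -[X in measurable X]setTI.
  have : measurable_fun [set: T] (fun t => `|ratr (u.1 0 i) - X t 0 i|).
    apply: measurableT_comp => //; apply: measurable_funB => //; exact: mX.
  move=> /(_ measurableT `]-oo, ratr u.2[%classic) /=.
  move=> /(_ (measurable_itv _)); rewrite /preimage/=.
  by under eq_set do rewrite in_itv/=.
apply: (measurability _ (RGenOInfty.measurableE R)) => //.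
move=> _ [_ [a ->] <-]; rewrite setTI.
have -> : (F \o X) @^-1` `]a, +oo[%classic = X @^-1` (F @^-1` `]a, +oo[%classic) by [].
apply: openV; apply: open_comp => [w _|]; first exact: cF.
exact: interval_open.
Qed.

Definition bform m (P : 'M[R]_m) (b w : 'rV[R]_m) : R :=
  \sum_i \sum_j b 0 i * P i j * w 0 j.

Definition posdef m (P : 'M[R]_m) : Prop :=
  (forall i j, P i j = P j i) /\ forall w, w != 0 -> 0 < bform P w w.

(** The Schur complement of the entry [(0, 0)]: the precision matrix left for the
    other coordinates once coordinate 0 is integrated out. *)
Definition schur m (P : 'M[R]_m.+1) : 'M[R]_m :=
  \matrix_(i, j) (P (lift ord0 i) (lift ord0 j)
    - P ord0 (lift ord0 i) * P ord0 (lift ord0 j) / P ord0 ord0).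

(** The opposite of the value of coordinate 0 minimizing the quadratic form when the
    other coordinates are those of [w]. *)
Definition pivot_dot m (P : 'M[R]_m.+1) (w : 'rV[R]_m) : R :=
  (\sum_i P ord0 (lift ord0 i) * w 0 i) / P ord0 ord0.

Lemma posdef_pivot m (P : 'M[R]_m.+1) : posdef P -> 0 < P ord0 ord0.
Proof.
move=> [_ pos]; have := pos (delta_mx 0 ord0).
have -> : bform P (delta_mx 0 ord0) (delta_mx 0 ord0) = P ord0 ord0.
  rewrite /bform (bigD1 ord0)//= (bigD1 ord0)//= !mxE !eqxx/= mul1r mulr1.
  rewrite big1 ?addr0; last by move=> j /negbTE j0; rewrite mxE j0 andbF mulr0.
  rewrite big1 ?addr0// => i /negbTE i0; rewrite big1// => j _.
  by rewrite mxE i0 andbF !mul0r.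
apply; apply/eqP => /rowP/(_ ord0)/eqP.
by rewrite !mxE !eqxx/= oner_eq0.
Qed.

Lemma bform_schur m (P : 'M[R]_m.+1) (b w : 'rV[R]_m) : P ord0 ord0 != 0 ->
  bform (schur P) b w =
  \sum_i \sum_j b 0 i * P (lift ord0 i) (lift ord0 j) * w 0 j
  - P ord0 ord0 * pivot_dot P b * pivot_dot P w.
Proof.
move=> a0.
have -> : P ord0 ord0 * pivot_dot P b * pivot_dot P w =
    \sum_i \sum_j P ord0 (lift ord0 i) * b 0 i * (P ord0 (lift ord0 j) * w 0 j) / P ord0 ord0.
  rewrite /pivot_dot [P _ _ * _]mulrC divfK// mulrA.
  rewrite mulr_suml mulr_suml; apply: eq_bigr => i _.
  by rewrite mulr_sumr mulr_suml.
rewrite /bform -sumrB; apply: eq_bigr => i _; rewrite -sumrB; apply: eq_bigr => j _.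
by rewrite mxE; field.
Qed.

(** Completing the square in coordinate 0. *)
Lemma bform_cons m (P : 'M[R]_m.+1) r b t w : posdef P ->
  bform P (rV_cons r b) (rV_cons t w) =
  P ord0 ord0 * (r + pivot_dot P b) * (t + pivot_dot P w) + bform (schur P) b w.
Proof.
move=> posP; have a0 := posdef_pivot posP; have [sym _] := posP.
rewrite bform_schur ?gt_eqF// /bform big_ord_recl.
rewrite big_ord_recl !rV_cons0.
under eq_bigr do rewrite rV_consS.
under [X in _ + X = _]eq_bigr => i _.
  rewrite big_ord_recl rV_cons0 rV_consS.
  under eq_bigr do rewrite rV_consS.
  over.
rewrite big_split/=.
set B := \sum_i P ord0 (lift ord0 i) * b 0 i.
set B' := \sum_i P ord0 (lift ord0 i) * w 0 i.
have -> : \sum_(i < m) r * P ord0 (lift ord0 i) * w 0 i = r * B'.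
  by rewrite mulr_sumr; apply: eq_bigr => i _; rewrite mulrA.
have -> : \sum_(i < m) b 0 i * P (lift ord0 i) ord0 * t = t * B.
  by rewrite mulr_sumr; apply: eq_bigr => i _; rewrite (sym _ ord0); ring.
by rewrite /pivot_dot -/B -/B'; field; rewrite gt_eqF.
Qed.

(** The Schur complement takes the value of the whole form at the minimizing
    coordinate 0. *)
Lemma posdef_schur m (P : 'M[R]_m.+1) : posdef P -> posdef (schur P).
Proof.
move=> posP; split=> [i j|w w0].
  by rewrite !mxE posP.1; congr (_ - _ / _); rewrite mulrC.
have := posP.2 (rV_cons (- pivot_dot P w) w).
rewrite bform_cons// addNr mulr0 add0r; apply.
apply: contraNN w0 => /eqP/rowP E; apply/eqP/rowP => i.
by have := E (lift ord0 i); rewrite rV_consS !mxE.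
Qed.

End gaussian_vectors.

Section gaussian_existence.
Context {R : realType}.
Local Notation mu := (@lebesgue_measure R).
Local Notation N01 := (normal_prob (0 : R) 1).

Lemma bounded_integrable d (T : measurableType d) (P : probability T R)
    (f : T -> R) M : measurable_fun [set: T] f -> (forall t, `|f t| <= M) ->
  P.-integrable [set: T] (EFin \o f).
Proof.
move=> mf fM; apply: (@le_integrable _ _ _ _ _ _ _ (cst M%:E)) => //.
- exact/measurable_EFinP.
- by move=> t _; rewrite /= lee_fin (le_trans (fM t))// ler_norm.
- exact: finite_measure_integrable_cst.
Qed.

(** The substitution [t = z / sqrt a - beta]. *)
Lemma gaussian_shift (a beta M : R) (f : R -> R) : 0 < a ->
  measurable_fun [set: R] f -> (forall t, `|f t| <= M) ->
  \int[mu]_t (f t * expR (- (a * (t + beta) ^+ 2 / 2))) =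
  (normal_peak (Num.sqrt a)^-1)^-1 * \int[N01]_z f (z / Num.sqrt a - beta).
Proof.
move=> a0 mf fM; set s := (Num.sqrt a)^-1.
have s_gt0 : 0 < s by rewrite invr_gt0 sqrtr_gt0.
have s0 : s != 0 by rewrite gt_eqF.
have s2 : s ^+ 2 = a^-1 by rewrite /s exprVn sqr_sqrtr// ltW.
clearbody s.
have mphi : measurable_fun [set: R] (fun z => - beta + s * z).
  by apply: measurable_funD => //; exact: measurable_funM.
have k0 : 0 < normal_peak s := normal_peak_gt0 s0.
have intf : (normal_prob (- beta) s).-integrable setT (EFin \o f).
  exact: (@bounded_integrable _ _ (normal_prob (- beta) s) f M mf fM).
have intN : N01.-integrable setT (EFin \o (fun z => f (- beta + s * z))).
  apply: (@bounded_integrable _ _ N01 (fun z => f (- beta + s * z)) M) => //.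
  exact: (measurableT_comp mf mphi).
have E1 : (\int[normal_prob (- beta) s]_t (f t)%:E = \int[N01]_z (f (- beta + s * z))%:E)%E.
  have mphi' : @measurable_fun _ _ (measurableTypeR R) (measurableTypeR R) setT
    (fun z => - beta + s * z) := mphi.
  pose push : {measure set measurableTypeR R -> \bar R} :=
    measure_function_pushforward__canonical__measure_function_Measure N01 mphi'.
  transitivity (\int[push]_t (f t)%:E)%E.
    apply: eq_measure_integral => A mA _; exact: normal_prob_affine.
  rewrite /push integral_pushforward//; exact/measurable_EFinP.
have E2 : \int[N01]_z f (z * s - beta) =
    fine (\int[mu]_t ((f t)%:E * (normal_pdf (- beta) s t)%:E)).
  rewrite -(integral_normal_prob intf) E1 /Rintegral; congr fine.
  by apply: eq_integral => z _; rewrite addrC [s * z]mulrC.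
have E3 t : expR (- (a * (t + beta) ^+ 2 / 2)) =
    (normal_peak s)^-1 * normal_pdf (- beta) s t.
  rewrite (normal_pdfE _ s0) mulKf; last by rewrite gt_eqF.
  rewrite /normal_fun opprK s2; congr expR; field.
  by rewrite gt_eqF.
rewrite E2 /Rintegral.
rewrite (_ : (fun t => (f t * expR (- (a * (t + beta) ^+ 2 / 2)))%:E) =
   (fun t => (normal_peak s)^-1%:E * ((f t)%:E * (normal_pdf (- beta) s t)%:E))%E); last first.
  by apply: funext => t; rewrite -!EFinM E3 mulrCA.
have intfp : mu.-integrable setT (fun t => (f t)%:E * (normal_pdf (- beta) s t)%:E)%E.
  have intp := integrableZl measurableT M (integrable_normal_pdf (- beta) s).
  apply: (le_integrable _ _ _ intp); first by [].
    apply: emeasurable_funM; first exact/measurable_EFinP.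
    by apply/measurable_EFinP; exact: measurable_normal_pdf.
  move=> t _; rewrite /= lee_fin normrM [leRHS]normrM.
  apply: ler_wpM2r; first exact: normr_ge0.
  exact: le_trans (fM t) (ler_norm M).
rewrite (integralZl measurableT intfp) fineM; first by [].
  exact: isT.
exact: (integrable_fin_num measurableT intfp).
Qed.

Lemma le_norm_Rintegral d (T : measurableType d) (Q : probability T R)
    (f : T -> R) M : measurable_fun [set: T] f -> (forall t, `|f t| <= M) ->
  `|\int[Q]_t f t| <= M.
Proof.
move=> mf fM; have intf := bounded_integrable Q mf fM.
apply: le_trans (le_normr_Rintegral measurableT intf) _.
have mnf : measurable_fun [set: T] (fun t => `|f t|) by exact: measurableT_comp.
have intnf : Q.-integrable [set: T] (EFin \o (fun t => `|f t|)).
  by apply: (bounded_integrable Q (M := M) mnf) => t; rewrite normr_id.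
have intM : Q.-integrable [set: T] (EFin \o cst M) by exact: finite_measure_integrable_cst.
apply: le_trans (le_Rintegral measurableT intnf intM _) _.
  by move=> t _; exact: fM.
by rewrite Rintegral_cst// [X in fine X](@probability_setT _ _ _ Q) mulr1.
Qed.

(** Adding the bound [M] makes the integrand nonnegative, so that Tonelli applies. *)
Lemma measurable_Rintegral d1 d2 (T1 : measurableType d1) (T2 : measurableType d2)
    (Q : probability T2 R) (g : T1 * T2 -> R) M :
  measurable_fun [set: T1 * T2] g -> (forall u, `|g u| <= M) ->
  measurable_fun [set: T1] (fun x => \int[Q]_y g (x, y)).
Proof.
move=> mg gM.
have mg1 x : measurable_fun [set: T2] (fun y => g (x, y)).
  exact: (measurableT_comp mg (pair1_measurable x)).
have intM : Q.-integrable [set: T2] (EFin \o cst M) by exact: finite_measure_integrable_cst.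
have E x : \int[Q]_y g (x, y) = \int[Q]_y (g (x, y) + M) - M.
  have intg : Q.-integrable [set: T2] (EFin \o (fun y => g (x, y))).
    exact: (bounded_integrable Q (mg1 x) (fun y => gM (x, y))).
  rewrite (RintegralD measurableT intg intM) Rintegral_cst//.
  by rewrite [X in M * fine X](@probability_setT _ _ _ Q) mulr1 addrK.
under eq_fun do rewrite E.
apply: measurable_funB => //.
apply: (measurableT_comp (fine_measurable measurableT)).
apply: (@measurable_fun_fubini_tonelli_F _ _ _ _ R Q (fun u => (g u + M)%:E)).
  by apply/measurable_EFinP; exact: measurable_funD.
move=> u; rewrite lee_fin -lerBlDr sub0r.
by have := gM u; rewrite ler_norml => /andP[].
Qed.

(** Let [G] be built for the Schur complement and let [z] be an independent
    standard normal variable: given [G], coordinate 0 must be normal of variance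
    [1 / a] and mean [- pivot_dot P G]. By [bform_cons] a linear form of the new
    vector is a multiple of [z] plus a linear form of [G], with variances adding
    up to [bform P b b]; the same identity computes the Gaussian integral. *)
Lemma exists_gaussian m (P : 'M[R]_m) : posdef P ->
  exists (d : measure_display) (T : measurableType d) (Q : probability T R)
    (G : T -> 'rV[R]_m), [/\ random_vector G,
    forall (b : 'rV[R]_m) (A : set R), measurable A ->
      Q [set t | A (bform P b (G t))] = centered_normal (bform P b b) A &
    exists2 c, 0 < c & forall F M, Borel_measurable F -> (forall w, `|F w| <= M) ->
      iterint (fun w => F w * expR (- (bform P w w / 2))) =
      c * \int[Q]_t F (G t)].
Proof.
elim: m P => [|m IH] P posP.
  have E w w' : bform P w w' = 0 by rewrite /bform big_ord0.
  exists _, (measurableTypeR R), (normal_prob (0 : R) 1 : probability _ R), (fun=> 0); split.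
  - by move=> [].
  - move=> b A mA; rewrite !E /centered_normal eqxx diracE.
    have [A0|A0] := pselect (A 0).
      rewrite mem_set// (_ : mkset _ = setT) ?probability_setT//.
      by apply/seteqP; split.
    rewrite memNset// (_ : mkset _ = set0) ?measure0//.
    by apply/seteqP; split.
  - exists 1 => // F M mF bF /=.
    rewrite E mul0r oppr0 expR0 mulr1 mul1r.
    by rewrite Rintegral_cst// [X in fine X](@probability_setT _ _ _ N01) mulr1.
have [d [T [Q [G [mG lawG [c c0 intG]]]]]] := IH _ (posdef_schur posP).
set a := P ord0 ord0; have a0 : 0 < a := posdef_pivot posP.
have sa0 : 0 < Num.sqrt a by rewrite sqrtr_gt0.
(* The new coordinate 0, given a standard normal [z] and the other coordinates. *)
pose lastc (z : R) (v : 'rV[R]_m) := rV_cons (z / Num.sqrt a - pivot_dot P v) v.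
have mlastc d' (T' : measurableType d') (Z : T' -> R) (X : T' -> 'rV[R]_m) :
    measurable_fun [set: T'] Z -> random_vector X ->
    random_vector (fun t => lastc (Z t) (X t)).
  move=> mZ mX i; case: (unliftP ord0 i) => [j ->|->].
    by under eq_fun do rewrite rV_consS; exact: mX.
  under eq_fun do rewrite rV_cons0.
  apply: measurable_funB; first exact: measurable_funM.
  apply: measurable_funM => //; apply: measurable_sum => j.
  by apply: measurable_funM => //; exact: mX.
exists _, _, (N01 \x Q)%E, (fun u => lastc u.1 (G u.2)); split.
- apply: mlastc; first exact: measurable_fst.
  by move=> i; apply: (measurableT_comp (mG i)); exact: measurable_snd.
- move=> b A mA; pose r := b 0 ord0; pose b' := \row_i b 0 (lift ord0 i).
  have bE : b = rV_cons r b' by exact: rV_consP.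
  have mY : measurable_fun [set: T] (fun t => bform (schur P) b' (G t)).
    apply: measurable_sum => i; apply: measurable_sum => j.
    by apply: measurable_funM => //; exact: mG.
  have v0 : 0 <= bform (schur P) b' b'.
    have [->|b'0] := eqVneq b' 0.
      rewrite /bform big1// => i _; rewrite big1// => j _.
      by rewrite !mxE !mul0r.
    exact/ltW/(posdef_schur posP).2.
  have := centered_normal_add (Num.sqrt a * (r + pivot_dot P b')) mY v0
    (fun B mB => lawG b' B mB) mA.
  have -> : (Num.sqrt a * (r + pivot_dot P b')) ^+ 2 + bform (schur P) b' b' = bform P b b.
    by rewrite bE bform_cons// -/a exprMn sqr_sqrtr ?ltW//; ring.
  have aV : a / Num.sqrt a = Num.sqrt a.
    by rewrite -{1}(sqr_sqrtr (ltW a0)) expr2 mulfK// lt0r_neq0.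
  have lin u : Num.sqrt a * (r + pivot_dot P b') * u.1 + bform (schur P) b' (G u.2) =
      bform P b (lastc u.1 (G u.2)).
    by rewrite bE bform_cons// subrK -/a -[in LHS]aV; ring.
  by move=> <-; congr ((N01 \x Q)%E _); apply/seteqP; split => u /=; rewrite lin.
- have kpos : 0 < normal_peak (Num.sqrt a)^-1.
    by apply: normal_peak_gt0; rewrite invr_eq0 gt_eqF.
  exists (c / normal_peak (Num.sqrt a)^-1); first exact: divr_gt0.
  move=> F M mF FM /=.
  pose F' v := \int[N01]_z F (lastc z v).
  have mFl v : measurable_fun [set: R] (fun z => F (lastc z v)).
    by apply: (mF _ (measurableTypeR R)); apply: mlastc.
  have F'M v : `|F' v| <= M by exact: (le_norm_Rintegral N01 (mFl v) (fun z => FM _)).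
  have mF' : Borel_measurable F'.
    move=> d' T' X mX.
    apply: (@measurable_Rintegral _ _ T' (measurableTypeR R) N01
      (fun u => F (lastc u.2 (X u.1))) M) => [|u]; last exact: FM.
    apply: mF; apply: mlastc; first exact: measurable_snd.
    by move=> i; apply: (measurableT_comp (mX i)); exact: measurable_fst.
  have mF'' : Borel_measurable (fun v => (normal_peak (Num.sqrt a)^-1)^-1 * F' v).
    by move=> d' T' X mX; apply: measurable_funM => //; exact: (mF' _ _ _ mX).
  have F''M v : `|(normal_peak (Num.sqrt a)^-1)^-1 * F' v| <=
      (normal_peak (Num.sqrt a)^-1)^-1 * M.
    have kinv : 0 < (normal_peak (Num.sqrt a)^-1)^-1 by rewrite invr_gt0.
    by rewrite normrM (gtr0_norm kinv) (ler_wpM2l (ltW kinv)) ?F'M.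
  have mFG : measurable_fun [set: R * T] (fun u => F (lastc u.1 (G u.2))).
    apply: mF; apply: mlastc; first exact: measurable_fst.
    by move=> i; apply: (measurableT_comp (mG i)); exact: measurable_snd.
  have mF'G : measurable_fun [set: T] (fun t => F' (G t)) := mF' _ _ _ mG.
  have intF'G := bounded_integrable Q mF'G (fun t => F'M (G t)).
  transitivity (iterint (fun v => (normal_peak (Num.sqrt a)^-1)^-1 * F' v *
      expR (- (bform (schur P) v v / 2)))).
    congr iterint; apply: funext => v.
    have mFv : measurable_fun [set: R] (fun t => F (rV_cons t v)).
      apply: (mF _ (measurableTypeR R)) => i.
      case: (unliftP ord0 i) => [j ->|->].
        by under eq_fun do rewrite rV_consS; exact: measurable_cst.
      by under eq_fun do rewrite rV_cons0; exact: measurable_id.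
    pose K := expR (- (bform (schur P) v v / 2)).
    transitivity (\int[mu]_t (F (rV_cons t v) * K *
        expR (- (a * (t + pivot_dot P v) ^+ 2 / 2)))).
      congr Rintegral; apply: funext => t.
      rewrite bform_cons// -/a /K -[RHS]mulrA -expRD; congr (_ * expR _).
      by ring.
    rewrite (@gaussian_shift _ _ (M * K) (fun t => F (rV_cons t v) * K))//; last 2 first.
    - exact: measurable_funM.
    - by move=> t; rewrite normrM [`|K|]ger0_norm ?expR_ge0// ler_wpM2r ?expR_ge0.
    rewrite -mulrA; congr (_ * _).
    by rewrite (RintegralZr K measurableT (bounded_integrable N01 (mFl v) (fun z => FM _))).
  rewrite (intG _ _ mF'' F''M) (RintegralZl _ measurableT intF'G) mulrA; congr (_ * _).
  have intFG := bounded_integrable (N01 \x Q)%E mFG (fun u => FM _).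
  rewrite /Rintegral; congr fine.
  rewrite -(integral21_prod_meas1 intFG); apply: eq_integral => t _.
  rewrite /F' /Rintegral fineK//.
  exact: (integrable_fin_num measurableT (bounded_integrable N01 (mFl (G t)) (fun z => FM _))).
Qed.

End gaussian_existence.

(** * The law of the occupation numbers *)

Section occupation_numbers.

Definition occupation (T : finType) n (s : {ffun 'I_n -> T}) (x : T) : nat :=
  \sum_(i < n) (s i == x).

Lemma sum_occupation (T : finType) n (s : {ffun 'I_n -> T}) :
  \sum_x occupation s x = n.
Proof.
rewrite /occupation exchange_big/= -[RHS]muln1 -[X in (X * _)%N]card_ord -sum_nat_const.
apply: eq_bigr => i _; rewrite (bigD1 (s i))//= eqxx big1// => x.
by rewrite eq_sym => /negbTE->.
Qed.

Lemma sum_ffunS (V : nmodType) (T : finType) n (F : {ffun 'I_n.+1 -> T} -> V) :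
  \sum_s F s = \sum_x \sum_(s : {ffun 'I_n -> T})
    F [ffun i => oapp s x (unlift ord0 i)].
Proof.
rewrite pair_big/=.
pose f (u : T * {ffun 'I_n -> T}) : {ffun 'I_n.+1 -> T} :=
  [ffun i => oapp u.2 u.1 (unlift ord0 i)].
rewrite (reindex f)//=; exists (fun s => (s ord0, [ffun i => s (lift ord0 i)])).
  move=> [x s] _; congr pair; first by rewrite ffunE unlift_none.
  by apply/ffunP => i; rewrite !ffunE liftK.
move=> s _; apply/ffunP => i; rewrite ffunE.
by case: (unliftP ord0 i) => [j ->|->] /=; rewrite ?ffunE.
Qed.

Lemma occupation_cons (T : finType) n (s : {ffun 'I_n -> T}) x y :
  occupation [ffun i => oapp s x (unlift ord0 i)] y = ((x == y) + occupation s y)%N.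
Proof.
rewrite /occupation big_ord_recl ffunE unlift_none/=; congr (_ + _)%N.
by apply: eq_bigr => i _; rewrite ffunE liftK.
Qed.

(** The multinomial count, free of divisions. By induction on the length: the words
    starting with [x] number [K x] times the multinomial of [K] less one [x]. *)
Lemma card_occupation (T : finType) n (K : T -> nat) : (\sum_x K x = n)%N ->
  ((\sum_(s : {ffun 'I_n -> T}) [forall x, occupation s x == K x])
   * \prod_x (K x)`! = n`!)%N.
Proof.
elim: n K => [|n IH] K sK.
  have K0 x : K x = 0%N.
    by apply/eqP; rewrite -leqn0 -sK (bigD1 x)//= leq_addr.
  rewrite [X in (_ * X)%N]big1 ?muln1; last by move=> x _; rewrite K0.
  rewrite (eq_bigr (fun=> 1%N)); last first.
    move=> s _; apply/eqP; rewrite eqb1; apply/forallP => x.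
    by rewrite K0 /occupation big_ord0.
  by rewrite sum_nat_const card_ffun card_ord expn0.
rewrite (sum_ffunS (V := nat)) big_distrl/=.
transitivity (\sum_x K x * n`!)%N; last by rewrite -big_distrl/= sK factS.
apply: eq_bigr => x _.
have [Kx0|Kx0] := posnP (K x).
  rewrite Kx0 mul0n big1 ?mul0n// => s _; apply/eqP; rewrite eqb0.
  apply/forallPn; exists x; rewrite occupation_cons eqxx Kx0//.
pose K' y := (K y - (x == y))%N.
have K'E y : K y = ((x == y) + K' y)%N.
  by rewrite /K' subnKC//; case: eqP => // <-.
have sK' : (\sum_y K' y = n)%N.
  apply: succn_inj; rewrite -sK (eq_bigr _ (fun y _ => K'E y)) big_split/=.
  rewrite (_ : (\sum_y (x == y) = 1)%N)// (bigD1 x)//= eqxx big1// => y.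
  by rewrite eq_sym => /negbTE->.
have -> : (\prod_y (K y)`! = K x * \prod_y (K' y)`!)%N.
  rewrite (bigD1 x)//= [in RHS](bigD1 x)//= mulnA; congr (_ * _)%N.
    by rewrite [K x in LHS]K'E eqxx add1n factS -add1n -[(1 + K' x)%N]/(true + K' x)%N -[true](eqxx x) -K'E.
  by apply: eq_bigr => y; rewrite eq_sym => /negbTE yx; rewrite K'E yx.
rewrite mulnCA; congr (_ * _)%N; rewrite -(IH K' sK'); congr (_ * _)%N.
apply: eq_bigr => s _; congr nat_of_bool.
apply: eq_forallb => y; rewrite occupation_cons K'E eqn_add2l//.
Qed.

End occupation_numbers.

Section boxsum_theory.
Context {R : realType}.

Lemma boxsum_sum N m (I : Type) (r : seq I) (a : I -> 'rV[nat]_m -> R) :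
  \sum_(i <- r) boxsum N (a i) = boxsum N (fun k => \sum_(i <- r) a i k).
Proof.
elim: m a => [//|m IH] a /=; rewrite IH; apply: eq_boxsum => v.
by rewrite exchange_big.
Qed.

Lemma boxsum_delta N m (k0 : 'rV[nat]_m) (f : 'rV[nat]_m -> R) :
  (forall i, (k0 0%R i <= N)%N) ->
  boxsum N (fun k => (k0 == k)%:R * f k) = f k0.
Proof.
elim: m k0 f => [|m IH] k0 f le_k0 /=.
  have -> : k0 = 0 by apply/rowP => -[].
  by rewrite eqxx mul1r.
set a := k0 0 ord0; set k' := \row_i k0 0 (lift ord0 i).
have k0E : k0 = rV_cons a k' by exact: rV_consP.
have consI t v : (k0 == rV_cons t v) = (a == t) && (k' == v).
  rewrite k0E; apply/eqP/andP => [E|[/eqP-> /eqP->]//].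
  split; first by rewrite -(rV_cons0 a k') E rV_cons0.
  by apply/eqP/rowP => i; rewrite -(rV_consS a k' i) E rV_consS.
transitivity (boxsum N (fun v => (k' == v)%:R * f (rV_cons a v))).
  apply: eq_boxsum => v.
  have aN : (a < N.+1)%N by rewrite ltnS le_k0.
  rewrite (bigD1 (Ordinal aN))//= consI eqxx/= big1 ?addr0// => j ja.
  rewrite consI (_ : (a == j) = false) ?mul0r//.
  by apply/negbTE; rewrite eq_sym; apply: contra ja => /eqP E; apply/eqP/val_inj.
rewrite IH; first by rewrite [in RHS]k0E.
by move=> i; rewrite mxE.
Qed.

Definition full_occupation m n (k : 'rV[nat]_m) : 'rV[nat]_m.+1 :=
  rV_cons (n - \sum_i k 0%R i)%N k.

(** The value 0 outside the simplex lets [boxsum] range over the whole box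
    [{0, ..., n} ^ m] of the numbers of spins other than the first. *)
Definition multinomial m n (k : 'rV[nat]_m) : R :=
  if (\sum_i k 0%R i <= n)%N then
    n`!%:R / \prod_i (full_occupation n k 0 i)`!%:R
  else 0.

Lemma sum_config m n (f : 'rV[nat]_m.+1 -> R) :
  \sum_(s : {ffun 'I_n -> 'I_m.+1}) f (\row_i occupation s i) =
  boxsum n (fun k => multinomial n k * f (full_occupation n k)).
Proof.
pose tl (s : {ffun 'I_n -> 'I_m.+1}) : 'rV[nat]_m := \row_i occupation s (lift ord0 i).
have occE s : \row_i occupation s i = full_occupation n (tl s).
  have := sum_occupation s; rewrite big_ord_recl => sE.
  apply/rowP => i; case: (unliftP ord0 i) => [j ->|->].
    by rewrite rV_consS !mxE.
  rewrite rV_cons0 mxE -[in RHS]sE.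
  by under eq_bigr do rewrite mxE; rewrite addnK.
have le_n (s : {ffun 'I_n -> 'I_m.+1}) x : (occupation s x <= n)%N.
  by apply: leq_trans _ (eq_leq (sum_occupation s)); rewrite (bigD1 x)//= leq_addr.
transitivity (\sum_(s : {ffun 'I_n -> 'I_m.+1})
    boxsum n (fun k => (tl s == k)%:R * f (full_occupation n k))).
  apply: eq_bigr => s _; rewrite boxsum_delta ?occE// => i.
  by rewrite mxE le_n.
rewrite boxsum_sum; apply: eq_boxsum => k; rewrite -mulr_suml; congr (_ * _).
rewrite /multinomial; case: ifPn => [kn|kn]; last first.
  rewrite big1// => s _; case: eqP => // sk; case/negP: kn.
  apply: leq_trans _ (eq_leq (sum_occupation s)); rewrite big_ord_recl -sk.
  by under eq_bigr do rewrite mxE; exact: leq_addl.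
set K := full_occupation n k.
have sK : (\sum_i K 0%R i = n)%N.
  rewrite big_ord_recl /K /full_occupation rV_cons0.
  rewrite [X in (_ + X)%N](eq_bigr (fun i => k 0%R i)) ?subnK// => i _.
  by rewrite rV_consS.
have := card_occupation sK => /(congr1 (fun x => x%:R : R)).
rewrite natrM natr_prod => <-.
rewrite mulfK; last by rewrite prodf_seq_neq0; apply/allP => i _; rewrite pnatr_eq0 -lt0n fact_gt0.
rewrite natr_sum; apply: eq_bigr => s _; congr (_%:R); congr nat_of_bool.
apply/eqP/forallP => [sk i|H].
  by rewrite /K -sk -occE mxE.
by apply/rowP => i; rewrite mxE (eqP (H _)) /K rV_consS.
Qed.

End boxsum_theory.

Section potts_sums.
Context {R : realType}.

Lemma sum_pairs_lt n (e : 'I_n -> 'I_n -> R) : (forall i j, e i j = e j i) ->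
  \sum_i \sum_j e i j =
  2 * (\sum_(i < n) \sum_(j < n | (i < j)%N) e i j) + \sum_i e i i.
Proof.
move=> sym.
have split3 i : \sum_j e i j =
    \sum_(j < n | (i < j)%N) e i j + \sum_(j < n | (j < i)%N) e i j + e i i.
  rewrite (bigID (fun j : 'I_n => (i < j)%N))/= -addrA; congr (_ + _).
  rewrite (bigD1 i) ?ltnn//= addrC; congr (_ + _).
  by apply: eq_bigl => j; rewrite -leqNgt ltn_neqAle andbC.
rewrite (eq_bigr _ (fun i _ => split3 i)) !big_split/=; congr (_ + _).
rewrite mulr2n mulrDl mul1r; congr (_ + _).
rewrite (exchange_big_dep xpredT)//=; apply: eq_bigr => i _.
by apply: eq_bigr => j _; exact: sym.
Qed.

(** Ordered pairs of equal spins, diagonal included, are counted by the squares of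
    the occupation numbers. *)
Lemma potts_exponentE p (beta h : R) n (s : config p n) :
  potts_exponent beta h s =
  beta / (2 * n%:R) * (\sum_k (occupation s k)%:R ^+ 2 - n%:R)
  + h * (occupation s ord0)%:R.
Proof.
rewrite /potts_exponent /occupation natr_sum; congr (_ + _).
have -> : \sum_k (\sum_(i < n) (s i == k))%:R ^+ 2 =
    \sum_(i < n) \sum_(j < n) (s i == s j)%:R :> R.
  under eq_bigr do rewrite natr_sum expr2 big_distrlr/=.
  rewrite exchange_big/=; apply: eq_bigr => i _.
  rewrite exchange_big/=; apply: eq_bigr => j _.
  rewrite (bigD1 (s i))//= eqxx mul1r big1 ?addr0 1?eq_sym//.
  by move=> k /negbTE ki; rewrite eq_sym ki mul0r.
rewrite sum_pairs_lt; last by move=> i j; rewrite eq_sym.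
have -> : \sum_(i < n) (s i == s i)%:R = n%:R :> R.
  by under eq_bigr do rewrite eqxx; rewrite sumr_const card_ord.
by rewrite addrK invfM; move: (n%:R^-1 : R) => c; field.
Qed.

Lemma expectation_potts p (beta h : R) n (X : config p n -> R) :
  ('E_(potts beta h n)[X] = (\sum_s X s * potts_pmf beta h s)%R%:E)%E.
Proof.
rewrite unlock.
have mall (A : set (config p n)) : measurable A by [].
have mfun (A : set (config p n)) : measurable_fun A (EFin \o X) by [].
pose r := index_enum (config p n).
have -> : [set: config p n] = \big[setU/set0]_(s <- r) [set s].
  apply/seteqP; split => // s _.
  by rewrite -bigcup_seq; exists s => //=; exact: mem_index_enum.
have triv : trivIset [set` r] (fun s : config p n => [set s]).
  by move=> s t _ _ [u [/= -> ->]].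
rewrite (integral_bigsetU_EFin _ (fun i => mall _) (index_enum_uniq _) triv (mfun _)).
rewrite -sumEFin; apply: eq_bigr => s _.
rewrite (eq_integral (fun=> (X s)%:E)); last by move=> t; rewrite inE => ->.
rewrite integral_cst//= EFinM; congr (_ * _)%E.
by rewrite /potts esum_set1// lee_fin potts_pmf_ge0.
Qed.

End potts_sums.

(** * The local limit of the weights *)

Section coordinate_limits.
Context {R : realType}.
Local Notation s n := (Num.sqrt (n%:R : R)).

Variables (K : nat -> nat) (y : nat -> R) (x w : R).
Hypothesis x_gt0 : 0 < x.
Hypothesis y_cvg : y n @[n --> \oo] --> x.
Hypothesis w_cvg : ((K n)%:R - n%:R * y n) / s n @[n --> \oo] --> w.

Let wn n := ((K n)%:R - n%:R * y n) / s n.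

Let near_n0 : \forall n \near \oo, (0 < n)%N.
Proof. exact: nbhs_infty_gt. Qed.

Let KE n : (0 < n)%N -> (K n)%:R / n%:R - y n = wn n * (s n)^-1.
Proof.
move=> n0; have n0R : n%:R != 0 :> R by rewrite pnatr_eq0 -lt0n.
have s2 : s n * s n = n%:R by rewrite -expr2 sqr_sqrtr.
by rewrite /wn -mulrA -invfM s2; field.
Qed.

Lemma frequency_cvg : (K n)%:R / n%:R @[n --> \oo] --> x.
Proof.
have lim : wn n * (s n)^-1 + y n @[n --> \oo] --> w * 0 + x.
  by apply: cvgD => //; apply: cvgM => //; exact: invsqrtn_cvg0.
rewrite mulr0 add0r in lim; apply: cvg_trans lim.
apply: near_eq_cvg; move: near_n0; apply: filterS => n n0.
by rewrite -KE// subrK.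
Qed.

Lemma occupation_cvgy : K n @[n --> \oo] --> \oo.
Proof.
apply/cvgnyPge => A.
have x2 : x / 2 < x by rewrite ltr_pdivrMr// ltr_pMr// ltr1n.
have h1 := cvgr_gt _ frequency_cvg _ x2.
near=> n.
have n0 : (0 < n)%N by near: n; exact: near_n0.
have hK : x / 2 < (K n)%:R / n%:R by near: n; exact: h1.
have hA : A%:R / (x / 2) <= n%:R by near: n; exact: nbhs_infty_ger.
rewrite -(ler_nat R); move: hK; rewrite ltr_pdivlMr ?ltr0n// => /ltW; apply: le_trans.
by rewrite mulrC -ler_pdivrMr// divr_gt0.
Unshelve. all: by end_near. Qed.

(** With [u] the relative deviation, of order [1 / sqrt n], the term is squeezed by
    [psi_ge] and [psi_le] around [n * y n * u ^ 2 / 2]. *)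
Lemma entropy_term_cvg :
  n%:R * (y n * psi (((K n)%:R / n%:R - y n) / y n)) @[n --> \oo] --> w ^+ 2 / (2 * x).
Proof.
pose u n := wn n * (s n)^-1 / y n.
have u_cvg : u n @[n --> \oo] --> (0 : R).
  have lim : u n @[n --> \oo] --> w * 0 / x.
    apply: cvgM; first by apply: cvgM => //; exact: invsqrtn_cvg0.
    by apply: cvgV => //; rewrite gt_eqF.
  by rewrite mulr0 mul0r in lim.
have q_cvg : wn n ^+ 2 / y n @[n --> \oo] --> w ^+ 2 / x.
  by apply: cvgM; [exact: cvg_sqr|apply: cvgV => //; rewrite gt_eqF].
apply: (@squeeze_cvgr _ _ _ _
  (fun n => wn n ^+ 2 / y n * (2^-1 - u n / 6))
  (fun n => wn n ^+ 2 / y n * (2^-1 - u n / 6 + u n ^+ 2 / 3))); last 2 first.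
- rewrite (_ : w ^+ 2 / (2 * x) = w ^+ 2 / x * (2^-1 - 0 / 6)); last first.
    by field; rewrite gt_eqF.
  apply: cvgM => //; apply: cvgB; first exact: cvg_cst.
  by apply: cvgM => //; exact: cvg_cst.
- rewrite (_ : w ^+ 2 / (2 * x) = w ^+ 2 / x * (2^-1 - 0 / 6 + 0 ^+ 2 / 3)); last first.
    by field; rewrite gt_eqF.
  apply: cvgM => //; apply: cvgD.
    by apply: cvgB; [exact: cvg_cst|apply: cvgM => //; exact: cvg_cst].
  by apply: cvgM; [exact: cvg_sqr|exact: cvg_cst].
near=> n.
have n0 : (0 < n)%N by near: n; exact: near_n0.
have y0 : 0 < y n by near: n; exact: (cvgr_gt _ y_cvg _ x_gt0).
have u1 : -1 < u n.
  by near: n; apply: (cvgr_gt _ u_cvg); rewrite ltrN10.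
rewrite KE// -/(u n).
have s2 : s n * s n = n%:R by rewrite -expr2 sqr_sqrtr.
have s0 : s n != 0 by rewrite gt_eqF// sqrtn_gt0.
have E : wn n ^+ 2 / y n = n%:R * (y n * u n ^+ 2).
  rewrite /u; move: (wn n) (s n) s0 s2 => W S S0 <-; field.
  by rewrite S0 gt_eqF.
rewrite E; have := psi_le u1; have := psi_ge (ltW u1).
move: (psi (u n)) => P; move: (u n) => U h1 h2.
rewrite -!mulrA !(ler_pM2l (_ : 0 < n%:R)) ?ltr0n// !(ler_pM2l y0).
by apply/andP; split; lra.
Unshelve. all: by end_near. Qed.

Lemma stirling_term_cvg (a : R) : 0 < a ->
  stirling_factor k / s k @[k --> \oo] --> a ->
  s n / stirling_factor (K n) @[n --> \oo] --> (a * Num.sqrt x)^-1.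
Proof.
move=> a0 a_cvg.
have lim1 : stirling_factor (K n) / s (K n) @[n --> \oo] --> a.
  exact: (cvg_comp _ _ occupation_cvgy a_cvg).
have lim2 : Num.sqrt ((K n)%:R / n%:R) @[n --> \oo] --> Num.sqrt x.
  by apply: (cvg_comp _ _ frequency_cvg); exact: sqrt_continuous.
have sx0 : 0 < Num.sqrt x by rewrite sqrtr_gt0.
have lim3 : (stirling_factor (K n) / s (K n) * Num.sqrt ((K n)%:R / n%:R))^-1
    @[n --> \oo] --> (a * Num.sqrt x)^-1.
  by apply: cvgV; [rewrite mulf_neq0// gt_eqF|exact: cvgM].
apply: cvg_trans lim3; apply: near_eq_cvg; near=> n.
have n0 : (0 < n)%N by near: n; exact: near_n0.
have K0 : (0 < K n)%N by near: n; move/cvgnyPgt: occupation_cvgy; exact.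
have sn0 := @sqrtn_gt0 R _ n0; have sK0 := @sqrtn_gt0 R _ K0.
have := @stirling_factor_gt0 R (K n) => st0.
rewrite sqrtrM// sqrtrV ?ler0n//; field.
by rewrite !gt_eqF.
Unshelve. all: by end_near. Qed.

End coordinate_limits.

Section stirling_form.
Context {R : realType}.

Lemma fact_stirling (k : nat) :
  k`!%:R = stirling_factor k * expR (k%:R * ln k%:R - k%:R) :> R.
Proof.
rewrite /stirling_factor; have [->|k0] := posnP k.
  by rewrite fact0 expr0 mul0r subr0 expR0 !mulr1 invr1 mulr1.
have kR : 0 < k%:R :> R by rewrite ltr0n.
rewrite expRB expR_natM_ln// mulrACA -mulrA [X in _ * X]mulrC.
by field; rewrite gt_eqF ?expR_gt0// expf_neq0// gt_eqF.
Qed.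

Definition potts_weight (m : nat) (beta h : R) n (K : 'rV[nat]_m.+1) : R :=
  expR (beta / (2 * n%:R) * (\sum_i (K 0 i)%:R ^+ 2 - n%:R) + h * (K 0 ord0)%:R).

Definition frequencies m n (K : 'rV[nat]_m) : 'rV[R]_m :=
  \row_i ((K 0 i)%:R / n%:R).

Lemma sum_full_occupation m n (k : 'rV[nat]_m) : (\sum_i k 0%R i <= n)%N ->
  (\sum_i full_occupation n k 0%R i = n)%N.
Proof.
move=> kn; rewrite big_ord_recl /full_occupation rV_cons0.
rewrite [X in (_ + X)%N](eq_bigr (fun i => k 0%R i)) ?subnK// => i _.
by rewrite rV_consS.
Qed.

Lemma frequencies_Omega p n (k : 'rV[nat]_p.+1) : (0 < n)%N ->
  (\sum_i k 0%R i <= n)%N -> Omega (frequencies n (full_occupation n k)).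
Proof.
move=> n0 kn; split => [|i]; last by rewrite mxE divr_ge0.
under eq_bigr do rewrite mxE.
by rewrite -mulr_suml -natr_sum sum_full_occupation// divff// pnatr_eq0 -lt0n.
Qed.

(** The powers [(K i / e) ^ K i] of the factorials carry the entropy, and the
    exponent of the model the rest of the free energy; only the factors
    [stirling_factor] and [beta / 2], the diagonal pairs, remain. *)
Lemma multinomial_weightE p (beta h : R) n (k : 'rV[nat]_p.+1) : (0 < n)%N ->
  (\sum_i k 0%R i <= n)%N ->
  multinomial n k * potts_weight beta h n (full_occupation n k) =
  stirling_factor n / \prod_i stirling_factor (full_occupation n k 0 i) *
  expR (- (n%:R * free_energy beta h (frequencies n (full_occupation n k)) + beta / 2)).
Proof.
move=> n0 kn; rewrite /multinomial kn; set K := full_occupation n k.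
have nR : 0 < n%:R :> R by rewrite ltr0n.
have sK : \sum_i (K 0 i)%:R = n%:R :> R by rewrite -natr_sum sum_full_occupation.
rewrite fact_stirling.
under eq_bigr do rewrite fact_stirling.
rewrite big_split/= -expR_sum invfM.
rewrite mulrACA -[LHS]mulrA; congr (_ * _).
rewrite /potts_weight -expRN -!expRD; congr expR.
rewrite free_energyE.
have E i : frequencies n K 0 i * ln (frequencies n K 0 i) -
    beta / 2 * frequencies n K 0 i ^+ 2 - h * (frequencies n K 0 i * (i == ord0)%:R)
  = n%:R^-1 * ((K 0 i)%:R * ln (K 0 i)%:R - (K 0 i)%:R) + (n%:R^-1 * (K 0 i)%:R) * (1 - ln n%:R)
    - beta / 2 * n%:R^-1 ^+ 2 * (K 0 i)%:R ^+ 2 - h / n%:R * ((K 0 i)%:R * (i == ord0)%:R).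
  rewrite mxE; have [->|Ki] := posnP (K 0 i).
    by rewrite !mul0r !mulr0; ring.
  rewrite ln_div ?posrE ?ltr0n//; field.
  by rewrite gt_eqF.
rewrite (eq_bigr _ (fun i _ => E i)) !big_split/= !sumrN -!mulr_sumr -mulr_suml -mulr_sumr sK.
have -> : \sum_i (K 0 i)%:R * (i == ord0)%:R = (K 0 ord0)%:R :> R.
  by rewrite (bigD1 ord0)//= mulr1 big1 ?addr0// => i /negbTE->; rewrite mulr0.
by rewrite sumrB sK; field; rewrite gt_eqF.
Qed.

End stirling_form.

Section local_limit.
Context {R : realType} {p : nat}.
Local Notation s n := (Num.sqrt (n%:R : R)).
Variables (betan hn : nat -> R) (beta : R) (x : 'rV[R]_p.+2) (yn : nat -> 'rV[R]_p.+2).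
Variable c : R.
Hypothesis x_gt0 : forall i, 0 < x 0 i.
Hypothesis x_sum : \sum_i x 0 i = 1.
Hypothesis yn_cvg : forall i, yn n 0 i @[n --> \oo] --> x 0 i.
Hypothesis betan_cvg : betan n @[n --> \oo] --> beta.
Hypothesis c_gt0 : 0 < c.
Hypothesis yn_near : \forall n \near \oo, quadratic_well c (betan n) (hn n) (yn n).

(** The weight of the occupation numbers, times factors independent of [k] that
    give it a limit and cancel in expectations. *)
Definition scaled_weight n (k : 'rV[nat]_p.+1) : R :=
  s n ^+ p.+1 *
  (multinomial n k * potts_weight (betan n) (hn n) n (full_occupation n k)) *
  expR (n%:R * free_energy (betan n) (hn n) (yn n) + betan n / 2).

Definition deviation n (k : 'rV[nat]_p.+1) : 'rV[R]_p.+2 :=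
  \row_i (((full_occupation n k 0 i)%:R - n%:R * yn n 0 i) / s n).

Let z n k : 'rV[R]_p.+2 := frequencies n (full_occupation n k).

Lemma scaled_weightE n (k : 'rV[nat]_p.+1) : (0 < n)%N -> (\sum_i k 0%R i <= n)%N ->
  scaled_weight n k =
  stirling_factor n / s n * \prod_i (s n / stirling_factor (full_occupation n k 0 i)) *
  expR (- (n%:R * (free_energy (betan n) (hn n) (z n k) -
                   free_energy (betan n) (hn n) (yn n)))).
Proof.
move=> n0 kn; rewrite /scaled_weight multinomial_weightE//.
have -> : \prod_i (s n / stirling_factor (full_occupation n k 0 i)) =
    s n ^+ p.+2 / \prod_i stirling_factor (full_occupation n k 0 i).
  by rewrite big_split/= -prodfV; congr (_ * _); rewrite prodr_const card_ord.
have sn : 0 < s n by exact: sqrtn_gt0.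
rewrite [X in X * _ = _]mulrA -[LHS]mulrA -expRD; congr (_ * expR _); last by rewrite /z; ring.
by rewrite [s n ^+ p.+2]exprS; field; rewrite !gt_eqF// prodr_gt0// => i _; exact: stirling_factor_gt0.
Qed.

Lemma scaled_weight_ge0 n k : 0 <= scaled_weight n k.
Proof.
rewrite /scaled_weight !mulr_ge0 ?expR_ge0 ?exprn_ge0 ?sqrtr_ge0//.
by rewrite /multinomial; case: ifP => // _; rewrite divr_ge0// prodr_ge0.
Qed.

Lemma sqdist_deviation n k : (0 < n)%N ->
  n%:R * sqdist (z n k) (yn n) = \sum_i deviation n k 0 i ^+ 2.
Proof.
move=> n0; rewrite /sqdist mulr_sumr; apply: eq_bigr => i _; rewrite !mxE.
have s2 : s n ^+ 2 = n%:R by rewrite sqr_sqrtr.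
rewrite expr_div_n s2; field; by rewrite pnatr_eq0 -lt0n.
Qed.

(** The factors [s n / stirling_factor (K i)] are bounded as long as [K i] is of
    order [n]. Otherwise the deviation is of order [sqrt n], and half of the
    Gaussian decay pays for a factor at most of order [n] per coordinate. *)
Lemma scaled_weight_dominated : exists2 C, 0 <= C & \forall n \near \oo,
  forall k, scaled_weight n k <=
    C * expR (- (c / 2 * \sum_i deviation n k 0 (lift ord0 i) ^+ 2)).
Proof.
have [a a0 [a_cvg a_le]] := @stirling_factor_cvg R.
have x3_gt0 i : 0 < x 0 i / 3 by rewrite divr_gt0.
have [mu mu0 mule] := exists_common_lb x3_gt0.
(* The minimum with 1 serves [k = 0], where the Stirling factor is 1. *)
pose a1 := Num.min a 1; have a1_gt0 : 0 < a1 by rewrite lt_min a0 ltr01.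
have st_ge k : (0 < k)%N -> a1 * s k <= stirling_factor k.
  move=> k0; apply: le_trans (a_le k k0).
  by rewrite ler_wpM2r ?sqrtr_ge0// ge_min lexx.
have st0 : a1 <= stirling_factor 0.
  have -> : stirling_factor 0 = 1 :> R.
    by rewrite /stirling_factor fact0 expr0 expR0 invr1 !mulr1.
  by rewrite ge_min lexx orbT.
pose eps := c / (2 * p.+2%:R) * mu ^+ 2.
have eps0 : 0 < eps by rewrite mulr_gt0 ?divr_gt0 ?mulr_gt0 ?exprn_gt0.
pose C2 := (a1 * Num.sqrt mu)^-1 + (a1 * eps)^-1.
have C20 : 0 < C2 by rewrite addr_gt0 ?invr_gt0 ?mulr_gt0 ?sqrtr_gt0.
exists ((a + 1) * C2 ^+ p.+2).
  by rewrite mulr_ge0 ?(exprn_ge0 _ (ltW C20)) ?addr_ge0 ?(ltW a0).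
have near_y : \forall n \near \oo, forall i, 2 * mu < yn n 0 i.
  apply: filter_forall => i.
  have mx : 2 * mu < x 0 i by have := mule i; have := x_gt0 i; lra.
  exact: (cvgr_gt _ (@yn_cvg i) _ mx).
near=> n => k.
have n0 : (0 < n)%N by near: n; exact: nbhs_infty_gt.
have ymu : forall i, 2 * mu < yn n 0 i by near: n.
have stn : stirling_factor n / s n < a + 1.
  by near: n; apply: (cvgr_lt _ a_cvg); rewrite ltrDl.
have [y1 y0 H] : quadratic_well c (betan n) (hn n) (yn n) by near: n.
have nR : 0 < n%:R :> R by rewrite ltr0n.
have sn : 0 < s n by exact: sqrtn_gt0.
have s2 : s n * s n = n%:R by rewrite -expr2 sqr_sqrtr// ltW.
have [kn|kn] := boolP (\sum_i k 0%R i <= n)%N; last first.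
  rewrite /scaled_weight /multinomial (negbTE kn) mul0r mulr0 mul0r.
  by rewrite mulr_ge0 ?expR_ge0// mulr_ge0 ?(exprn_ge0 _ (ltW C20)) ?addr_ge0 ?(ltW a0).
rewrite scaled_weightE//.
have [_ growth] := H _ (frequencies_Omega n0 kn).
rewrite -/(z n k) in growth.
set D := _ - _ in growth *; set K := full_occupation n k.
set S := sqdist (z n k) (yn n) in growth *.
have S0 : 0 <= S := sqdist_ge0 _ _.
(* The power [p.+2] of [E] is the half of the Gaussian decay that is spent. *)
pose E := expR (c / (2 * p.+2%:R) * (n%:R * S)).
have E1 : 1 <= E.
  by rewrite -expR0 ler_expR mulr_ge0 ?divr_ge0 ?mulr_ge0// ltW.
have factor i : s n / stirling_factor (K 0 i) <= C2 * E.
  have stK := @stirling_factor_gt0 R (K 0 i).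
  have [big|small] := leP (mu * n%:R) (K 0 i)%:R.
    apply: (@le_trans _ _ (a1 * Num.sqrt mu)^-1); last first.
      rewrite (@le_trans _ _ C2) ?ler_peMr ?(ltW C20)//.
      by rewrite lerDl invr_ge0 mulr_ge0 ?(ltW a1_gt0) ?(ltW eps0).
    have K0 : (0 < K 0%R i)%N by rewrite -(ltr0n R) (lt_le_trans _ big)// mulr_gt0.
    rewrite ler_pdivrMr// mulrC ler_pdivlMr ?mulr_gt0 ?sqrtr_gt0//.
    rewrite mulrCA (le_trans _ (st_ge _ K0))// ler_wpM2l ?(ltW a1_gt0)//.
    by rewrite mulrC -sqrtrM ?(ltW mu0)// ler_sqrt// ltW.
  have st1 : a1 <= stirling_factor (K 0 i).
    have [->//|K0] := posnP (K 0 i); apply: le_trans (st_ge _ K0).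
    rewrite ler_peMr ?(ltW a1_gt0)// -[leLHS]sqrtr1 ler_sqrt ?ler1n//.
  apply: (@le_trans _ _ (n%:R / a1)).
    have s1 : 1 <= s n by rewrite -[leLHS]sqrtr1 ler_sqrt ?ler1n ?ler0n.
    have s_le : s n <= n%:R by rewrite -[leRHS]s2 ler_peMl// ltW.
    have inv_le : (stirling_factor (K 0 i))^-1 <= a1^-1 by rewrite lef_pV2 ?posrE.
    by apply: ler_pM => //; rewrite ?invr_ge0; exact: ltW.
  have Smu : mu ^+ 2 <= S.
    apply: le_trans (sqdist_coord _ _ i); rewrite /z [frequencies n _ 0 i]mxE -/K.
    have : (K 0 i)%:R / n%:R < mu by rewrite ltr_pdivrMr.
    have := ymu i; move: ((K 0 i)%:R / n%:R) (yn n 0 i) => u v h1 h2.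
    have h3 : mu <= v - u by move: h1 h2; lra.
    have h4 : 0 <= v - u by exact: le_trans (ltW mu0) h3.
    have h5 : 0 <= v - u - mu by rewrite subr_ge0.
    have := mulr_ge0 h5 (addr_ge0 h4 (ltW mu0)); lra.
  have : eps * n%:R <= E.
    apply: le_trans (_ : expR (eps * n%:R) <= _).
      by have := expR_ge1Dx (eps * n%:R); apply: le_trans; rewrite lerDr.
    have -> : eps * n%:R = c / (2 * p.+2%:R) * (n%:R * mu ^+ 2) by rewrite /eps; ring.
    by rewrite ler_expR ler_pM2l ?divr_gt0 ?mulr_gt0// ler_pM2l.
  move=> hE; apply: (@le_trans _ _ ((a1 * eps)^-1 * E)).
    rewrite invfM -mulrA mulrC ler_pM2l ?invr_gt0// ler_pdivlMl//.
  rewrite ler_wpM2r ?expR_ge0// lerDr invr_ge0 mulr_ge0 ?sqrtr_ge0// ltW//.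
have sum_ge : \sum_i deviation n k 0 (lift ord0 i) ^+ 2 <= n%:R * S.
  rewrite /S sqdist_deviation// [leRHS]big_ord_recl lerDr; exact: sqr_ge0.
apply: (@le_trans _ _ ((a + 1) * (C2 * E) ^+ p.+2 * expR (- (n%:R * D)))).
  rewrite ler_wpM2r ?expR_ge0//; apply: ler_pM.
  - by rewrite divr_ge0 ?ltW// stirling_factor_gt0.
  - apply: prodr_ge0 => i _.
    by rewrite divr_ge0 ?(ltW sn)// ltW// stirling_factor_gt0.
  - exact: ltW.
  rewrite -[X in _ <= _ ^+ X]card_ord -prodr_const; apply: ler_prod => i _.
  by rewrite factor divr_ge0 ?(ltW sn)// ltW// stirling_factor_gt0.
rewrite exprMn mulrA -mulrA ler_wpM2l//.
  by rewrite mulr_ge0 ?(exprn_ge0 _ (ltW C20)) ?addr_ge0 ?(ltW a0).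
rewrite -expRM_natl -expRD ler_expR.
have -> : p.+2%:R * (c / (2 * p.+2%:R) * (n%:R * S)) = c / 2 * (n%:R * S).
  by field.
have h1 := ler_wpM2l (ltW nR) growth.
have h2 : c / 2 * \sum_i deviation n k 0 (lift ord0 i) ^+ 2 <= c / 2 * (n%:R * S).
  by rewrite ler_wpM2l// divr_ge0// ltW.
move: h1 h2; rewrite mulrCA; move: (n%:R * S) (n%:R * D) (\sum_i _) => u v q; lra.
Unshelve. all: by end_near. Qed.

(** The sum-zero vector with given last coordinates. *)
Definition balanced m (w : 'rV[R]_m) : 'rV[R]_m.+1 := rV_cons (- \sum_i w 0 i) w.

Section along_sequence.
Variables (k : nat -> 'rV[nat]_p.+1) (w : 'rV[R]_p.+1).
Hypothesis k_cvg : forall i,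
  ((k n 0 i)%:R - n%:R * yn n 0 (lift ord0 i)) / s n @[n --> \oo] --> w 0 i.

Lemma near_sum_le : \forall n \near \oo, (\sum_i k n 0%R i <= n)%N.
Proof.
have lim : \sum_i (k n 0 i)%:R / n%:R @[n --> \oo] --> \sum_i x 0 (lift ord0 i).
  apply: cvg_sumr => i.
  exact: (@frequency_cvg R (fun n => k n 0 i) _ _ _ (@yn_cvg _) (@k_cvg i)).
have lt1 : \sum_i x 0 (lift ord0 i) < 1.
  by rewrite -x_sum [ltRHS]big_ord_recl ltrDr.
have h := cvgr_lt _ lim _ lt1.
near=> n.
have n0 : (0 < n)%N by near: n; exact: nbhs_infty_gt.
have : \sum_i (k n 0 i)%:R / n%:R < 1 :> R by near: n; exact: h.
by rewrite -mulr_suml ltr_pdivrMr ?ltr0n// mul1r -natr_sum ltr_nat => /ltnW.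
Unshelve. all: by end_near. Qed.

Lemma deviation_cvg i : deviation n (k n) 0 i @[n --> \oo] --> balanced w 0 i.
Proof.
case: (unliftP ord0 i) => [j ->|->].
  rewrite /balanced rV_consS; apply: (cvg_trans _ (@k_cvg j)).
  by apply: near_eq_cvg; apply: nearW => n; rewrite mxE /full_occupation rV_consS.
rewrite /balanced rV_cons0.
have lim : - \sum_i ((k n 0 i)%:R - n%:R * yn n 0 (lift ord0 i)) / s n
    @[n --> \oo] --> - \sum_i w 0 i.
  by apply: cvgN; apply: cvg_sumr => j; exact: k_cvg.
apply: cvg_trans lim; apply: near_eq_cvg; near=> n.
have kn : (\sum_i k n 0%R i <= n)%N by near: n; exact: near_sum_le.
have [y1 _ _] : quadratic_well c (betan n) (hn n) (yn n) by near: n.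
rewrite mxE /full_occupation rV_cons0 -mulr_suml sumrB -mulr_sumr natrB// natr_sum.
have -> : yn n 0 ord0 = 1 - \sum_i yn n 0 (lift ord0 i).
  by rewrite -[X in _ = X - _]y1 big_ord_recl addrK.
ring.
Unshelve. all: by end_near. Qed.

Lemma full_occupation_cvg i :
  ((full_occupation n (k n) 0 i)%:R - n%:R * yn n 0 i) / s n @[n --> \oo] --> balanced w 0 i.
Proof.
by apply: (cvg_trans _ (@deviation_cvg i)); apply: near_eq_cvg; apply: nearW => n; rewrite mxE.
Qed.

(** Each factor of [scaled_weightE] converges: the Stirling ratios to the prefactor,
    the exponent to half the Hessian at [x]. *)
Lemma scaled_weight_cvg_along (a : R) : 0 < a ->
  stirling_factor j / s j @[j --> \oo] --> a ->
  scaled_weight n (k n) @[n --> \oo] -->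
  a * \prod_i (a * Num.sqrt (x 0 i))^-1 *
  expR (- (\sum_i balanced w 0 i ^+ 2 * ((x 0 i)^-1 - beta) / 2)).
Proof.
move=> a0 a_cvg.
have lim : stirling_factor n / s n *
    \prod_i (s n / stirling_factor (full_occupation n (k n) 0 i)) *
    expR (- (\sum_i n%:R * (yn n 0 i * psi (((full_occupation n (k n) 0 i)%:R / n%:R
        - yn n 0 i) / yn n 0 i))
      - betan n / 2 * \sum_i deviation n (k n) 0 i ^+ 2)) @[n --> \oo] -->
  a * \prod_i (a * Num.sqrt (x 0 i))^-1 *
  expR (- (\sum_i balanced w 0 i ^+ 2 / (2 * x 0 i) -
       beta / 2 * \sum_i balanced w 0 i ^+ 2)).
  apply: cvgM.
    apply: cvgM => //; apply: cvg_prodr => i.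
    exact: (@stirling_term_cvg R (fun n => full_occupation n (k n) 0 i)
      (fun n => yn n 0 i) _ _ (x_gt0 i) (@yn_cvg i) (@full_occupation_cvg i)).
  apply: (@cvg_comp _ _ _ (fun n => - (\sum_i n%:R * (yn n 0 i *
      psi (((full_occupation n (k n) 0 i)%:R / n%:R - yn n 0 i) / yn n 0 i))
      - betan n / 2 * \sum_i deviation n (k n) 0 i ^+ 2)) expR); last first.
    exact: continuous_expR.
  apply: cvgN; apply: cvgB.
    apply: cvg_sumr => i.
    exact: (@entropy_term_cvg R (fun n => full_occupation n (k n) 0 i)
      (fun n => yn n 0 i) _ _ (x_gt0 i) (@yn_cvg i) (@full_occupation_cvg i)).
  apply: cvgM; first by apply: cvgM => //; exact: cvg_cst.
  by apply: cvg_sumr => i; apply: cvg_sqr; exact: deviation_cvg.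
rewrite (_ : \sum_i balanced w 0 i ^+ 2 * ((x 0 i)^-1 - beta) / 2 =
    \sum_i balanced w 0 i ^+ 2 / (2 * x 0 i) - beta / 2 * \sum_i balanced w 0 i ^+ 2); last first.
  rewrite mulr_sumr -sumrB; apply: eq_bigr => i _.
  by field; rewrite gt_eqF.
apply: cvg_trans lim; apply: near_eq_cvg; near=> n.
have n0 : (0 < n)%N by near: n; exact: nbhs_infty_gt.
have kn : (\sum_i k n 0%R i <= n)%N by near: n; exact: near_sum_le.
have [y1 _ H] : quadratic_well c (betan n) (hn n) (yn n) by near: n.
rewrite scaled_weightE//; congr (_ * expR (- _)).
have [-> _] := H _ (frequencies_Omega n0 kn).
rewrite mulrBr -sqdist_deviation//; congr (_ - _); last by rewrite /z; ring.
by rewrite mulr_sumr; apply: eq_bigr => i _; rewrite [frequencies n _ 0 i]mxE.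
Unshelve. all: by end_near. Qed.

End along_sequence.

Let sqrtn_mul_cvgy (u : nat -> R) (l : R) : 0 < l -> u n @[n --> \oo] --> l ->
  s n * u n @[n --> \oo] --> +oo.
Proof.
move=> l0 ul; have l20 : 0 < l / 2 by rewrite divr_gt0.
have l2l : l / 2 < l by rewrite ltr_pdivrMr// ltr_pMr// ltr1n.
apply/cvgryPge => y.
have u_large := cvgr_gt _ ul _ l2l.
have /cvgryPge/(_ (`|y| / (l / 2))) s_large := @sqrtn_cvgy R.
near=> n; have un : l / 2 < u n by near: n; exact: u_large.
have sn : `|y| / (l / 2) <= s n by near: n; exact: s_large.
apply: le_trans (ler_norm y) _; rewrite -[leLHS](@divfK _ (l / 2)) ?gt_eqF//.
by rewrite ler_pM ?divr_ge0// ltW.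
Unshelve. all: by end_near. Qed.

Definition lattice_mean (g : 'rV[R]_p.+2 -> R) n : R :=
  (s n)^-1 ^+ p.+1 *
  boxsum n (fun k => g (deviation n k) * scaled_weight n k).

Lemma lattice_mean_cvg : exists2 kappa, 0 < kappa &
  forall (g : 'rV[R]_p.+2 -> R) M, continuous g -> (forall v, `|g v| <= M) ->
  lattice_mean g n @[n --> \oo] -->
  iterint (fun w => kappa * g (balanced w) *
    expR (- (\sum_i balanced w 0 i ^+ 2 * ((x 0 i)^-1 - beta) / 2))).
Proof.
have [a a0 [a_cvg _]] := @stirling_factor_cvg R.
exists (a * \prod_i (a * Num.sqrt (x 0 i))^-1).
  rewrite mulr_gt0// prodr_gt0// => i _.
  by rewrite invr_gt0 mulr_gt0// sqrtr_gt0.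
move=> g M gc gM; have M0 : 0 <= M := le_trans (normr_ge0 _) (gM 0).
have [C C0 [N _ CP]] := scaled_weight_dominated.
(* The majorant holds for large [n] only, whereas [lattice_sum_cvg] asks for all [n]. *)
pose t n k := if (N <= n)%N then g (deviation n k) * scaled_weight n k else 0.
pose center n (i : 'I_p.+1) := n%:R * yn n 0 (lift ord0 i).
have nsE n : n%:R / s n = s n.
  have [->|n0] := eqVneq (s n) 0; first by rewrite invr0 mulr0.
  by apply: (mulIf n0); rewrite divfK// -expr2 sqr_sqrtr.
suff : (s n)^-1 ^+ p.+1 * boxsum n (t n) @[n --> \oo] -->
    iterint (fun w => a * (\prod_i (a * Num.sqrt (x 0 i))^-1) * g (balanced w) *
    expR (- (\sum_i balanced w 0 i ^+ 2 * ((x 0 i)^-1 - beta) / 2))).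
  apply: cvg_trans; apply: near_eq_cvg; exists N => // n /= Nn.
  by rewrite /lattice_mean; congr (_ * _); apply: eq_boxsum => k; rewrite /t Nn.
apply: (@lattice_sum_cvg R _ center t _ (M * C) (c / 2)).
- by rewrite divr_gt0.
- move=> n k; rewrite /t; case: ifPn => Nn; last first.
    by rewrite normr0 mulr_ge0 ?mulr_ge0 ?expR_ge0.
  rewrite normrM -[leRHS]mulrA; apply: ler_pM => //.
  rewrite (ger0_norm (scaled_weight_ge0 n k)).
  apply: le_trans (CP n Nn k) _; rewrite le_eqVlt; apply/orP; left; apply/eqP.
  congr (_ * expR (- (_ * _))); apply: eq_bigr => i _.
  by rewrite mxE /full_occupation rV_consS.
- move=> i; under eq_fun do rewrite /center mulrAC nsE.
  exact: (sqrtn_mul_cvgy (x_gt0 (lift ord0 i)) (@yn_cvg _)).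
- move=> i; have x1 : 0 < 1 - x 0 (lift ord0 i).
    rewrite -x_sum (bigD1 (lift ord0 i))//= addrC addrK.
    rewrite (bigD1 ord0)//= ltr_pwDl// sumr_ge0// => j _; exact: ltW.
  have lim : 1 - yn n 0 (lift ord0 i) @[n --> \oo] --> 1 - x 0 (lift ord0 i).
    by apply: cvgB => //; exact: cvg_cst.
  have := sqrtn_mul_cvgy x1 lim.
  apply: cvg_trans; apply: near_eq_cvg; apply: nearW => n.
  by rewrite /center mulrBr mulr1 mulrBl mulrAC nsE.
- move=> k w kw; have dev := deviation_cvg kw.
  have weight := scaled_weight_cvg_along kw a0 a_cvg.
  have glim : g (deviation n (k n)) @[n --> \oo] --> g (balanced w).
    apply: (@cvg_comp _ _ _ (fun n => deviation n (k n)) g) (gc _).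
    by apply: cvg_rV.
  have lim : g (deviation n (k n)) * scaled_weight n (k n) @[n --> \oo] -->
      a * (\prod_i (a * Num.sqrt (x 0 i))^-1) * g (balanced w) *
      expR (- (\sum_i balanced w 0 i ^+ 2 * ((x 0 i)^-1 - beta) / 2)).
    by rewrite [_ * g (balanced w)]mulrC -mulrA; exact: cvgM glim weight.
  apply: cvg_trans lim; apply: near_eq_cvg; exists N => // n /= Nn.
  by rewrite /t Nn.
Qed.

End local_limit.

(** * The limiting covariance matrix *)

Section covariance.
Context {R : realType} {p : nat}.
Local Notation m := (p.+1%:R : R).
Variables (beta x1 xq : R).
Hypothesis x1_gt0 : 0 < x1.
Hypothesis xq_gt0 : 0 < xq.
Hypothesis x_sum : x1 + m * xq = 1.
Let A := xq^-1 - beta.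
Let B := x1^-1 - beta.
Let rho := B / A.
Let D := A + m * B.
Hypothesis D_gt0 : 0 < D.
Hypothesis A_gt0 : (0 < p)%N -> 0 < A.

(** The Hessian of the free energy on sum-zero vectors, in the last coordinates. *)
Definition precision : 'M[R]_p.+1 := \matrix_(i, j) (B + A * (i == j)%:R).

Lemma bform_precision (b w : 'rV[R]_p.+1) : bform precision b w =
  B * (\sum_i b 0 i) * (\sum_i w 0 i) + A * \sum_i b 0 i * w 0 i.
Proof.
have -> : B * (\sum_i b 0 i) * (\sum_i w 0 i) = \sum_i \sum_j B * (b 0 i * w 0 j).
  rewrite -mulrA big_distrlr/= mulr_sumr; apply: eq_bigr => i _.
  by rewrite mulr_sumr.
rewrite /bform mulr_sumr -big_split/=; apply: eq_bigr => i _.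
have -> : A * (b 0 i * w 0 i) = \sum_j A * (i == j)%:R * (b 0 i * w 0 j).
  rewrite (bigD1 i)//= eqxx mulr1 big1 ?addr0// => j.
  by rewrite eq_sym => /negbTE->; rewrite mulr0 mul0r.
by rewrite -big_split/=; apply: eq_bigr => j _; rewrite mxE; ring.
Qed.

Lemma bform_precision_balanced (w : 'rV[R]_p.+1) : bform precision w w =
  \sum_i balanced w 0 i ^+ 2 * ((two_valued p x1 xq 0 i)^-1 - beta).
Proof.
rewrite bform_precision [RHS]big_ord_recl /balanced rV_cons0 mxE eqxx sqrrN -/B.
have -> : \sum_i rV_cons (- \sum_i w 0 i) w 0 (lift ord0 i) ^+ 2 *
    ((two_valued p x1 xq 0 (lift ord0 i))^-1 - beta) = A * \sum_i w 0 i * w 0 i.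
  rewrite mulr_sumr; apply: eq_bigr => i _.
  by rewrite rV_consS mxE/= -/A expr2 mulrC.
by rewrite expr2; ring.
Qed.

Let cov := limit_covariance p beta x1 xq.

Lemma covariance_scale : ((x1 * xq)^-1 - p.+2%:R * beta)^-1 = D^-1.
Proof.
congr _^-1; rewrite /D /A /B -[p.+2%:R]natr1.
have -> : (x1 * xq)^-1 = (x1 + m * xq) / (x1 * xq) by rewrite x_sum mul1r.
by field; rewrite !gt_eqF.
Qed.

Let contrast (u : 'rV[R]_p.+2) : 'rV[R]_p.+1 := \row_i (u 0 (lift ord0 i) - u 0 ord0).

(** The product of [v] with the inverse of [precision], a multiple of the identity
    plus a rank-one matrix (Sherman-Morrison formula). *)
Let solve (v : 'rV[R]_p.+1) : 'rV[R]_p.+1 :=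
  \row_j (D^-1 * ((1 + m * rho) * v 0 j - rho * \sum_i v 0 i)).

Let sum_solve v : \sum_i solve v 0 i = D^-1 * \sum_i v 0 i.
Proof.
under eq_bigr do rewrite mxE.
rewrite -mulr_sumr sumrB -mulr_sumr sumr_const card_ord -mulr_natl.
by congr (_ * _); ring.
Qed.

Lemma bform_solve (v w : 'rV[R]_p.+1) :
  bform precision (solve v) w = \sum_i v 0 i * w 0 i.
Proof.
have D0 : D != 0 by rewrite gt_eqF.
rewrite bform_precision sum_solve.
have [p0|p0] := posnP p.
  (* With a single coordinate [rho] cancels; it may be a quotient by [A = 0]. *)
  have one (f : 'I_p.+1 -> R) : \sum_i f i = f ord0.
    move: f; rewrite p0 => f; exact: big_ord1.
  have m1 : m = 1 by rewrite p0.
  rewrite !one mxE one m1; move: D0; rewrite /D m1 => D0; field.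
  by rewrite mul1r in D0 *.
have A0 : A != 0 by rewrite gt_eqF// A_gt0.
set V := \sum_i v 0 i.
have -> : \sum_i solve v 0 i * w 0 i =
    D^-1 * (1 + m * rho) * (\sum_i v 0 i * w 0 i) - D^-1 * rho * V * (\sum_i w 0 i).
  rewrite [_ * \sum_i v 0 i * w 0 i]mulr_sumr [_ * \sum_i w 0 i]mulr_sumr -sumrB.
  by apply: eq_bigr => i _; rewrite mxE -/V; ring.
have inv (a b k s t y : R) : a != 0 -> a + k * b != 0 ->
    b * ((a + k * b)^-1 * y) * t + a * ((a + k * b)^-1 * (1 + k * (b / a)) * s
      - (a + k * b)^-1 * (b / a) * y * t) = s.
  by move=> a0 d0; field; rewrite a0 d0.
exact: inv.
Qed.

Lemma row_cov0 (u : 'rV[R]_p.+2) : (u *m cov) 0 ord0 =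
  D^-1 * (m * u 0 ord0 - \sum_i u 0 (lift ord0 i)).
Proof.
rewrite mxE; set U := \sum_i u 0 (lift ord0 i).
rewrite big_ord_recl !mxE covariance_scale eqxx/=.
have -> : \sum_(i < p.+1) u 0 (lift ord0 i) * cov (lift ord0 i) ord0 = - D^-1 * U.
  by rewrite mulr_sumr; apply: eq_bigr => i _; rewrite !mxE covariance_scale/=; ring.
by rewrite -[p.+2%:R]natr1; ring.
Qed.

Lemma row_covS (u : 'rV[R]_p.+2) i : (u *m cov) 0 (lift ord0 i) =
  D^-1 * (- u 0 ord0 + (1 + m * rho) * u 0 (lift ord0 i)
    - rho * \sum_j u 0 (lift ord0 j)).
Proof.
rewrite mxE; set U := \sum_i u 0 (lift ord0 i).
rewrite big_ord_recl !mxE covariance_scale/=.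
have -> : \sum_(j < p.+1) u 0 (lift ord0 j) * cov (lift ord0 j) (lift ord0 i) =
    \sum_(j < p.+1) (D^-1 * (1 + m * rho) * (u 0 (lift ord0 j) * (j == i)%:R)
      - D^-1 * rho * u 0 (lift ord0 j)).
  apply: eq_bigr => j _; rewrite !mxE covariance_scale/= (inj_eq lift_inj) -/A -/B -/rho.
  have qE : p.+2%:R - 2 = m - 1 :> R by rewrite -[p.+2%:R]natr1; ring.
  by rewrite qE; case: (j == i); rewrite /= ?mulr1 ?mulr0; ring.
rewrite sumrB -!mulr_sumr (bigD1 i)//= eqxx mulr1 big1 ?addr0.
  by rewrite -/U; ring.
by move=> j /negbTE->; rewrite mulr0.
Qed.

Lemma quadratic_cov (u : 'rV[R]_p.+2) :
  (u *m cov *m u^T) 0 0 = bform precision (solve (contrast u)) (solve (contrast u)).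
Proof.
rewrite bform_solve.
set U := \sum_i u 0 (lift ord0 i); set U2 := \sum_i u 0 (lift ord0 i) ^+ 2.
transitivity (D^-1 * (m * u 0 ord0 ^+ 2 - 2 * u 0 ord0 * U + (1 + m * rho) * U2 - rho * U ^+ 2)).
  rewrite mxE big_ord_recl row_cov0 -/U [u^T _ _]mxE.
  under [X in _ + X = _]eq_bigr do rewrite row_covS [u^T _ _]mxE -/U.
  have -> : \sum_(i < p.+1) D^-1 * (- u 0 ord0 + (1 + m * rho) * u 0 (lift ord0 i) - rho * U) *
       u 0 (lift ord0 i) = D^-1 * (- u 0 ord0 - rho * U) * U + D^-1 * (1 + m * rho) * U2.
    transitivity (\sum_(i < p.+1) (D^-1 * (- u 0 ord0 - rho * U) * u 0 (lift ord0 i)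
        + D^-1 * (1 + m * rho) * u 0 (lift ord0 i) ^+ 2)).
      by apply: eq_bigr => i _; ring.
    by rewrite big_split/= -!mulr_sumr.
  by ring.
have sum_contrast : \sum_i contrast u 0 i = U - m * u 0 ord0.
  by under eq_bigr do rewrite mxE; rewrite sumrB sumr_const card_ord mulr_natl.
have sum_contrast2 : \sum_i contrast u 0 i * contrast u 0 i =
    U2 - 2 * u 0 ord0 * U + m * u 0 ord0 ^+ 2.
  have -> : m * u 0 ord0 ^+ 2 = \sum_(i < p.+1) u 0 ord0 ^+ 2.
    by rewrite sumr_const card_ord mulr_natl.
  rewrite /U2 [_ * U]mulr_sumr -sumrB -big_split/=; apply: eq_bigr => i _.
  by rewrite mxE; ring.
transitivity (\sum_i (D^-1 * (1 + m * rho) * (contrast u 0 i * contrast u 0 i)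
    - D^-1 * rho * (\sum_j contrast u 0 j) * contrast u 0 i)).
  rewrite sumrB -!mulr_sumr sum_contrast2 sum_contrast.
  have mrho : D^-1 * m * u 0 ord0 ^+ 2 = D^-1 * m * u 0 ord0 ^+ 2 by [].
  by ring.
by apply: eq_bigr => i _; rewrite [solve _ _ _]mxE; ring.
Qed.

Lemma dot_balanced (u : 'rV[R]_p.+2) (w : 'rV[R]_p.+1) :
  (balanced w *m u^T) 0 0 = bform precision (solve (contrast u)) w.
Proof.
rewrite bform_solve mxE big_ord_recl /balanced !rV_cons0 [u^T _ _]mxE.
under [X in _ + X = _]eq_bigr do rewrite rV_consS [u^T _ _]mxE.
under [RHS]eq_bigr do rewrite mxE mulrBl.
rewrite sumrB -mulr_sumr addrC mulNr [u 0 ord0 * _]mulrC; congr (_ - _).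
by apply: eq_bigr => i _; rewrite mulrC.
Qed.

(** Take [b = solve (contrast u)]. As [balanced w] sums to 0, its product with [u]
    is the one of [w] with [contrast u], and [solve] inverts [precision]. This
    turns the linear forms of [exists_gaussian] into those of the limit. *)
Lemma precision_dual (u : 'rV[R]_p.+2) : exists b : 'rV[R]_p.+1,
  (forall w, (balanced w *m u^T) 0 0 = bform precision b w) /\
  (u *m cov *m u^T) 0 0 = bform precision b b.
Proof.
by exists (solve (contrast u)); split=> [w|]; rewrite ?dot_balanced ?quadratic_cov.
Qed.

Hypothesis coercive : exists2 c, 0 < c & forall w : 'rV[R]_p.+2, sum_zero w ->
  c * \sum_i w 0 i ^+ 2 <=
    \sum_i w 0 i ^+ 2 * ((two_valued p x1 xq 0 i)^-1 - beta).

Lemma posdef_precision : posdef precision.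
Proof.
have [c c0 cP] := coercive.
split=> [i j|w w0]; first by rewrite !mxE eq_sym.
rewrite bform_precision_balanced; apply: lt_le_trans (cP (balanced w) _); last first.
  rewrite /sum_zero/= big_ord_recl /balanced rV_cons0.
  by under [X in _ + X = _]eq_bigr do rewrite rV_consS; rewrite addNr.
have /existsP[i wi] : [exists i, w 0 i != 0].
  apply: contraNT w0 => /existsPn w0; apply/eqP/rowP => i; rewrite mxE.
  by apply/eqP/negPn/w0.
rewrite mulr_gt0// (bigD1 (lift ord0 i))//= ltr_pwDl//.
  by rewrite /balanced rV_consS exprn_even_gt0// wi orbT.
by apply: sumr_ge0 => j _; exact: sqr_ge0.
Qed.

(** If [u] is in the kernel, its quadratic form [bform precision b b] is 0, so [b]
    and thus [contrast u] vanish: the kernel is the line of constant vectors. *)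
Lemma rank_limit_covariance : \rank cov = p.+1.
Proof.
suff kerE : (kermx cov :=: (const_mx 1 : 'rV[R]_p.+2))%MS.
  have := mxrank_ker cov; rewrite kerE rank_rV.
  have -> : (const_mx 1 : 'rV[R]_p.+2) != 0.
    by apply/eqP => /rowP/(_ ord0); rewrite !mxE => /eqP; rewrite oner_eq0.
  by have := rank_leq_row cov; move=> /= /[swap] /eqP; rewrite eq_sym; lia.
apply/eqmxP/andP; split.
  apply/rV_subP => u /sub_kermxP ucov.
  have q0 : (u *m cov *m u^T) 0 0 = 0 by rewrite ucov mul0mx mxE.
  have s0 : solve (contrast u) = 0.
    apply/eqP/negPn/negP => /(posdef_precision.2).
    by rewrite -quadratic_cov q0 ltxx.
  have c0 i : contrast u 0 i = 0.
    have := bform_solve (contrast u) (\row_j (j == i)%:R).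
    rewrite s0 /bform.
    under eq_bigr do (under eq_bigr do rewrite mxE !mul0r; rewrite big1//).
    rewrite big1// (bigD1 i)//= mxE eqxx mulr1 big1 ?addr0//.
    by move=> j /negbTE ji; rewrite mxE ji mulr0.
  apply/sub_rVP; exists (u 0 ord0); apply/rowP => i; rewrite !mxE mulr1.
  have [j ->|->//] := unliftP ord0 i.
  by have /eqP := c0 j; rewrite mxE subr_eq0 => /eqP.
have sum1 : \sum_(j < p.+1) (const_mx 1 : 'rV[R]_p.+2) 0 (lift ord0 j) = m.
  by under eq_bigr do rewrite mxE; rewrite sumr_const card_ord.
apply/sub_kermxP/rowP => j; rewrite [RHS]mxE.
have [i ->|->] := unliftP ord0 j; rewrite ?row_covS ?row_cov0 sum1 !mxE; ring.
Qed.

End covariance.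

(** * Convergence in law *)

Section convergence.
Context {R : realType} {p : nat}.
Local Notation s n := (Num.sqrt (n%:R : R)).

(** The partition function and the normalization of [scaled_weight] are common to
    both lattice means. *)
Lemma potts_expectation_ratio (betan hn : nat -> R) (yn : nat -> 'rV[R]_p.+2) n (g : 'rV[R]_p.+2 -> R)
    (W : config p n -> 'rV[R]_p.+2) : (0 < n)%N ->
  (forall c i, W c 0 i = ((occupation c i)%:R - n%:R * yn n 0 i) / s n) ->
  ('E_(potts (betan n) (hn n) n)[g \o W] =
   (lattice_mean betan hn yn g n / lattice_mean betan hn yn (fun=> 1) n)%R%:E)%E.
Proof.
move=> n0 WE; rewrite expectation_potts; congr _%:E.
pose norm := (s n)^-1 ^+ p.+1 * (s n ^+ p.+1 *
  expR (n%:R * free_energy (betan n) (hn n) (yn n) + betan n / 2)).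
have norm0 : norm != 0.
  by rewrite !mulf_neq0 ?expf_neq0 ?invr_eq0 ?gt_eqF ?sqrtn_gt0 ?expR_gt0.
have meanE f : lattice_mean betan hn yn f n =
    norm * \sum_(c : config p n) f (\row_i (((occupation c i)%:R - n%:R * yn n 0 i) / s n))
      * expR (potts_exponent (betan n) (hn n) c).
  pose F (K : 'rV[nat]_p.+2) := f (\row_i (((K 0 i)%:R - n%:R * yn n 0 i) / s n))
    * potts_weight (betan n) (hn n) n K.
  transitivity (norm * \sum_(c : config p n) F (\row_i occupation c i)).
    rewrite sum_config /lattice_mean /norm -mulrA; congr (_ * _).
    by rewrite -boxsumZ; apply: eq_boxsum => k; rewrite /F /scaled_weight; ring.
  congr (_ * _); apply: eq_bigr => c _; rewrite /F potts_exponentE /potts_weight.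
  rewrite [(\row_i occupation c i) 0 ord0]mxE; congr (f _ * expR (_ * (_ - _) + _)).
    by apply/rowP => i; rewrite !mxE.
  by apply: eq_bigr => i _; rewrite mxE.
rewrite !meanE -mulf_div divff// mul1r.
rewrite mulr_suml; apply: eq_bigr => c _.
rewrite /potts_pmf /potts_Z mulrA; congr (g _ * _ / _).
  by apply/rowP => i; rewrite mxE -WE.
by apply: eq_bigr => c' _; rewrite mul1r.
Qed.

End convergence.

Section potts_convergence.
Context {R : realType} {p : nat}.

Lemma bounded_fun_le (g : 'rV[R]_p.+2 -> R) : bounded_fun g ->
  exists M, forall v, `|g v| <= M.
Proof.
by move=> [M [_ /(_ (M + 1))]]; rewrite ltrDl ltr01 => /(_ isT) gM; exists (M + 1) => v; exact: gM.
Qed.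

Lemma random_vector_balanced d (T : measurableType d) (G : T -> 'rV[R]_p.+1) :
  random_vector G -> random_vector (fun t => balanced (G t)).
Proof.
move=> mG i; have [j ->|->] := unliftP ord0 i.
  by under eq_fun do rewrite /= /balanced rV_consS; exact: mG.
under eq_fun do rewrite /= /balanced rV_cons0.
apply: measurableT_comp => //.
by apply: measurable_sum => j; exact: mG.
Qed.

Lemma expectation_bounded d (T : measurableType d) (Q : probability T R)
    (f : T -> R) M : measurable_fun [set: T] f -> (forall t, `|f t| <= M) ->
  ('E_Q[f] = (\int[Q]_t f t)%R%:E)%E.
Proof.
move=> mf fM; rewrite unlock /Rintegral fineK//.
by apply: integrable_fin_num => //; exact: bounded_integrable mf fM.
Qed.

End potts_convergence.

Theorem theorem3p1 (R : realType) (p : nat)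
    (betan hn : nat -> R) (beta h : R)
    (cvg_betan_hn : (betan n, hn n) @[n --> \oo] --> (beta, h))
    (beta_ge0 : 0 <= beta) (h_ge0 : 0 <= h)
    (neq_critical : (beta, h) <> (beta0 R p, h0 R p))
    (x1 xq : R) (x : 'rV[R]_p.+2) (xE : x = two_valued p x1 xq)
    (x_min : global_minimizer beta h x)
    (x_unique : forall y : 'rV[R]_p.+2, global_minimizer beta h y -> y = x)
    (dn : nat -> 'rV[R]_p.+2)
    (dnP : forall n, (0 < n)%N ->
      smallest_minimizer_shift (betan n) (hn n) x (dn n))
    (W : forall n, config p n -> 'rV[R]_p.+2)
    (WP : forall n (s : config p n), (0 < n)%N ->
      empirical_vector R s =
        n%:R *: x + n%:R *: dn n + Num.sqrt n%:R *: W n s) :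
  (exists (d : measure_display) (T : measurableType d) (P : probability T R)
     (G : T -> 'rV[R]_p.+2),
     centered_gaussian_vector P (limit_covariance p beta x1 xq) G /\
     converges_in_law (fun n => potts (betan n) (hn n) n) W P G) /\
  \rank (limit_covariance p beta x1 xq) = p.+1.
Proof.
have betan_cvg : betan n @[n --> \oo] --> beta.
  exact: (cvg_comp _ _ cvg_betan_hn (@cvg_fst _ _ _ _ _)).
have hn_cvg : hn n @[n --> \oo] --> h.
  exact: (cvg_comp _ _ cvg_betan_hn (@cvg_snd _ _ _ _ _)).
have x_gt0 := global_minimizer_gt0 x_min.
have x_sum : \sum_i x 0 i = 1 := x_min.1.1.
have xmin := x_min; rewrite xE in xmin.
have [x1_gt0 xq_gt0] := two_valued_gt0 xmin.
have x1q := two_valued_sum xmin.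
have radial := radial_curvature_gt0 xmin neq_critical.
have angular := angular_curvature_gt0 xmin h_ge0 neq_critical.
have coercive := hessian_coercive xmin h_ge0 neq_critical.
split; last exact: rank_limit_covariance.
have [c0 c0_gt0] := coercive; rewrite -xE => hess.
pose yn n := x + dn n.
have yn_cvg : forall i, yn n 0 i @[n --> \oo] --> x 0 i.
  by move=> i; exact: (perturbed_minimizer_cvg betan_cvg hn_cvg x_min x_unique dnP).
have [c c_gt0 yn_near] :=
  perturbed_minimizer_well betan_cvg hn_cvg x_min x_unique dnP c0_gt0 hess.
have [d [T [Q [G [mG law [cG cG_gt0 intG]]]]]] :=
  exists_gaussian (posdef_precision coercive).
exists d, T, Q, (fun t => balanced (G t)); split.
  split=> [|u A mA]; first exact: random_vector_balanced.
  have [b [dotE quadE]] :=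
    precision_dual x1_gt0 xq_gt0 x1q radial angular u.
  rewrite quadE -law//; congr (Q _); apply/seteqP.
  by split=> t /=; rewrite dotE.
move=> g gc /bounded_fun_le [M gM].
have [kappa kappa_gt0 mean] :=
  lattice_mean_cvg x_gt0 x_sum yn_cvg betan_cvg c_gt0 yn_near.
(* Both lattice means, that of [g] and that of 1, have the common factor
   [kappa * cG] in their limits, which leaves the expectation under [Q]. *)
have limE f N : continuous f -> (forall v, `|f v| <= N) ->
    lattice_mean betan hn yn f n @[n --> \oo] -->
    kappa * cG * \int[Q]_t f (balanced (G t)).
  move=> fc fN; have N0 : 0 <= N := le_trans (normr_ge0 _) (fN 0).
  have mf : Borel_measurable (fun w : 'rV[R]_p.+1 => f (balanced w)).
    move=> d' T' X mX.
    exact: (continuous_Borel_measurable fc (random_vector_balanced mX)).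
  have : iterint (fun w : 'rV[R]_p.+1 => kappa * f (balanced w) *
      expR (- (\sum_i balanced w 0 i ^+ 2 * ((x 0 i)^-1 - beta) / 2))) =
      kappa * cG * \int[Q]_t f (balanced (G t)).
    rewrite -mulrA mulrCA.
    have <- : \int[Q]_t (kappa * f (balanced (G t))) = kappa * \int[Q]_t f (balanced (G t)).
      rewrite RintegralZl//.
      by apply: (@bounded_integrable _ _ _ _ _ N); [exact: mf | move=> t; exact: fN].
    rewrite -(intG (fun w => kappa * f (balanced w)) (kappa * N)).
    + congr (iterint _); apply/funext => w; congr (_ * expR (- _)).
      by rewrite bform_precision_balanced mulr_suml -xE.
    + by move=> d' T' X mX; apply: measurable_funM => //; exact: (mf _ _ _ mX).
    + by move=> w; rewrite normrM gtr0_norm// ler_pM2l.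
  by move=> <-; exact: mean.
have limg := limE g M gc gM.
have lim1 : lattice_mean betan hn yn (fun=> 1) n @[n --> \oo] --> kappa * cG.
  have one_cont : continuous (fun _ : 'rV[R]_p.+2 => (1 : R)).
    exact: cst_continuous.
  have one_le : `|1 : R| <= 1 by rewrite normr1.
  have := limE (fun=> 1) 1 one_cont (fun=> one_le).
  by rewrite /Rintegral integral_cst//= probability_setT mule1 mulr1.
rewrite (@expectation_bounded _ _ _ _ _ M); last 2 first.
- exact: (continuous_Borel_measurable gc (random_vector_balanced mG)).
- by move=> t; exact: gM.
have lim : (lattice_mean betan hn yn g n / lattice_mean betan hn yn (fun=> 1) n)%:E
    @[n --> \oo] --> (\int[Q]_t g (balanced (G t)))%:E.
  have kc0 : kappa * cG != 0 by rewrite gt_eqF// mulr_gt0.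
  apply/fine_cvgP; split; first exact: nearW.
  rewrite [X in _ --> X](_ : _ = kappa * cG * \int[Q]_t g (balanced (G t)) / (kappa * cG)).
    by apply: cvgM => //; exact: cvgV.
  by rewrite mulrAC divff// mul1r.
apply: cvg_trans lim; apply: near_eq_cvg; near=> n.
have n0 : (0 < n)%N by near: n; exact: nbhs_infty_gt.
apply/esym; apply: potts_expectation_ratio => // cf i.
have /rowP/(_ i) := WP n cf n0; rewrite !mxE /yn /occupation natr_sum => ->.
have sn : Num.sqrt n%:R != 0 :> R by rewrite gt_eqF// sqrtn_gt0.
by field.
Unshelve. all: by end_near. Qed.
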